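(* Let $f:[a,b]\times\mathbb{R}^n\times\mathbb{R}^m\to\mathbb{R}^n$ be continuously differentiable and Lipschitz-continuous with respect to both its second argument $x$ and its third argument $u$, and let $x_a\in\mathbb{R}^n$. Let $u^{*}\in PC([a,b];\mathbb{R}^m)$ be a control input and $x^{*}\in PC^1([a,b];\mathbb{R}^n)$ its associated state trajectory, i.e. the solution of $${}^{A}_{C}D^{\alpha,\beta}_{a+}x^{*}(t)=f(t,x^{*}(t),u^{*}(t)),\quad t\in[a,b],\qquad x^{*}(a)=x_a.$$ Let $h\in PC([a,b];\mathbb{R}^m)$ and, for $\epsilon\in\mathbb{R}$, let $u^{\epsilon}(t)=u^{*}(t)+\epsilon h(t)$ for all $t\in[a,b]$, and let $x^{\epsilon}$ be the corresponding state trajectory, solution of $${}^{A}_{C}D^{\alpha,\beta}_{a+}x^{\epsilon}(t)=f(t,x^{\epsilon}(t),u^{\epsilon}(t)),\quad t\in[a,b],\qquad x^{\epsilon}(a)=x_a.$$ Then there exists a function $\eta$ defined on $[a,b]$ (with values in $\mathbb{R}^n$) such that, for $t\in[a,b]$, $$x^{\epsilon}(t)=x^{*}(t)+\epsilon\,\eta(t)+o(\epsilon)\qquad(\epsilon\to0).$$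
   Context: $n,m\in\mathbb{N}$ with $m\le n$. $PC$ and $PC^1$ denote piecewise continuous and piecewise continuously differentiable functions. Let $[a,b]$ be a real interval, $\alpha\in[0,1]$ a real parameter, $\beta$ a complex parameter with non-negative real part, and $R$ a positive number with $R>(b-a)^{\mathrm{Re}(\beta)}$. Let $A$ be a complex analytic function on the disc $D(0,R)$, given there by the locally uniformly convergent power series $A(x)=\sum_{n=0}^{\infty}a_nx^n$. The left-sided fractional integral of order $\alpha$ with general analytic kernel $A$ is $${}^{A}I^{\alpha,\beta}_{a+}x(t)=\int_a^t(t-s)^{\alpha-1}A\bigl((t-s)^{\beta}\bigr)x(s)\,ds.$$ For an analytic function $A$ used in an operator of order $\alpha$, put $A_\Gamma(x)=\sum_{n\ge0}a_n\Gamma(\beta n+\alpha)x^n$. Let $\bar A(x)=\sum_{n\ge0}\bar a_nx^n$ be the analytic function with $A_\Gamma\cdot\bar A_\Gamma=1$, where, $\bar A$ being used in operators of order $1-\alpha$, $\bar A_\Gamma(x)=\sum_{n\ge0}\bar a_n\Gamma(\beta n+1-\alpha)x^n$. The left Caputo fractional derivative with general analytic kernel is ${}^{A}_{C}D^{\alpha,\beta}_{a+}x(t)={}^{\bar A}I^{1-\alpha,\beta}_{a+}x'(t)$, acting componentwise on vector-valued functions. *)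

(* Defs.v *)
(* Over MathComp-Analysis, with R : realType, complex numbers R[i] and row
   vectors for R^n; the library norm on row vectors is the maximum norm. *)
From HB Require Import structures.
From mathcomp Require Import all_boot all_order all_algebra.
From mathcomp Require Import complex.
From mathcomp Require Import all_classical all_reals all_analysis.
Set Implicit Arguments.
Unset Strict Implicit.
Unset Printing Implicit Defensive.
Import Order.TTheory GRing.Theory Num.Theory.
Import numFieldNormedType.Exports.
Local Open Scope classical_set_scope.
Local Open Scope ring_scope.
Local Open Scope complex_scope.

Section Kernels.
Variable R : realType.
Local Notation C := R[i].
Implicit Types (z beta : C) (c : nat -> C) (D : set R).

(* x ^ z = exp (z ln x) for x > 0. *)
Definition cpowR (x : R) z : C :=
  (x `^ complex.Re z)%:C *
  (cos (complex.Im z * ln x) +i* sin (complex.Im z * ln x)).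

Definition Cintegral D (g : R -> C) : C :=
  (\int[lebesgue_measure]_(s in D) complex.Re (g s)) +i*
  (\int[lebesgue_measure]_(s in D) complex.Im (g s)).

Definition gamma_integral z : C :=
  Cintegral `]0, +oo[ (fun s => cpowR s (z - 1) * (expR (- s))%:C).

(* Euler's Gamma function on Re z > -1: the integral for Re z > 0, continued by
   Gamma z = Gamma (z + 1) / z.  At the pole z = 0 the value is 0, because
   z / 0 = 0 in the library. *)
Definition Gamma z : C :=
  if 0 < complex.Re z then gamma_integral z else gamma_integral (z + 1) / z.

(* F is the sum on the disc D(0, rho) of the locally uniformly convergent power
   series with coefficients c. *)
Definition analytic_on_disc (rho : R) c (F : C -> C) : Prop :=
  forall r : R, 0 < r -> r < rho ->
    {uniform [set z : C^o | `|z| <= r%:C],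
      (fun N (z : C^o) => \sum_(k < N) c k * z ^+ k : C^o) @ \oo
        --> (F : C^o -> C^o)}.

(* Coefficients of the transform A_Gamma, for a kernel with coefficients c used
   in an operator of order alpha. *)
Definition gamma_transform (alpha : R) beta c (k : nat) : C :=
  c k * Gamma (beta *+ k + alpha%:C).

(* The product of the power series with coefficients c and d is 1. The transform
   of a kernel with positive radius of convergence may have radius 0, so the
   product is the one of formal power series. *)
Definition series_reciprocal c (d : nat -> C) : Prop :=
  forall N : nat, \sum_(k < N.+1) c k * d (N - k)%N = (N == 0)%:R.

Definition frac_integral (A : C -> C) (alpha : R) beta (a : R) (x : R -> C)
    (t : R) : C :=
  Cintegral `[a, t] (fun s =>
    ((t - s) `^ (alpha - 1))%:C * A (cpowR (t - s) beta) * x s).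

(* Abar is the kernel dual to that of the operator. *)
Definition caputo (Abar : C -> C) (alpha : R) beta (a : R) (x : R -> R)
    (t : R) : C :=
  frac_integral Abar (1 - alpha) beta a (fun s => (derive1 x s)%:C) t.

End Kernels.

Section FunctionClasses.
Variable R : realType.

(* On every open subinterval ]p, q[ of the partition a :: s of [a, b], g is
   continuous with finite one-sided limits at p and q. *)
Definition continuous_pieces (V : normedModType R) (a : R) (s : seq R)
    (g : R -> V) : Prop :=
  forall i, (i < size s)%N ->
    let p := nth a (a :: s) i in let q := nth a s i in
    [/\ {in `]p, q[, continuous g},
        cvg (g t @[t --> p^'+]) & cvg (g t @[t --> q^'-])].

Definition PC (V : normedModType R) (a b : R) (g : R -> V) : Prop :=
  exists2 s, itv_partition a b s & continuous_pieces a s g.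

(* Piecewise C^1 functions are continuous across the breakpoints; at the
   breakpoints themselves the value of derive1 g is irrelevant. *)
Definition PC1 (V : normedModType R) (a b : R) (g : R -> V) : Prop :=
  {within `[a, b], continuous g} /\
  exists s, [/\ itv_partition a b s,
    forall i, (i < size s)%N ->
      {in `]nth a (a :: s) i, nth a s i[, forall t, derivable g t 1} &
    continuous_pieces a s (derive1 g)].

(* Continuous differentiability relative to a set D that need not be open, for
   finite-dimensional V: there, pointwise continuity of p |-> dg p v for each v
   is continuity of the differential in operator norm. *)
Definition C1_on (V W : normedModType R) (D : set V) (g : V -> W) : Prop :=
  exists dg : V -> {linear V -> W},
    (forall p, D p ->
      (fun q => g q - g p - dg p (q - p)) =o_ (within D (nbhs p))
      (fun q => q - p)) /\
    (forall v, {within D, continuous (fun p => dg p v)}).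

End FunctionClasses.

Section Control.
Variables (R : realType) (n m : nat).

Definition state_trajectory (Abar : R[i] -> R[i]) (alpha : R) (beta : R[i])
    (a b : R) (f : R -> 'rV[R]_n -> 'rV[R]_m -> 'rV[R]_n) (xa : 'rV[R]_n)
    (u : R -> 'rV[R]_m) (x : R -> 'rV[R]_n) : Prop :=
  [/\ PC1 a b x,
      forall t, t \in `[a, b] -> forall i,
        caputo Abar alpha beta a (fun s => x s ord0 i) t =
          (f t (x t) (u t) ord0 i)%:C &
      x a = xa].

End Control.

(* Main.v *)
(* Euler's Beta integral gives that t^(z-1) and t^(w-1) convolve to a multiple of
   t^(z+w-1), so A_Gamma * Abar_Gamma = 1 says that the kernels of the two
   fractional integrals convolve to the constant 1 on ]0, b - a]; by Fubini, a
   trajectory is therefore a solution of the Volterra equation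
   x(t) = xa + int_a^t K(t-s) f(s, x(s), u(s)) ds, with |K(t)| <= M t^(alpha-1).
   A weakly singular Gronwall inequality (weighted supremum norm) shows first
   that the quotients (xeps - xs) / eps are bounded, and then that their
   difference for two parameters eps, del is controlled by the difference of
   two difference quotients of f in a common bounded direction. The latter
   tends to 0 pointwise because f is differentiable, and in mean by dominated
   convergence. So the quotients are Cauchy as eps -> 0, and eta is their
   limit; the linearised equation need not be solved. *)

(* The obstacle is the passage from the formal identity for the transforms to the convolution
   identity. The Beta integral yields antidiagonal sums multiplied by Gamma(beta N + 1), and this
   factor has to be cancelled at complex arguments. So Gamma is shown to have no zero on Re z > 0,
   by an elementary estimate far to the right and the functional equation. Beta and Gamma are
   treated as integrals of kernels extended by 0 to the whole line, which lets Fubini do most of the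
   work. The strict inequality between (b - a)^Re(beta) and the radii leaves a geometric margin in
   the coefficients, enough to sum the double series absolutely and to pass to the limit under the
   integral. In the Gronwall step the weight exp(lam t) shrinks the mass of the singular kernel like
   lam^(-alpha). The same decay, together with a bounded remainder, upgrades convergence in mean to
   uniform convergence. The difference quotients of f converge pointwise in time but uniformly over
   bounded directions; this uniformity matters because the direction itself depends on the
   parameter. *)
Require Import Defs.
From HB Require Import structures.
From mathcomp Require Import all_boot all_order all_algebra.
From mathcomp Require Import complex.
From mathcomp Require Import all_classical all_reals all_analysis.
From mathcomp Require Import measurable_realfun ring lra.
Import Order.TTheory GRing.Theory Num.Theory.
Import numFieldNormedType.Exports.
Local Open Scope classical_set_scope.
Local Open Scope ring_scope.
Local Open Scope complex_scope.

Local Notation mu := lebesgue_measure.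

(** * Lebesgue integrals over the line *)

Section AffineChange.
Set Implicit Arguments.
Unset Strict Implicit.
Variable R : realType.
Implicit Types (f : R -> R).

Lemma measurable_affine (r c : R) :
  measurable_fun setT (fun x : measurableTypeR R => r * x + c : measurableTypeR R).
Proof. by apply: measurable_funD => //; apply: measurable_funM. Qed.

(** By uniqueness of Lebesgue measure it suffices that |r| times the pushforward agrees with it on
    the intervals ]x, y]. For r < 0 the preimage of such an interval is closed on the left instead
    of on the right. *)
Lemma lebesgue_measure_affine_preimage (r c : R) (A : set (measurableTypeR R)) : r != 0 ->
  measurable A ->
  mu A = (`|r|%:E * mu ((fun x : R => r * x + c)%R @^-1` A))%E.
Proof.
move=> r0 mA.
have mphi := measurable_affine r c.
have nr : 0 <= `|r| by [].
pose m := measure_function_pushforward__canonical__measure_function_Measure mu mphi.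
have mE B : m B = mu ((fun x : R => r * x + c)%R @^-1` B) by [].
rewrite -mE.
suff -> : mu A = mscale (NngNum nr) m A by [].
apply: lebesgue_measure_unique => // X [[x y] /= _ <-].
rewrite /mscale/= mE.
have [rp|rn|/eqP] := ltgtP r 0; last by rewrite (negbTE r0).
  have -> : (fun x0 => r * x0 + c) @^-1` `]x, y]%classic
     = `[(y - c) / r, (x - c) / r[%classic.
    apply/seteqP; split => z /=; rewrite !in_itv/= => /andP[h1 h2]; apply/andP; split.
    - by rewrite ler_ndivrMr//; lra.
    - by rewrite ltr_ndivlMr//; lra.
    - by move: h2; rewrite ltr_ndivlMr//; lra.
    - by move: h1; rewrite ler_ndivrMr//; lra.
  rewrite !lebesgue_measure_itv/= !lte_fin ltr_nM2r ?invr_lt0//.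
  rewrite ltrD2r; case: ifPn => xy; last by rewrite mule0.
  rewrite -EFinB -EFinM; congr EFin; rewrite ltr0_norm//; field; exact: r0.
have -> : (fun x0 => r * x0 + c) @^-1` `]x, y]%classic
   = `](x - c) / r, (y - c) / r]%classic.
  apply/seteqP; split => z /=; rewrite !in_itv/= => /andP[h1 h2]; apply/andP; split.
  - by rewrite ltr_pdivrMr//; lra.
  - by rewrite ler_pdivlMr//; lra.
  - by move: h1; rewrite ltr_pdivrMr//; lra.
  - by move: h2; rewrite ler_pdivlMr//; lra.
rewrite !lebesgue_measure_itv/= !lte_fin ltr_pM2r ?invr_gt0//.
rewrite ltrD2r; case: ifPn => xy; last by rewrite mule0.
rewrite -EFinB -EFinM; congr EFin; rewrite gtr0_norm//; field; exact: r0.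
Qed.

Lemma ge0_integral_affine (r c : R) (f : R -> \bar R) : r != 0 ->
  measurable_fun setT f -> (forall x, (0 <= f x)%E) ->
  (\int[mu]_x f x = `|r|%:E * \int[mu]_x f (r * x + c)%R)%E.
Proof.
move=> r0 mf f0.
have mphi := measurable_affine r c.
have nr : 0 <= `|r| by [].
pose m := measure_function_pushforward__canonical__measure_function_Measure mu mphi.
have mE B : m B = mu ((fun x : R => r * x + c)%R @^-1` B) by [].
transitivity (\int[mscale (NngNum nr) m]_x f x)%E.
  apply: eq_measure_integral => A mA _.
  transitivity (`|r|%:E * m A)%E => //.
  by rewrite mE; exact: lebesgue_measure_affine_preimage.
rewrite ge0_integral_mscale//.
by congr (_ * _)%E; rewrite /m ge0_integral_pushforward// => x _.
Qed.

Lemma integral_affine (r c : R) (f : R -> \bar R) : r != 0 ->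
  measurable_fun setT f ->
  (\int[mu]_x f (r * x + c)%R = (`|r|^-1)%:E * \int[mu]_x f x)%E.
Proof.
move=> r0 mf.
have nr0 : `|r| != 0 by rewrite normr_eq0.
have H (g : R -> \bar R) : measurable_fun setT g -> (forall x, (0 <= g x)%E) ->
    (\int[mu]_x g (r * x + c)%R = (`|r|^-1)%:E * \int[mu]_x g x)%E.
  move=> mg g0; rewrite [in RHS](ge0_integral_affine c r0 mg)// muleA -EFinM.
  by rewrite mulVf// mul1e.
rewrite [LHS]integralE [in RHS]integralE.
(* A positive finite scalar distributes over subtraction even when infinities occur, so the positive
   and negative parts can be rescaled separately without integrability. *)
have mulB (x y z : \bar R) : (0 < x)%E -> x \is a fin_num ->
    (x * (y - z) = x * y - x * z)%E.
  case: x => // x hx _.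
  by case: y => [y||]; case: z => [z||] //=;
    rewrite ?(gt0_muley hx) ?(gt0_muleNy hx)//= -!EFinM mulrBr.
rewrite mulB ?lte_fin ?invr_gt0 ?normr_gt0//; congr (_ - _)%E.
  by rewrite -(H _ (measurable_funepos mf) (funepos_ge0 f)); apply: eq_integral => x _;
     rewrite -[in LHS]/((f \o (fun x => r * x + c)%R)) funepos_comp.
by rewrite -(H _ (measurable_funeneg mf) (funeneg_ge0 f)); apply: eq_integral => x _;
     rewrite -[in LHS]/((f \o (fun x => r * x + c)%R)) funeneg_comp.
Qed.
Lemma Rintegral_affine (r c : R) f : r != 0 -> measurable_fun setT f ->
  \int[mu]_x f (r * x + c) = `|r|^-1 * \int[mu]_x f x.
Proof.
move=> r0 mf; rewrite /Rintegral (@integral_affine r c (EFin \o f))//; last exact/measurable_EFinP.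
have r1 : 0 < `|r|^-1 by rewrite invr_gt0 normr_gt0.
by case: (\int[mu]_x _)%E => [x||] //=; rewrite mulr_infty gtr0_sg// mul1e mulr0.
Qed.

Lemma integrable_affine (r c : R) f : r != 0 ->
  mu.-integrable setT (EFin \o f) ->
  mu.-integrable setT (EFin \o (fun x => f (r * x + c))).
Proof.
move=> r0 /integrableP[mf fi].
apply/integrableP; split.
  exact: measurableT_comp mf (measurable_affine r c).
rewrite (@integral_affine r c (fun x => `|(f x)%:E|)%E)//; last exact: measurableT_comp.
exact: lte_mul_pinfty.
Qed.

End AffineChange.

(** * Fubini's theorem for iterated real-valued integrals *)

Section FubiniReal.
Set Implicit Arguments.
Unset Strict Implicit.
Variable R : realType.
Implicit Types (f H : R -> R -> R).

(** Every section, not merely almost every one, is integrable. Real iterated integrals then agree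
    with the extended ones, since [fine] never meets an infinite inner integral. *)
Definition fubini_dominating H :=
  [/\ measurable_fun setT (fun p : R * R => H p.1 p.2),
      forall x, mu.-integrable setT (EFin \o H x),
      forall y, mu.-integrable setT (EFin \o H^~ y) &
      mu.-integrable setT (EFin \o (fun x => \int[mu]_y H x y))].

Variables (f H : R -> R -> R).
Hypothesis domH : fubini_dominating H.
Hypothesis mf : measurable_fun setT (fun p : R * R => f p.1 p.2).
Hypothesis fH : forall x y, `|f x y| <= H x y.

Let mf1 x : measurable_fun setT (f x).
Proof. exact: measurableT_comp mf (measurable_pair1 _). Qed.

Let mf2 y : measurable_fun setT (f^~ y).
Proof. exact: measurableT_comp mf (measurable_pair2 _). Qed.

Lemma dominated_integrable1 x : mu.-integrable setT (EFin \o f x).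
Proof.
case: domH => _ iH _ _; apply: le_integrable (iH x) => //.
  by apply/measurable_EFinP; exact: mf1.
by move=> y _ /=; rewrite lee_fin (le_trans (fH x y))// ler_norm.
Qed.

Lemma dominated_integrable2 y : mu.-integrable setT (EFin \o f^~ y).
Proof.
case: domH => _ _ iH _; apply: le_integrable (iH y) => //.
  by apply/measurable_EFinP; exact: mf2.
by move=> x _ /=; rewrite lee_fin (le_trans (fH x y))// ler_norm.
Qed.

Let if12 : (mu \x mu)%E.-integrable setT (fun p : R * R => (f p.1 p.2)%:E).
Proof.
case: domH => mH iH1 iH2 iH; apply/integrable12ltyP.
  exact/measurable_EFinP.
case/integrableP : iH => mi; apply: le_lt_trans.
apply: ge0_le_integral => //.
- by move=> x _; apply: integral_ge0.
- apply: (measurable_fun_fubini_tonelli_F (m2 := mu) (fun p : R * R => `|(f p.1 p.2)%:E|%E)) => //=.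
  have mabs : measurable_fun setT (fun p : R * R => `|f p.1 p.2|).
    by apply: measurableT_comp mf.
  by apply/measurable_EFinP; exact: mabs.
- exact: measurableT_comp.
- move=> x _ /=.
  have H0 y : 0 <= H x y by rewrite (le_trans _ (fH x y)).
  rewrite ger0_norm ?Rintegral_ge0//.
  rewrite fineK; last by apply: integrable_fin_num => //; exact: iH1.
  apply: ge0_le_integral => //.
  + by apply/measurable_EFinP; apply: measurableT_comp (mf1 x).
  + exact: (measurable_int mu (iH1 x)).
  + by move=> y _; rewrite lee_fin.
Qed.

Lemma dominated_Fubini :
  \int[mu]_x \int[mu]_y f x y = \int[mu]_y \int[mu]_x f x y.
Proof.
rewrite /Rintegral; have /= F := Fubini if12.
transitivity (fine (\int[mu]_x \int[mu]_y (f x y)%:E)%E).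
  congr fine; apply: eq_integral => x _; rewrite fineK//.
  by apply: integrable_fin_num => //; exact: dominated_integrable1.
rewrite F; congr fine; apply: eq_integral => y _; rewrite fineK//.
by apply: integrable_fin_num => //; exact: dominated_integrable2.
Qed.

End FubiniReal.

(** * Complex-valued integrals by real and imaginary parts *)

Section ComplexIntegral.
Set Implicit Arguments.
Unset Strict Implicit.
Variable R : realType.
Local Notation C := R[i].
Local Notation normc := (@Normc.normc R).
Implicit Types (g : R -> C) (z w : C).

Lemma normr_Re_le z : `|complex.Re z| <= normc z.
Proof. by rewrite -lecR (le_trans (normc_ge_Re z))// normc_def; case: z. Qed.

Lemma normr_Im_le z : `|complex.Im z| <= normc z.
Proof.
case: z => x y /=; rewrite -[leLHS]sqrtr_sqr ler_wsqrtr// lerDr.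
exact: sqr_ge0.
Qed.

Lemma normc_le_add z : normc z <= `|complex.Re z| + `|complex.Im z|.
Proof.
case: z => x y /=; rewrite -[leRHS]ger0_norm ?addr_ge0// -sqrtr_sqr.
rewrite ler_wsqrtr// sqrrD !real_normK ?num_real//.
by rewrite -addrA lerD2l lerDr mulrn_wge0 ?mulr_ge0.
Qed.

Lemma normc_ge0 z : 0 <= normc z.
Proof. by case: z => x y /=; rewrite sqrtr_ge0. Qed.

Lemma CReM z w : complex.Re (z * w) =
  complex.Re z * complex.Re w - complex.Im z * complex.Im w.
Proof. by case: z w => a b [c d]. Qed.

Lemma CImM z w : complex.Im (z * w) =
  complex.Re z * complex.Im w + complex.Im z * complex.Re w.
Proof. by case: z w => a b [c d]. Qed.

Definition Cmeasurable g :=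
  measurable_fun setT (fun x => complex.Re (g x)) /\
  measurable_fun setT (fun x => complex.Im (g x)).

Definition Cintegrable g :=
  mu.-integrable setT (EFin \o (fun x => complex.Re (g x))) /\
  mu.-integrable setT (EFin \o (fun x => complex.Im (g x))).

Definition Cint g : C := Cintegral setT g.

Lemma ReCint g : complex.Re (Cint g) = \int[mu]_x complex.Re (g x).
Proof. by []. Qed.

Lemma ImCint g : complex.Im (Cint g) = \int[mu]_x complex.Im (g x).
Proof. by []. Qed.

Lemma Cmeasurable_cst z : Cmeasurable (fun=> z).
Proof. by split; exact: measurable_cst. Qed.

Lemma CmeasurableD f g : Cmeasurable f -> Cmeasurable g ->
  Cmeasurable (fun x => f x + g x).
Proof.
move=> [f1 f2] [g1 g2]; split.
  have -> : (fun x => complex.Re (f x + g x)) =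
    (fun x => complex.Re (f x) + complex.Re (g x)).
    by apply/funext => x; rewrite raddfD.
  exact: measurable_funD.
have -> : (fun x => complex.Im (f x + g x)) =
  (fun x => complex.Im (f x) + complex.Im (g x)).
  by apply/funext => x; rewrite raddfD.
exact: measurable_funD.
Qed.

Lemma CmeasurableM f g : Cmeasurable f -> Cmeasurable g ->
  Cmeasurable (fun x => f x * g x).
Proof.
move=> [f1 f2] [g1 g2]; split.
  under eq_fun do rewrite CReM.
  by apply: measurable_funB; apply: measurable_funM.
under eq_fun do rewrite CImM.
by apply: measurable_funD; apply: measurable_funM.
Qed.

Lemma Cmeasurable_sum n (F : 'I_n -> R -> C) :
  (forall i, Cmeasurable (F i)) -> Cmeasurable (fun x => \sum_i F i x).
Proof.
elim: n F => [|n ih] F mF.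
  by under eq_fun do rewrite big_ord0; exact: Cmeasurable_cst.
under eq_fun do rewrite big_ord_recr/=.
by apply: CmeasurableD => //; exact: ih.
Qed.

Lemma Cmeasurable_affine g (r c : R) : Cmeasurable g ->
  Cmeasurable (fun x => g (r * x + c)).
Proof.
move=> [m1 m2]; split.
- exact: (measurableT_comp m1 (measurable_affine r c)).
- exact: (measurableT_comp m2 (measurable_affine r c)).
Qed.

Lemma Cintegrable_le g (h : R -> R) : Cmeasurable g ->
  mu.-integrable setT (EFin \o h) -> (forall x, normc (g x) <= h x) ->
  Cintegrable g.
Proof.
move=> [m1 m2] ih gh; split; apply: le_integrable ih => //; try exact/measurable_EFinP;
  move=> x _ /=; rewrite lee_fin (le_trans _ (ler_norm _))// (le_trans _ (gh x))//.
- exact: normr_Re_le.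
- exact: normr_Im_le.
Qed.

Lemma eq_Cint f g : f =1 g -> Cint f = Cint g.
Proof. by move=> /funext ->. Qed.

Lemma CintZl z g : Cintegrable g -> Cint (fun x => z * g x) = z * Cint g.
Proof.
move=> [i1 i2]; apply/eqP; rewrite eq_complex; apply/andP; split; apply/eqP.
  rewrite CReM !ReCint !ImCint -!RintegralZl// -RintegralB//; [|exact: (integrableZl _ _ i1)|exact: (integrableZl _ _ i2)].
  by apply: eq_Rintegral => x _; rewrite CReM.
rewrite CImM !ReCint !ImCint -!RintegralZl// -RintegralD//; [|exact: (integrableZl _ _ i2)|exact: (integrableZl _ _ i1)].
by apply: eq_Rintegral => x _; rewrite CImM.
Qed.

Lemma CintD f g : Cintegrable f -> Cintegrable g ->
  Cint (fun x => f x + g x) = Cint f + Cint g.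
Proof.
move=> [f1 f2] [g1 g2]; apply/eqP; rewrite eq_complex; apply/andP; split; apply/eqP.
  rewrite raddfD/= -RintegralD//.
  by apply: eq_Rintegral => x _; rewrite raddfD.
rewrite raddfD/= -RintegralD//.
by apply: eq_Rintegral => x _; rewrite raddfD.
Qed.

Lemma CintegrableZl z g : Cintegrable g -> Cintegrable (fun x => z * g x).
Proof.
move=> [i1 i2]; split.
  have : mu.-integrable setT (fun x => (complex.Re z)%:E * (complex.Re (g x))%:E - (complex.Im z)%:E * (complex.Im (g x))%:E)%E.
    by apply: integrableB => //; exact: integrableZl.
  by apply: eq_integrable => // x _ /=; rewrite CReM EFinB !EFinM.
have : mu.-integrable setT (fun x => (complex.Re z)%:E * (complex.Im (g x))%:E + (complex.Im z)%:E * (complex.Re (g x))%:E)%E.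
  by apply: integrableD => //; exact: integrableZl.
by apply: eq_integrable => // x _ /=; rewrite CImM EFinD !EFinM.
Qed.

Lemma CintegrableD f g : Cintegrable f -> Cintegrable g ->
  Cintegrable (fun x => f x + g x).
Proof.
move=> [f1 f2] [g1 g2]; split.
  have := integrableD measurableT f1 g1.
  by apply: eq_integrable => // x _ /=; rewrite raddfD.
have := integrableD measurableT f2 g2.
by apply: eq_integrable => // x _ /=; rewrite raddfD.
Qed.

Lemma Cint_sum n (F : 'I_n -> R -> C) : (forall i, Cintegrable (F i)) ->
  Cintegrable (fun x => \sum_i F i x) /\
  Cint (fun x => \sum_i F i x) = \sum_i Cint (F i).
Proof.
elim: n F => [|n ih] F iF.
  have -> : (fun x => \sum_i F i x) = (fun=> 0).
    by apply/funext => x; rewrite big_ord0.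
  split; first by split; exact: integrable0.
  by rewrite big_ord0 /Cint /Cintegral /Rintegral/= integral0.
have -> : (fun x => \sum_i F i x) =
    (fun x => \sum_(i < n) F (widen_ord (leqnSn n) i) x + F ord_max x).
  by apply/funext => x; rewrite big_ord_recr.
have [i1 e1] := ih (fun i => F (widen_ord (leqnSn n) i)) (fun i => iF _).
split; first exact: CintegrableD.
by rewrite CintD// e1 big_ord_recr.
Qed.

Lemma Cint_affine (r c : R) g : r != 0 -> Cmeasurable g ->
  Cint (fun x => g (r * x + c)) = (`|r|^-1)%:C * Cint g.
Proof.
move=> r0 [m1 m2]; apply/eqP; rewrite eq_complex CReM CImM/= !mul0r subr0 addr0.
by rewrite (Rintegral_affine c r0 m1) (Rintegral_affine c r0 m2) !eqxx.
Qed.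

(** The factor 2 comes from bounding the real and the imaginary part separately; a sharper constant
    would change nothing later. *)
Lemma normc_Cint_le g (h : R -> R) : Cmeasurable g ->
  mu.-integrable setT (EFin \o h) -> (forall x, normc (g x) <= h x) ->
  normc (Cint g) <= \int[mu]_x h x *+ 2.
Proof.
move=> mg ih gh; have [i1 i2] := Cintegrable_le mg ih gh.
rewrite (le_trans (normc_le_add _))// mulr2n lerD//.
- rewrite ReCint (le_trans (le_normr_Rintegral _ _))// le_Rintegral//.
    exact: integrable_norm.
  by move=> x _; rewrite (le_trans (normr_Re_le _)).
- rewrite ImCint (le_trans (le_normr_Rintegral _ _))// le_Rintegral//.
    exact: integrable_norm.
  by move=> x _; rewrite (le_trans (normr_Im_le _)).
Qed.

Lemma Cint_Fubini (g : R -> R -> C) (H : R -> R -> R) : fubini_dominating H ->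
  measurable_fun setT (fun p : R * R => complex.Re (g p.1 p.2)) ->
  measurable_fun setT (fun p : R * R => complex.Im (g p.1 p.2)) ->
  (forall x y, normc (g x y) <= H x y) ->
  Cint (fun x => Cint (g x)) = Cint (fun y => Cint (g^~ y)).
Proof.
move=> dH m1 m2 gH; apply/eqP; rewrite eq_complex; apply/andP; split; apply/eqP.
  rewrite !ReCint; apply: (dominated_Fubini dH) => // x y.
  exact: le_trans (normr_Re_le _) (gH x y).
rewrite !ImCint; apply: (dominated_Fubini dH) => // x y.
exact: le_trans (normr_Im_le _) (gH x y).
Qed.

End ComplexIntegral.

(** * Power kernels and the Beta integral *)

Section PowerKernels.
Set Implicit Arguments.
Unset Strict Implicit.
Variable R : realType.
Local Notation C := R[i].
Local Notation normc := (@Normc.normc R).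
Implicit Types (p q t s x y : R) (z w : C).

Lemma cpowRD x z w : 0 < x -> cpowR x (z + w) = cpowR x z * cpowR x w.
Proof.
move=> x0; rewrite /cpowR !raddfD/= powRD; last by rewrite (gt_eqF x0) implybT.
rewrite mulrDl cosD sinD; apply/eqP; rewrite eq_complex CReM CImM/=.
by apply/andP; split; apply/eqP; ring.
Qed.

Lemma cpowRM x y z : 0 < x -> 0 < y -> cpowR (x * y) z = cpowR x z * cpowR y z.
Proof.
move=> x0 y0; rewrite /cpowR powRM ?ltW// lnM ?posrE// mulrDr cosD sinD.
by apply/eqP; rewrite eq_complex CReM CImM/=; apply/andP; split; apply/eqP; ring.
Qed.

Lemma cpowR0 x : 0 < x -> cpowR x 0 = 1.
Proof.
by move=> x0; rewrite /cpowR/= powRr0 mul0r cos0 sin0 mul1r.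
Qed.

Lemma cpowRMn x z n : 0 < x -> cpowR x (z *+ n) = cpowR x z ^+ n.
Proof.
move=> x0; elim: n => [|n ih]; first by rewrite mulr0n cpowR0.
by rewrite mulrSr cpowRD// ih exprSr.
Qed.

Lemma cpowR_real x p : 0 < x -> cpowR x p%:C = (x `^ p)%:C.
Proof. by move=> x0; rewrite /cpowR/= mul0r cos0 sin0 mulr1. Qed.

Lemma cpowR1 z : cpowR (1 : R) z = 1.
Proof. by rewrite /cpowR/= powR1 ln1 mulr0 cos0 sin0 mulr1. Qed.

Lemma normc_cpowR x z : normc (cpowR x z) = x `^ complex.Re z.
Proof.
rewrite /cpowR Normc.normcM/= expr0n addr0 cos2Dsin2 sqrtr1 mulr1.
by rewrite sqrtr_sqr ger0_norm// powR_ge0.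
Qed.

Lemma CReD z w : complex.Re (z + w) = complex.Re z + complex.Re w.
Proof. exact: raddfD. Qed.

Lemma CImD z w : complex.Im (z + w) = complex.Im z + complex.Im w.
Proof. exact: raddfD. Qed.

(** The power t^(p-1) cut off to t > 0. With the cutoff in the kernel, a convolution over [0, t] is
    an integral over the whole line, where affine substitution and Fubini apply directly. [cker] is
    its version for complex exponents. *)
Definition pker p t : R := if 0 < t then t `^ (p - 1) else 0.

Definition cker z t : C := if 0 < t then cpowR t (z - 1) else 0.

Lemma pker_ge0 p t : 0 <= pker p t.
Proof. by rewrite /pker; case: ifP => // _; rewrite powR_ge0. Qed.

Lemma pker_neg p t : t <= 0 -> pker p t = 0.
Proof. by move=> t0; rewrite /pker ltNge t0. Qed.

Lemma cker_neg z t : t <= 0 -> cker z t = 0.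
Proof. by move=> t0; rewrite /cker ltNge t0. Qed.

Lemma normc_cker z t : normc (cker z t) = pker (complex.Re z) t.
Proof.
rewrite /cker /pker; case: ifP => _; last by rewrite Normc.normc0.
by rewrite normc_cpowR CReD.
Qed.

Lemma cker_real p t : cker p%:C t = (pker p t)%:C.
Proof.
rewrite /cker /pker; case: ifPn => // t0.
by rewrite -cpowR_real// rmorphB.
Qed.

Lemma pkerM p x t : 0 < x -> pker p (x * t) = x `^ (p - 1) * pker p t.
Proof.
move=> x0; rewrite /pker pmulr_rgt0//; case: ifPn => t0; last by rewrite mulr0.
by rewrite powRM// ltW.
Qed.

Lemma ckerM z x t : 0 < x -> cker z (x * t) = cpowR x (z - 1) * cker z t.
Proof.
move=> x0; rewrite /cker pmulr_rgt0//; case: ifPn => t0; last by rewrite mulr0.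
by rewrite cpowRM.
Qed.

Lemma pker_le p q t : q <= p -> t <= 1 -> pker p t <= pker q t.
Proof.
move=> qp t1; rewrite /pker; case: ifPn => // t0.
by apply: ger_powR; rewrite ?t0 ?t1// lerD2r.
Qed.

Lemma measurable_pker p : measurable_fun setT (pker p).
Proof.
apply: measurable_fun_ifT => //.
  exact: measurable_fun_ltr.
Qed.

Lemma Cmeasurable_cker z : Cmeasurable (cker z).
Proof.
have mRe : measurable_fun setT (fun t : R => complex.Re (cpowR t (z - 1))).
  under eq_fun do rewrite /cpowR CReM/= mul0r subr0.
  apply: measurable_funM; first exact: measurable_powR.
  apply: (measurableT_comp (continuous_measurable_fun (@continuous_cos R))).
  by apply: measurable_funM => //; exact: measurable_ln.
have mIm : measurable_fun setT (fun t : R => complex.Im (cpowR t (z - 1))).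
  under eq_fun do rewrite /cpowR CImM/= mul0r addr0.
  apply: measurable_funM; first exact: measurable_powR.
  apply: (measurableT_comp (continuous_measurable_fun (@continuous_sin R))).
  by apply: measurable_funM => //; exact: measurable_ln.
split.
- have -> : (fun t => complex.Re (cker z t)) = (fun t : R => if 0 < t then complex.Re (cpowR t (z - 1)) else 0).
    by apply/funext => t; rewrite /cker; case: ifP.
  by apply: measurable_fun_ifT => //; exact: measurable_fun_ltr.
- have -> : (fun t => complex.Im (cker z t)) = (fun t : R => if 0 < t then complex.Im (cpowR t (z - 1)) else 0).
    by apply/funext => t; rewrite /cker; case: ifP.
  by apply: measurable_fun_ifT => //; exact: measurable_fun_ltr.
Qed.

(** This is ln x <= x - 1 at x = t / (2p), multiplied by p and exponentiated. *)
Lemma powR_le_expR p t : 0 < p -> 0 < t ->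
  t `^ p <= expR (p * (ln (p *+ 2) - 1)) * expR (t / 2).
Proof.
move=> p0 t0; rewrite /powR gt_eqF// -expRD ler_expR.
have c0 : 0 < p *+ 2 by rewrite pmulrn_lgt0.
have : ln (t / (p *+ 2)) <= t / (p *+ 2) - 1.
  have := @le_ln1Dx R (t / (p *+ 2) - 1); rewrite addrCA subrr addr0; apply.
  by rewrite ltrBrDl subrr divr_gt0.
rewrite ln_div ?posrE// lerBlDr => /(ler_wpM2l (ltW p0)) h.
rewrite (le_trans h)// le_eqVlt; apply/orP; left; apply/eqP.
rewrite -mulr_natr; field; exact: lt0r_neq0.
Qed.

(* Dominates the integrand of Gamma p up to a constant, and is the derivative of
   the bounded function - 1 / (p (1 + t ^ p)). *)
Let maj p t : R := t `^ (p - 1) / (1 + t `^ p) ^+ 2.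

Let majE p x : 0 < p -> 0 < x ->
  is_derive x 1 (fun t : R => - (p * (1 + t `^ p))^-1) (maj p x).
Proof.
move=> p0 x0.
have h0 : p * (1 + x `^ p) != 0.
  by rewrite mulf_neq0 ?gt_eqF// ltr_wpDr ?powR_ge0.
have D := @is_derive1_powR R p x x0.
have D1 : is_derive x 1 (fun t : R => p * (1 + t `^ p)) (p * (p * x `^ (p - 1))).
  have := is_deriveZ p (is_deriveD (is_derive_cst (1:R) x 1) D).
  by rewrite add0r.
have D2 := is_deriveN (@is_deriveV R (fun t : R => p * (1 + t `^ p)) _ _ _ h0 D1).
apply: is_derive_eq D2 _.
rewrite /maj scaleNr opprK exprMn /GRing.scale/=; field.
by rewrite (gt_eqF p0) gt_eqF// ltr_wpDr ?powR_ge0.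
Qed.

Let maj_continuous p x : 0 < p -> 0 < x -> {for x, continuous (maj p)}.
Proof.
move=> p0 x0; apply: differentiable_continuous; apply/derivable1_diffP.
have D := @is_derive1_powR R p x x0.
have D' := @is_derive1_powR R (p - 1) x x0.
have h0 : (1 + x `^ p) ^+ 2 != 0.
  by rewrite expf_neq0// gt_eqF// ltr_wpDr ?powR_ge0.
rewrite /maj; apply: derivableM => //; apply: derivableV => //.
Qed.

Let maj_ge0 p t : 0 <= maj p t.
Proof. by rewrite /maj divr_ge0 ?powR_ge0// sqr_ge0. Qed.

Let maj_FTC p (x y : R) : 0 < p -> 0 < x -> x < y ->
  (\int[mu]_(t in `[x, y]) (maj p t)%:E <= (p^-1)%:E)%E.
Proof.
move=> p0 x0 xy.
have H (u : R) : 0 <= (p * (1 + u `^ p))^-1 <= p^-1.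
  have h1 : 0 < 1 + u `^ p by rewrite ltr_wpDr ?powR_ge0.
  apply/andP; split; first by rewrite invr_ge0 mulr_ge0 ?ltW.
  by rewrite lef_pV2 ?posrE ?mulr_gt0// ler_peMr ?(ltW p0)// lerDl powR_ge0.
rewrite (@continuous_FTC2 _ _ (fun t : R => - (p * (1 + t `^ p))^-1))//.
- by rewrite -EFinB lee_fin; move: (H x) (H y); lra.
- apply: continuous_in_subspaceT => t; rewrite inE/= in_itv/= => /andP[xt _].
  by apply: maj_continuous => //; exact: lt_le_trans xt.
- have C (t : R) : 0 < t -> {for t, continuous (fun t : R => - (p * (1 + t `^ p))^-1)}.
    move=> t0; apply: differentiable_continuous; apply/derivable1_diffP.
    by have := majE p0 t0; move=> [].
  split.
  + move=> t; rewrite in_itv/= => /andP[xt _].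
    by have := majE p0 (lt_trans x0 xt); move=> [].
  + by apply: cvg_at_right_filter; exact: C.
  + by apply: cvg_at_left_filter; apply: C; exact: lt_trans xy.
- move=> t; rewrite in_itv/= => /andP[xt _].
  by have [_] := majE p0 (lt_trans x0 xt); rewrite derive1E.
Qed.

Definition gker p t : R := pker p t * expR (- t).

Lemma gker_ge0 p t : 0 <= gker p t.
Proof. by rewrite mulr_ge0 ?pker_ge0// expR_ge0. Qed.

Lemma measurable_gker p : measurable_fun setT (gker p).
Proof.
apply: measurable_funM; first exact: measurable_pker.
by apply: measurableT_comp => //; exact: measurableT_comp.
Qed.

Lemma integrable_gker p : 0 < p -> mu.-integrable setT (EFin \o gker p).
Proof.
move=> p0.
(* These intervals stay away from 0 and exhaust the half-line. Starting at [n.+2] makes the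
   endpoints distinct already for n = 0, as [maj_FTC] requires. *)
pose F (n : nat) : set R := `[n.+2%:R^-1, n.+2%:R]%classic.
have n0 n : 0 < n.+2%:R^-1 :> R by rewrite invr_gt0.
have n1 n : n.+2%:R^-1 < n.+2%:R :> R.
  by rewrite (@lt_trans _ _ 1)// ?invf_lt1// ltr1n.
have F0oo : \bigcup_n F n = `]0, +oo[%classic.
  apply/seteqP; split => [x [n _]|x]; rewrite /F/= !in_itv/= ?andbT.
    by move=> /andP[+ _]; exact: lt_le_trans.
  move=> x0; have [N1 hN1] : exists n : nat, x <= n.+2%:R.
    exists (Num.truncn x); rewrite ltW// (lt_trans (truncnS_gt x))// ltr_nat//.
  have [N2 hN2] : exists n : nat, x^-1 <= n.+2%:R.
    exists (Num.truncn x^-1); rewrite ltW// (lt_trans (truncnS_gt _))// ltr_nat//.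
  exists (maxn N1 N2) => //=; rewrite in_itv/=; apply/andP; split.
    rewrite invf_ple ?posrE// (le_trans hN2)// ler_nat !ltnS.
    by rewrite leq_maxr.
  by rewrite (le_trans hN1)// ler_nat !ltnS leq_maxl.
have mmaj : measurable_fun setT (maj p).
  apply: measurable_funM; first exact: measurable_powR.
  have -> : (fun t : R => ((1 + t `^ p) ^+ 2)^-1) = (fun t : R => (1 + t `^ p) `^ (- 2)).
    apply/funext => t; rewrite powRN; congr (_^-1).
    by rewrite -powR_mulrn// addr_ge0// powR_ge0.
  apply: (measurableT_comp (measurable_powR _)).
  by apply: measurable_funD => //; exact: measurable_powR.
have imaj : (\int[mu]_(t in `]0%R, +oo[) (maj p t)%:E <= (p^-1)%:E)%E.
  rewrite -F0oo.
  have cv : (\int[mu]_(t in F n) (maj p t)%:E)%E @[n --> \oo] -->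
      (\int[mu]_(t in \bigcup_n F n) (maj p t)%:E)%E.
    apply: ge0_nondecreasing_set_cvg_integral.
    - move=> k l kl; apply/subsetPset => t; rewrite /F/= !in_itv/= => /andP[h1 h2].
      apply/andP; split.
        by rewrite (le_trans _ h1)// lef_pV2 ?posrE// ler_nat !ltnS.
      by rewrite (le_trans h2)// ler_nat !ltnS.
    - by move=> k; exact: measurable_itv.
    - by move=> k; apply/measurable_EFinP; exact: measurable_funTS.
    - by move=> k t _; rewrite lee_fin.
  rewrite -(cvg_lim _ cv)//; apply: lime_le.
    by apply/cvg_ex; eexists; exact: cv.
  by apply: nearW => n; exact: maj_FTC.
pose K := 1 + expR (p * (ln (p *+ 2) - 1)).
have K0 : 0 <= K by rewrite addr_ge0// expR_ge0.
(* [powR_le_expR] gives 1 + t^p <= K exp(t/2); squared, this reads exp(-t) <= K^2 / (1 + t^p)^2. *)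
have le_maj t : 0 < t -> gker p t <= K ^+ 2 * maj p t.
  move=> t0; rewrite /gker /pker t0 /maj mulrCA ler_wpM2l ?powR_ge0//.
  rewrite ler_pdivlMr ?exprn_gt0 ?ltr_wpDr ?powR_ge0//.
  rewrite mulrC expRN ler_pdivrMr ?expR_gt0//.
  have -> : expR t = expR (t / 2) ^+ 2 by rewrite expr2 -expRD -splitr.
  rewrite -exprMn lerXn2r ?nnegrE ?addr_ge0 ?powR_ge0 ?mulr_ge0 ?expR_ge0//.
  rewrite /K mulrDl mul1r lerD ?powR_le_expR//.
  by rewrite -expR0 ler_expR divr_ge0// ltW.
apply/integrableP; split; first by apply/measurable_EFinP; exact: measurable_gker.
apply: (@le_lt_trans _ _ (\int[mu]_(t in `]0%R, +oo[) ((K ^+ 2)%:E * (maj p t)%:E))%E).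
  rewrite [leRHS]integral_mkcond; apply: ge0_le_integral => //.
  - by apply: measurableT_comp => //; apply/measurable_EFinP; exact: measurable_gker.
  - apply/(measurable_restrictT _ _).1 => //; apply: measurable_funTS.
    by apply/measurable_EFinP; exact: measurable_funM.
  - move=> t _; rewrite /= patchE ger0_norm ?gker_ge0//; case: ifPn.
      by rewrite inE/= in_itv/= andbT -EFinM lee_fin; exact: le_maj.
    rewrite notin_setE/= in_itv/= andbT => /negP; rewrite -leNgt => t0.
    by rewrite /gker pker_neg// mul0r.
rewrite ge0_integralZl//.
- rewrite (@le_lt_trans _ _ ((K ^+ 2)%:E * (p^-1)%:E)%E)//; last by rewrite -EFinM ltry.
  by rewrite lee_pmul// ?lee_fin ?sqr_ge0// integral_ge0// => t _; rewrite lee_fin.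
- by apply/measurable_EFinP; exact: measurable_funTS.
- by move=> t _; rewrite lee_fin.
- by rewrite lee_fin sqr_ge0.
Qed.

Lemma measurable_gkerE p : measurable_fun setT (EFin \o gker p).
Proof. by apply/measurable_EFinP; exact: measurable_gker. Qed.

Lemma integral_gker_gt0 p : (0 < \int[mu]_t (gker p t)%:E)%E.
Proof.
(* A lower bound of [gker p] on [1, 2], where 0 <= ln t <= t <= 2. *)
pose c := expR (- (`|p - 1| * 2) - 2).
have c0 : 0 < c by exact: expR_gt0.
apply: (@lt_le_trans _ _ (\int[mu]_(t in `[1%R, 2%R]) c%:E)%E).
  rewrite integral_cst//= lebesgue_measure_itv/= lte_fin ltr1n -EFinB -EFinM lte_fin.
  by rewrite mulr_gt0// subr_gt0 ltr1n.
apply: (@le_trans _ _ (\int[mu]_(t in `[1%R, 2%R]) (gker p t)%:E)%E).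
  apply: ge0_le_integral => //.
  - by move=> t _; rewrite lee_fin ltW.
  - by apply: measurable_funTS; exact: measurable_gkerE.
  - move=> t /=; rewrite in_itv/= => /andP[t1 t2]; rewrite lee_fin.
    have t0 : 0 < t by rewrite (lt_le_trans ltr01).
    rewrite /gker /pker t0 /c expRD ler_pM ?expR_ge0 ?ler_expR ?lerN2//.
    rewrite /powR gt_eqF// ler_expR lerNl -mulNr.
    rewrite (le_trans (ler_norm _))// normrM normrN ler_wpM2l//.
    rewrite ger0_norm ?ln_ge0// (le_trans _ t2)// ltW// ln_sublinear//.
apply: ge0_subset_integral => //; first exact: measurable_gkerE.
by move=> t _; rewrite lee_fin gker_ge0.
Qed.

Lemma measurable_shift (f : R -> R) : measurable_fun setT f ->
  measurable_fun setT (fun z : R * R => f (z.1 - z.2)).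
Proof.
move=> mf; apply: (measurableT_comp mf).
by apply: measurable_funB.
Qed.

Lemma measurable_conv (f g : R -> R) : measurable_fun setT f ->
  measurable_fun setT g ->
  measurable_fun setT (fun z : R * R => f (z.1 - z.2) * g z.2).
Proof.
move=> mf mg; apply: measurable_funM; first exact: measurable_shift.
by apply: (measurableT_comp mg); exact: measurable_snd.
Qed.

Let pconv p q u := (\int[mu]_s (pker p (u - s) * pker q s)%:E)%E.

Lemma measurable_conv1 (f g : R -> R) u : measurable_fun setT f ->
  measurable_fun setT g -> measurable_fun setT (fun s : R => f (u - s) * g s).
Proof.
move=> mf mg.
exact: (measurableT_comp (measurable_conv mf mg) (measurable_pair1 u)).
Qed.

Let pconv_scale p q u : 0 < u ->
  pconv p q u = ((u `^ (p + q - 1))%:E * pconv p q 1)%E.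
Proof.
move=> u0; rewrite /pconv (@ge0_integral_affine _ u 0 (fun s => (pker p (u - s) * pker q s)%:E)).
- have -> : (fun x : R => (pker p (u - (u * x + 0)) * pker q (u * x + 0))%:E)
    = (fun x : R => (u `^ (p - 1) * u `^ (q - 1))%:E * (pker p (1 - x) * pker q x)%:E)%E.
    apply/funext => x; rewrite addr0 -{1}(mulr1 u) -mulrBr !pkerM// -EFinM.
    by congr EFin; ring.
  rewrite ge0_integralZl_EFin//.
  + rewrite muleA -EFinM; congr (_%:E * _)%E.
    rewrite gtr0_norm// -[X in X * _]powRr1 ?ltW// -!powRD; last 2 first.
      by rewrite (gt_eqF u0) implybT.
      by rewrite (gt_eqF u0) implybT.
    by congr (_ `^ _); ring.
  + by move=> x _; rewrite lee_fin mulr_ge0// pker_ge0.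
  + by apply/measurable_EFinP; apply: measurable_conv1; exact: measurable_pker.
  + by rewrite mulr_ge0 ?powR_ge0.
- by rewrite gt_eqF.
- by apply/measurable_EFinP; apply: measurable_conv1; exact: measurable_pker.
- by move=> x; rewrite lee_fin mulr_ge0// pker_ge0.
Qed.

Lemma gker_conv p q u s :
  gker p (u - s) * gker q s = expR (- u) * (pker p (u - s) * pker q s).
Proof.
rewrite /gker mulrACA -expRD mulrC; congr (expR _ * _); ring.
Qed.

Lemma integral_shift (f : R -> \bar R) c : measurable_fun setT f ->
  (forall x, (0 <= f x)%E) ->
  (\int[mu]_u f (u - c)%R = \int[mu]_u f u)%E.
Proof.
move=> mf f0; rewrite [RHS](@ge0_integral_affine _ 1 (- c) f)// normr1 mul1e.
by apply: eq_integral => x _; rewrite mul1r.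
Qed.

(** Tonelli replaces a direct estimate of the Beta integral. The double integral of
    [gker p (u - s) * gker q s] equals the finite product of the integrals of [gker p] and [gker q].
    In the other order, homogeneity turns it into [pconv p q 1] times the integral of
    [gker (p + q)]. The latter is positive, so [pconv p q 1] cannot be infinite. *)
Let pconv_lty p q : 0 < p -> 0 < q -> (pconv p q 1 < +oo)%E.
Proof.
move=> p0 q0.
have B0 : (0 <= pconv p q 1)%E.
  by apply: integral_ge0 => x _; rewrite lee_fin mulr_ge0// pker_ge0.
have fin r : 0 < r -> (\int[mu]_t (gker r t)%:E)%E \is a fin_num.
  by move=> r0; apply: integrable_fin_num => //; exact: integrable_gker.
have mg : measurable_fun setT (fun z : R * R => (gker p (z.1 - z.2) * gker q z.2)%:E).
  apply/measurable_EFinP.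
  exact: measurable_conv (measurable_gker p) (measurable_gker q).
have g0 (z : R * R) : (0 <= (gker p (z.1 - z.2) * gker q z.2)%:E)%E.
  by rewrite lee_fin mulr_ge0// gker_ge0.
have /= := fubini_tonelli (m1 := mu) (m2 := mu) _ mg g0.
have -> : (fun u : R => \int[mu]_s (gker p (u - s) * gker q s)%:E)%E =
    (fun u => pconv p q 1 * (gker (p + q) u)%:E)%E.
  apply/funext => u.
  under eq_integral do rewrite gker_conv.
  have [u0|u0] := ltP 0 u; last first.
    rewrite /gker (pker_neg _ u0) mul0r mule0; apply: integral0_eq => x _.
    have [x0|x0] := leP x 0; first by rewrite (pker_neg q x0) !mulr0.
    by rewrite (@pker_neg p (u - x)) ?mul0r ?mulr0//; lra.
  under eq_integral do rewrite EFinM.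
  rewrite ge0_integralZl_EFin//.
  - rewrite -/(pconv p q u) pconv_scale// muleA muleC; congr (_ * _)%E.
    by rewrite -EFinM /gker /pker u0 mulrC.
  - by move=> x _; rewrite lee_fin mulr_ge0// pker_ge0.
  - by apply/measurable_EFinP; apply: measurable_conv1; exact: measurable_pker.
rewrite ge0_integralZl//; last 2 first.
- exact: measurable_gkerE.
- by move=> x _; rewrite lee_fin gker_ge0.
have -> : (fun s : R => \int[mu]_u (gker p (u - s) * gker q s)%:E)%E =
    (fun s => (fine (\int[mu]_t (gker p t)%:E) * gker q s)%:E)%E.
  apply/funext => s.
  have -> : (fun u : R => (gker p (u - s) * gker q s)%:E) =
      (fun u => (gker q s)%:E * (gker p (u - s))%:E)%E.
    by apply/funext => u; rewrite mulrC.
  rewrite ge0_integralZl_EFin ?gker_ge0//.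
  - rewrite (@integral_shift (EFin \o gker p))//.
    + by rewrite [in RHS]EFinM fineK ?fin// muleC.
    + exact: measurable_gkerE.
    + by move=> x; rewrite lee_fin gker_ge0.
  - by move=> x _; rewrite lee_fin gker_ge0.
  - have := measurableT_comp (measurable_gkerE p) (measurable_affine 1 (- s)).
    by under eq_fun do rewrite mul1r.
have : (\int[mu]_s (fine (\int[mu]_t (gker p t)%:E) * gker q s)%:E < +oo)%E.
  under eq_integral do rewrite EFinM.
  rewrite ge0_integralZl_EFin//.
  - by rewrite -ge0_fin_numE ?fin_numM ?fin// mule_ge0 ?lee_fin ?fine_ge0 ?integral_ge0//;
      move=> *; rewrite lee_fin gker_ge0.
  - by move=> x _; rewrite lee_fin gker_ge0.
  - exact: measurable_gkerE.
  - by rewrite fine_ge0// integral_ge0// => *; rewrite lee_fin gker_ge0.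
move=> /[swap] <-.
have := integral_gker_gt0 (p + q).
rewrite -(fineK (fin _ (addr_gt0 p0 q0))) lte_fin => G0.
by move: B0; case: (pconv p q 1) => //= [r|]; rewrite ?ltry// gt0_mulye.
Qed.

Definition rbeta p q : R := \int[mu]_s (pker p (1 - s) * pker q s).

Lemma integrable_pconv p q u : 0 < p -> 0 < q ->
  mu.-integrable setT (EFin \o (fun s => pker p (u - s) * pker q s)).
Proof.
move=> p0 q0; apply/integrableP; split.
  by apply/measurable_EFinP; apply: measurable_conv1; exact: measurable_pker.
under eq_integral do rewrite gee0_abs ?lee_fin ?mulr_ge0 ?pker_ge0//.
have [u0|u0] := ltP 0 u.
  rewrite -/(pconv p q u) pconv_scale// lte_mul_pinfty ?lee_fin ?powR_ge0//.
  exact: pconv_lty.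
rewrite integral0_eq// => x _ /=.
have [x0|x0] := leP x 0; first by rewrite (pker_neg q x0) !mulr0.
by rewrite (@pker_neg p (u - x)) ?mul0r ?mulr0//; lra.
Qed.

Lemma Rintegral_pconv p q u :
  \int[mu]_s (pker p (u - s) * pker q s) = rbeta p q * pker (p + q) u.
Proof.
have [u0|u0] := ltP 0 u.
  rewrite /Rintegral -/(pconv p q u) pconv_scale// /pker u0.
  rewrite /rbeta /Rintegral -/(pconv p q 1).
  have : (0 <= pconv p q 1)%E.
    by apply: integral_ge0 => x _; rewrite lee_fin mulr_ge0// pker_ge0.
  case: (pconv p q 1) => [r||]//=; first by rewrite mulrC.
  (* If the Beta integral is infinite, both sides are 0, the value of [fine] at infinity. *)
  by rewrite gt0_muley ?lte_fin ?powR_gt0//= mul0r.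
rewrite (pker_neg _ u0) mulr0 -(Rintegral_set0 mu (fun=> 0)).
rewrite /Rintegral integral0_eq ?integral_set0// => x _.
have [x0|x0] := leP x 0; first by rewrite (pker_neg q x0) !mulr0.
by rewrite (@pker_neg p (u - x)) ?mul0r ?mulr0//; lra.
Qed.

Definition cbeta z w : C := Cint (fun s => cker z (1 - s) * cker w s).

Lemma Cmeasurable_conv1 (f g : R -> C) u : Cmeasurable f -> Cmeasurable g ->
  Cmeasurable (fun s => f (u - s) * g s).
Proof.
move=> mf mg; apply: CmeasurableM => //.
have := Cmeasurable_affine (-1) u mf.
by under eq_fun do rewrite mulN1r addrC.
Qed.

Lemma Cintegrable_cconv z w u : 0 < complex.Re z -> 0 < complex.Re w ->
  Cintegrable (fun s => cker z (u - s) * cker w s).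
Proof.
move=> z0 w0; apply: Cintegrable_le (integrable_pconv u z0 w0) _.
  by apply: Cmeasurable_conv1; exact: Cmeasurable_cker.
by move=> x; rewrite Normc.normcM !normc_cker.
Qed.

Lemma Cint_cconv z w u : 0 < complex.Re z -> 0 < complex.Re w ->
  Cint (fun s => cker z (u - s) * cker w s) = cbeta z w * cker (z + w) u.
Proof.
move=> z0 w0.
have [u0|u0] := ltP 0 u; last first.
  rewrite (cker_neg _ u0) mulr0 (@eq_Cint _ _ (fun=> 0 * 0)).
    rewrite CintZl ?mul0r//.
    by split; exact: integrable0.
  move=> x; have [x0|x0] := leP x 0; first by rewrite (cker_neg w x0) !mulr0.
  by rewrite (@cker_neg z (u - x)) ?mul0r ?mulr0//; lra.
have mg : Cmeasurable (fun s => cker z (u - s) * cker w s).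
  by apply: Cmeasurable_conv1; exact: Cmeasurable_cker.
have := Cint_affine 0 (lt0r_neq0 u0) mg.
have -> : (fun x : R => cker z (u - (u * x + 0)) * cker w (u * x + 0)) =
   (fun x => (cpowR u (z - 1) * cpowR u (w - 1)) * (cker z (1 - x) * cker w x)).
  apply/funext => x; rewrite addr0 -{1}(mulr1 u) -mulrBr !ckerM//.
  by rewrite mulrACA.
rewrite CintZl; last exact: Cintegrable_cconv.
move=> /(congr1 (fun y : C => u%:C * y)).
rewrite [in RHS]mulrA -rmorphM gtr0_norm// divff ?gt_eqF// mul1r => <-.
rewrite /cker u0 -/(cbeta z w) mulrA [RHS]mulrC; congr (_ * _).
have -> : u%:C = cpowR u 1 by rewrite (cpowR_real 1 u0) powRr1// ltW.
by rewrite -!cpowRD//; congr cpowR; ring.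
Qed.

End PowerKernels.

(** * The Gamma function *)

Section GammaFunction.
Set Implicit Arguments.
Unset Strict Implicit.
Variable R : realType.
Local Notation C := R[i].
Local Notation normc := (@Normc.normc R).
Implicit Types (p q t s x y : R) (z w : C).

Definition cgker z t : C := cker z t * (expR (- t))%:C.

Lemma normc_cgker z t : normc (cgker z t) = gker (complex.Re z) t.
Proof.
rewrite /cgker Normc.normcM normc_cker /gker /= expr0n addr0 sqrtr_sqr.
by rewrite ger0_norm ?expR_ge0.
Qed.

Lemma Cmeasurable_cgker z : Cmeasurable (cgker z).
Proof.
apply: CmeasurableM; first exact: Cmeasurable_cker.
split => /=; last exact: measurable_cst.
by apply: measurableT_comp => //; exact: measurableT_comp.
Qed.

Lemma Cintegrable_cgker z : 0 < complex.Re z -> Cintegrable (cgker z).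
Proof.
move=> z0; apply: Cintegrable_le (integrable_gker z0) _.
  exact: Cmeasurable_cgker.
by move=> x; rewrite normc_cgker.
Qed.

Lemma GammaE z : 0 < complex.Re z -> Gamma z = Cint (cgker z).
Proof.
move=> z0; rewrite /Gamma z0 /gamma_integral /Cint /Cintegral.
have E (g : C -> R) : g 0 = 0 ->
    \int[mu]_(s in `]0, +oo[) g (cpowR s (z - 1) * (expR (- s))%:C) =
    \int[mu]_s g (cgker z s).
  move=> g0; rewrite Rintegral_mkcond; apply: eq_Rintegral => s _.
  rewrite patchE mem_setE/= in_itv/= andbT /cgker /cker.
  by case: ifP => // _; rewrite mul0r g0.
by congr (_ +i* _); [exact: (E (@complex.Re R))|exact: (E (@complex.Im R))].
Qed.

Lemma dominating_gker_conv p q : 0 < p -> 0 < q ->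
  fubini_dominating (fun u s => gker p (u - s) * gker q s).
Proof.
move=> p0 q0; split.
- by apply: measurable_conv; exact: measurable_gker.
- move=> u.
  have := integrableZl measurableT (expR (- u)) (integrable_pconv u p0 q0).
  by apply: eq_integrable => // s _ /=; rewrite gker_conv EFinM.
- move=> s.
  have := integrableZl measurableT (gker q s) (integrable_affine (-s) (oner_neq0 R) (integrable_gker p0)).
  by apply: eq_integrable => // u _ /=; rewrite mul1r mulrC EFinM.
- have := integrableZl measurableT (rbeta p q) (integrable_gker (addr_gt0 p0 q0)).
  apply: eq_integrable => // u _ /=.
  under eq_Rintegral do rewrite gker_conv.
  rewrite RintegralZl//; last exact: integrable_pconv.
  by rewrite Rintegral_pconv -EFinM /gker; congr EFin; ring.
Qed.

(** Integrate [cgker z (u - s) * cgker w s] over the plane in both orders. Over u first, a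
    translation leaves the product of the two Gamma integrals. Over s first, the exponentials
    combine to exp(-u) and what remains is the Beta convolution. *)
Lemma Gamma_mul z w : 0 < complex.Re z -> 0 < complex.Re w ->
  Gamma z * Gamma w = cbeta z w * Gamma (z + w).
Proof.
move=> z0 w0; have zw0 : 0 < complex.Re (z + w) by rewrite CReD addr_gt0.
rewrite !GammaE// -!CintZl; [|exact: Cintegrable_cgker..].
have mc (f : R -> R) (g : R -> R) := @measurable_conv R f g.
have [m1 m2] := Cmeasurable_cgker z; have [n1 n2] := Cmeasurable_cgker w.
transitivity (Cint (fun s => Cint (fun u => cgker z (u - s) * cgker w s))).
  apply: eq_Cint => s.
  have -> : (fun u => cgker z (u - s) * cgker w s) = (fun u => cgker w s * cgker z (1 * u + - s)).
    by apply/funext => u; rewrite mul1r mulrC.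
  rewrite CintZl; last first.
    split; have [h1 h2] := Cintegrable_cgker z0.
      exact: (integrable_affine (- s) (oner_neq0 R) h1).
    exact: (integrable_affine (- s) (oner_neq0 R) h2).
  rewrite (Cint_affine (- s) (oner_neq0 R) (Cmeasurable_cgker z)).
  by rewrite normr1 invr1 mul1r mulrC.
rewrite -(Cint_Fubini (g := fun u s => cgker z (u - s) * cgker w s) (dominating_gker_conv z0 w0)).
- apply: eq_Cint => u.
  have -> : (fun s => cgker z (u - s) * cgker w s) =
    (fun s => (expR (- u))%:C * (cker z (u - s) * cker w s)).
    apply/funext => s; rewrite /cgker mulrACA -rmorphM -expRD mulrC.
    by congr ((expR _)%:C * _); ring.
  rewrite CintZl; last exact: Cintegrable_cconv.
  by rewrite Cint_cconv// /cgker; ring.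
- under eq_fun do rewrite CReM.
  by apply: measurable_funB; [exact: (mc _ _ m1 n1)|exact: (mc _ _ m2 n2)].
- under eq_fun do rewrite CImM.
  by apply: measurable_funD; [exact: (mc _ _ m1 n2)|exact: (mc _ _ m2 n1)].
- by move=> u s; rewrite Normc.normcM !normc_cgker.
Qed.

(** [cker 1] is the indicator of the positive half-line, so convolving with it is taking the
    primitive that vanishes at 0. *)
Let cker_int z u : 0 < complex.Re z ->
  cbeta 1 z * cker (1 + z) u = Cint (fun s => if s < u then cker z s else 0).
Proof.
move=> z0; rewrite -Cint_cconv//; apply: eq_Cint => s.
rewrite {1}/cker subr_gt0; case: ifPn => su; last by rewrite mul0r.
by rewrite subrr cpowR0 ?mul1r// subr_gt0.
Qed.

(** The point 2 only serves to have 1 in the interior of the interval of integration. *)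
Let FTC_at1 (f G : R -> R) (l : R) :
  mu.-integrable `]-oo, 2] (EFin \o f) ->
  (forall u, G u = \int[mu]_s (if s < u then f s else 0)) ->
  {for (1 : R), continuous f} ->
  is_derive (1 : R) (1 : R) G l -> l = f 1.
Proof.
move=> intf GE cf [dG <-].
have lt12 : (1 : R) < 2 by rewrite ltr1n.
have [|_] := @continuous_FTC1 R f -oo%O 1 2 lt12 intf _ cf; first by rewrite ltNyr.
rewrite derive1E => <-; apply: near_eq_derive.
near=> u; rewrite GE.
rewrite -Rintegral_itv_bndo_bndc; last first.
  apply: integrableS intf => //; apply: subset_itvl; rewrite bnd_simp.
  by apply/ltW; near: u; apply: lt_nbhsl; rewrite ltr1n.
rewrite [RHS]Rintegral_mkcond; apply: eq_Rintegral => s _.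
by rewrite patchE mem_setE/= in_itv/=.
Unshelve. all: by end_near.
Qed.

Let is_derive_Rpow x : is_derive (1 : R) (1 : R) (fun u : R => u `^ x) x.
Proof.
by have := @is_derive1_powR R x 1 ltr01; rewrite powR1 mulr1.
Qed.

Let is_derive_mulln y : is_derive (1 : R) (1 : R) (fun u : R => y * ln u) y.
Proof.
by have := is_deriveZ y (@is_derive1_ln R 1 ltr01); rewrite /GRing.scale/= invr1 mulr1.
Qed.

Let is_derive_cosln y : is_derive (1 : R) (1 : R) (fun u : R => cos (y * ln u)) 0.
Proof.
have := @is_derive1_comp R cos (fun u : R => y * ln u) 1 _ _ _ (is_derive_mulln y).
rewrite ln1 mulr0 => /(_ _ (is_derive_cos 0)).
by rewrite sin0 oppr0 mul0r.
Qed.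

Let is_derive_sinln y : is_derive (1 : R) (1 : R) (fun u : R => sin (y * ln u)) y.
Proof.
have := @is_derive1_comp R sin (fun u : R => y * ln u) 1 _ _ _ (is_derive_mulln y).
rewrite ln1 mulr0 => /(_ _ (is_derive_sin 0)).
by rewrite cos0 mul1r.
Qed.

Let is_derive_cpowR1 w :
  is_derive (1 : R) (1 : R) (fun u : R => complex.Re (cpowR u w)) (complex.Re w) /\
  is_derive (1 : R) (1 : R) (fun u : R => complex.Im (cpowR u w)) (complex.Im w).
Proof.
have ER : (fun u : R => complex.Re (cpowR u w)) =
    (fun u : R => u `^ complex.Re w) * (fun u : R => cos (complex.Im w * ln u)).
  by apply/funext => u; rewrite /cpowR CReM/= mul0r subr0.
have EI : (fun u : R => complex.Im (cpowR u w)) =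
    (fun u : R => u `^ complex.Re w) * (fun u : R => sin (complex.Im w * ln u)).
  by apply/funext => u; rewrite /cpowR CImM/= mul0r addr0.
rewrite ER EI; split.
  have := is_deriveM (is_derive_Rpow (complex.Re w)) (is_derive_cosln (complex.Im w)).
  by rewrite ln1 mulr0 cos0 scaler0 add0r scale1r.
have := is_deriveM (is_derive_Rpow (complex.Re w)) (is_derive_sinln (complex.Im w)).
by rewrite ln1 mulr0 sin0 scale0r addr0 powR1 scale1r.
Qed.

Let near1_cker z : \forall u \near (1 : R), cpowR u (z - 1) = cker z u.
Proof.
near=> u; rewrite /cker ifT//; near: u; exact: lt_nbhsr.
Unshelve. all: by end_near. Qed.

Let is_derive_cker1 z :
  is_derive (1 : R) (1 : R) (fun u => complex.Re (cker z u)) (complex.Re (z - 1)) /\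
  is_derive (1 : R) (1 : R) (fun u => complex.Im (cker z u)) (complex.Im (z - 1)).
Proof.
have [h1 h2] := is_derive_cpowR1 (z - 1); split.
  by apply: near_eq_is_derive h1; near=> u; congr complex.Re; near: u; exact: near1_cker.
by apply: near_eq_is_derive h2; near=> u; congr complex.Im; near: u; exact: near1_cker.
Unshelve. all: by end_near. Qed.

Lemma cker_continuous1 z :
  {for (1 : R), continuous (fun s => complex.Re (cker z s))} /\
  {for (1 : R), continuous (fun s => complex.Im (cker z s))}.
Proof.
by have [[h1 _] [h2 _]] := is_derive_cker1 z; split;
  apply: differentiable_continuous; apply/derivable1_diffP.
Qed.

(** Undoes the exponential factor, so that integrability of [gker] passes to [pker] on half-lines
    bounded above. *)
Lemma pker_le_gker p s t : s <= t -> pker p s <= expR t * gker p s.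
Proof.
move=> st; rewrite /gker mulrCA -expRD ler_peMr ?pker_ge0//.
by rewrite -expR0 ler_expR subr_ge0.
Qed.

Let integrable_cker_itv z t : 0 < complex.Re z ->
  mu.-integrable `]-oo, t] (EFin \o (fun s => complex.Re (cker z s))) /\
  mu.-integrable `]-oo, t] (EFin \o (fun s => complex.Im (cker z s))).
Proof.
move=> z0; have [m1 m2] := Cmeasurable_cker z.
have i0 : mu.-integrable `]-oo, t] (fun s => (expR t)%:E * (gker (complex.Re z) s)%:E)%E.
  apply: integrableZl => //; apply: integrableS (integrable_gker z0) => //.
split; apply: le_integrable i0 => //.
- by apply/measurable_EFinP; exact: measurable_funTS.
- move=> s /=; rewrite in_itv/= => st; rewrite lee_fin (le_trans (normr_Re_le _))//.
  by rewrite normc_cker (le_trans (pker_le_gker _ st))// ler_norm.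
- by apply/measurable_EFinP; exact: measurable_funTS.
- move=> s /=; rewrite in_itv/= => st; rewrite lee_fin (le_trans (normr_Im_le _))//.
  by rewrite normc_cker (le_trans (pker_le_gker _ st))// ler_norm.
Qed.

(** By [cker_int], B(1, z) u^z is the primitive of s^(z-1); compare the derivatives at u = 1. At
    that point all powers are 1 and all phases vanish. With [Gamma_mul] this becomes the functional
    equation of Gamma. *)
Lemma cbeta1l z : 0 < complex.Re z -> cbeta 1 z * z = 1.
Proof.
move=> z0; set b := cbeta 1 z.
have [cRe cIm] := cker_continuous1 z.
have [iRe iIm] := integrable_cker_itv 2 z0.
have [dRe dIm] := is_derive_cker1 (1 + z).
move: dRe dIm; rewrite [1 + z]addrC addrK => dRe dIm.
have DRe : is_derive (1 : R) (1 : R) (fun u => complex.Re (b * cker (1 + z) u))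
   (complex.Re (b * z)).
  have := is_deriveB (is_deriveZ (complex.Re b) dRe) (is_deriveZ (complex.Im b) dIm).
  rewrite CReM; congr is_derive; apply/funext => u.
  by rewrite CReM addrC.
have DIm : is_derive (1 : R) (1 : R) (fun u => complex.Im (b * cker (1 + z) u))
   (complex.Im (b * z)).
  have := is_deriveD (is_deriveZ (complex.Re b) dIm) (is_deriveZ (complex.Im b) dRe).
  rewrite CImM; congr is_derive; apply/funext => u.
  by rewrite CImM addrC.
apply/eqP; rewrite eq_complex; apply/andP; split; apply/eqP.
  rewrite (FTC_at1 iRe _ cRe DRe).
    by rewrite /cker ltr01 cpowR1.
  by move=> u; rewrite cker_int// ReCint; apply: eq_Rintegral => s _; case: ifP.
rewrite (FTC_at1 iIm _ cIm DIm).
  by rewrite /cker ltr01 cpowR1.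
by move=> u; rewrite cker_int// ImCint; apply: eq_Rintegral => s _; case: ifP.
Qed.

(** For x = v^2 >= 1 the bracket is (v - 1/v)^2, while ln x = 2 ln v and ln v <= v - 1 <= v - 1/v;
    the claim is invariant under x -> 1/x. The right side involves only x, 1 and 1/x, whose averages
    against [gker] are again Gamma values. *)
Lemma sqr_ln_le x : 0 < x -> ln x ^+ 2 <= 4 * (x - 2 + x^-1).
Proof.
have H y : 1 <= y -> ln y ^+ 2 <= 4 * (y - 2 + y^-1).
  move=> y1; have y0 : 0 < y by rewrite (lt_le_trans ltr01).
  pose v := Num.sqrt y; have v0 : 0 < v by rewrite sqrtr_gt0.
  have v1 : 1 <= v by rewrite -sqrtr1 ler_wsqrtr.
  have yv : y = v ^+ 2 by rewrite sqr_sqrtr// ltW.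
  have lnv : ln y = ln v *+ 2 by rewrite yv lnXn.
  have h : ln v <= v - 1.
    by have := @le_ln1Dx R (v - 1); rewrite addrCA subrr addr0; apply; lra.
  have h0 : 0 <= ln v by rewrite ln_ge0.
  have iv : v^-1 <= 1 by rewrite invf_le1.
  have -> : y - 2 + y^-1 = (v - v^-1) ^+ 2.
    by rewrite yv; field; rewrite gt_eqF.
  have -> : ln y = 2 * ln v by rewrite lnv mulr_natl.
  have -> : (4 : R) = 2 ^+ 2 by rewrite -natrX.
  rewrite exprMn ler_wpM2l ?sqr_ge0//.
  by rewrite lerXn2r ?nnegrE//; lra.
move=> x0; have [x1|x1] := leP 1 x; first exact: H.
have := H x^-1; rewrite invf_ge1// => /(_ (ltW x1)).
by rewrite lnV ?posrE// sqrrN invrK; lra.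
Qed.

Lemma normr_sin_le x : `|sin x| <= `|x|.
Proof.
have H y : 0 <= y -> `|sin y| <= y.
  move=> y0; have [|c _] := @MVT_segment R sin cos 0 y y0 (fun u _ => is_derive_sin u).
  - by apply: continuous_subspaceT; exact: continuous_sin.
  - rewrite sin0 !subr0 => ->; rewrite normrM (ger0_norm y0).
    by rewrite ler_piMl// cos_max.
have [x0|x0] := leP 0 x; first by rewrite (ger0_norm x0) H.
by rewrite -normrN -sinN (ltr0_norm x0) H// oppr_ge0 ltW.
Qed.

Lemma cos_ge x : 1 - x ^+ 2 / 2 <= cos x.
Proof.
have -> : x = (x / 2) *+ 2 by rewrite -mulr_natr -mulrA mulVf ?mulr1.
set y := x / 2; rewrite cos_mulr2n cos2sin2.
have : sin y ^+ 2 <= y ^+ 2.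
  by rewrite -[leLHS]real_normK ?num_real// -[leRHS]real_normK ?num_real// lerXn2r ?nnegrE// normr_sin_le.
rewrite -mulr_natr; lra.
Qed.

Let G p := \int[mu]_s gker p s.

Let Gamma_real p : 0 < p -> Gamma p%:C = (G p)%:C.
Proof.
move=> p0; rewrite GammaE//; apply/eqP; rewrite eq_complex; apply/andP; split; apply/eqP.
  rewrite ReCint; apply: eq_Rintegral => s _.
  by rewrite /cgker cker_real -rmorphM.
rewrite ImCint/= -(@Rintegral_set0 _ _ _ mu (fun=> 0)).
rewrite /Rintegral integral0_eq ?integral_set0// => s _.
by rewrite /cgker cker_real -rmorphM.
Qed.

Let G_gt0 p : 0 < p -> 0 < G p.
Proof.
move=> p0; have := integral_gker_gt0 p; rewrite /G /Rintegral.
have /fineK <- // : (\int[mu]_t (gker p t)%:E)%E \is a fin_num.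
by apply: integrable_fin_num => //; exact: integrable_gker.
Qed.

(** The factor [Gamma 1] stays symbolic here; its value is computed in [Gamma1]. *)
Let Gamma_succ z : 0 < complex.Re z ->
  Gamma 1 * (z * Gamma z) = Gamma (1 + z).
Proof.
move=> z0; rewrite mulrCA Gamma_mul ?ltr01//.
by rewrite mulrA [z * _]mulrC cbeta1l// mul1r.
Qed.

Let G_succ p : 0 < p -> G (p + 1) = G 1 * (p * G p).
Proof.
move=> p0; have := @Gamma_succ p%:C p0.
rewrite -[1]/((1 : R)%:C) -rmorphD !Gamma_real ?addr_gt0// -!rmorphM => /(congr1 (@complex.Re R)) /=.
by rewrite addrC => <-.
Qed.

(* Under the Gamma law of shape x, s concentrates near its mean, so that the
   phase of s ^ (i y) is nearly constant and its average cannot vanish. *)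
Let Gamma_neq0_large z : 1 + 2 * complex.Im z ^+ 2 < complex.Re z -> Gamma z != 0.
Proof.
set x := complex.Re z; set y := complex.Im z => xy.
have x1 : 1 < x by rewrite (le_lt_trans _ xy)// lerDl mulr_ge0// sqr_ge0.
have x0 : 0 < x by rewrite (lt_trans ltr01).
have xm0 : 0 < x - 1 by rewrite subr_gt0.
(* The mean G (x + 1) / G x of the Gamma law. *)
pose c := G 1 * x.
have c0 : 0 < c by rewrite mulr_gt0// G_gt0.
have ig p := @integrable_gker R p.
have [iR iI] := Cintegrable_cgker x0.
apply/negP => /eqP; rewrite GammaE// => G0.
(* The right side is the real part of exp(-i y ln c) [cgker z s], whose integral vanishes if Gamma z
   = 0. It equals [gker x s] times the cosine of y ln(s/c). The lower bound follows from cos v >= 1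
   - v^2/2 and [sqr_ln_le] at s/c. *)
have lower s : gker x s * (1 + 4 * y ^+ 2) - 2 * y ^+ 2 * (c^-1 * gker (x + 1) s + c * gker (x - 1) s)
   <= cos (y * ln c) * complex.Re (cgker z s) + sin (y * ln c) * complex.Im (cgker z s).
  have [s0|s0] := leP s 0.
    rewrite /cgker cker_neg// mul0r !mulr0 addr0 /gker !pker_neg// !mul0r !mulr0 addr0.
    by rewrite mulr0 subr0.
  have -> : gker (x + 1) s = gker x s * s.
    rewrite /gker /pker s0 addrAC -mulrA [expR _ * s]mulrC mulrA -[X in _ = _ * X * _]powRr1 ?ltW//.
    by rewrite -powRD// (gt_eqF s0) implybT.
  have -> : gker (x - 1) s = gker x s * s^-1.
    rewrite /gker /pker s0 -mulrA [expR _ * s^-1]mulrC mulrA -[X in _ = _ * X * _]powR_inv1 ?ltW//.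
    by rewrite -powRD// (gt_eqF s0) implybT.
  have -> : cos (y * ln c) * complex.Re (cgker z s) + sin (y * ln c) * complex.Im (cgker z s)
     = gker x s * cos (y * ln (s / c)).
    rewrite ln_div ?posrE// mulrBr cosB /cgker /cker s0 /cpowR /gker /pker s0.
    rewrite !(CReM, CImM)/= !(CReD, CImD)/= oppr0 addr0 -/x -/y.
    by ring.
  have g0 := gker_ge0 x s.
  apply: le_trans (ler_wpM2l g0 (cos_ge _)).
  rewrite -subr_ge0.
  have -> : gker x s * (1 - (y * ln (s / c)) ^+ 2 / 2) -
    (gker x s * (1 + 4 * y ^+ 2) - 2 * y ^+ 2 * (c^-1 * (gker x s * s) + c * (gker x s * s^-1)))
    = gker x s * (y ^+ 2 * ((4 * (s / c - 2 + (s / c)^-1) - ln (s / c) ^+ 2) / 2)).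
    by field; rewrite !gt_eqF.
  rewrite mulr_ge0// mulr_ge0 ?sqr_ge0// divr_ge0// subr_ge0.
  by apply: sqr_ln_le; rewrite divr_gt0.
have iL : mu.-integrable setT (EFin \o (fun s => gker x s * (1 + 4 * y ^+ 2) - 2 * y ^+ 2 * (c^-1 * gker (x + 1) s + c * gker (x - 1) s))).
  have i1 := integrableZl measurableT (1 + 4 * y ^+ 2) (ig x x0).
  have i2 := integrableZl measurableT (c^-1) (ig (x + 1) (addr_gt0 x0 ltr01)).
  have i3 := integrableZl measurableT c (ig (x - 1) xm0).
  have := integrableB measurableT i1 (integrableZl measurableT (2 * y ^+ 2) (integrableD measurableT i2 i3)).
  by apply: eq_integrable => // s _ /=; congr EFin; ring.
have iU : mu.-integrable setT (EFin \o (fun s => cos (y * ln c) * complex.Re (cgker z s) + sin (y * ln c) * complex.Im (cgker z s))).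
  have := integrableD measurableT (integrableZl measurableT (cos (y * ln c)) iR)
    (integrableZl measurableT (sin (y * ln c)) iI).
  by apply: eq_integrable.
have := le_Rintegral measurableT iL iU (fun s _ => lower s).
rewrite [X in _ <= X -> _]RintegralD//; [|exact: (integrableZl _ _ iR)|exact: (integrableZl _ _ iI)].
rewrite [X in _ <= X + _ -> _]RintegralZl// [X in _ <= _ + X -> _]RintegralZl// -ReCint -ImCint G0 !mulr0 addr0.
have iA p : 0 < p -> forall k, mu.-integrable setT (EFin \o (fun s => k * gker p s)).
  by move=> p0 k; exact: (integrableZl _ _ (ig p p0)).
have iAD : mu.-integrable setT (EFin \o (fun s => c^-1 * gker (x + 1) s + c * gker (x - 1) s)).
  have := integrableD measurableT (iA (x + 1) (addr_gt0 x0 ltr01) c^-1) (iA (x - 1) xm0 c).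
  by apply: eq_integrable.
rewrite RintegralB//; last 2 first.
- have := iA x x0 (1 + 4 * y ^+ 2); apply: eq_integrable => // s _ /=.
  by rewrite mulrC.
- exact: (integrableZl _ _ iAD).
rewrite RintegralZr ?ig// RintegralZl// RintegralD//; [|exact: (iA _ (addr_gt0 x0 ltr01) _)|exact: (iA _ xm0 _)].
rewrite RintegralZl ?(ig _ (addr_gt0 x0 ltr01))// RintegralZl ?(ig _ xm0)// -!/(G _).
have Gx : G x = G 1 * ((x - 1) * G (x - 1)) by rewrite -G_succ// subrK.
rewrite G_succ// /c.
(* By the functional equation G (x + 1) / c = G x and c G (x - 1) = G x * x / (x - 1). The
   hypothesis on z says exactly that the resulting factor 1 - 2 y^2 / (x - 1) is positive. *)
have -> : G x * (1 + 4 * y ^+ 2) - 2 * y ^+ 2 *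
     ((G 1 * x)^-1 * (G 1 * (x * G x)) + G 1 * x * G (x - 1)) = G x * (1 - 2 * y ^+ 2 / (x - 1)).
  rewrite Gx; field.
  by rewrite !gt_eqF// G_gt0.
rewrite leNgt mulr_gt0 ?G_gt0// subr_gt0 ltr_pdivrMr// mul1r.
by lra.
Qed.

(** By the functional equation a zero at z propagates to every z + n. The imaginary part stays fixed
    while the real part grows, so some z + n enters the region of [Gamma_neq0_large]. *)
Lemma Gamma_neq0 z : 0 < complex.Re z -> Gamma z != 0.
Proof.
move=> z0; apply/negP => /eqP Gz.
have Gn n : Gamma (z + n%:R) = 0 /\ 0 < complex.Re (z + n%:R).
  elim: n => [|n [ih1 ih2]]; first by rewrite addr0.
  rewrite -addn1 natrD addrA [_ + 1]addrC -Gamma_succ// ih1 !mulr0; split => //.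
  by rewrite CReD ltr_pwDl// ltW.
have ReN n : complex.Re (n%:R : C) = n%:R by rewrite -(rmorph_nat (real_complex R)).
have ImN n : complex.Im (n%:R : C) = 0 by rewrite -(rmorph_nat (real_complex R)).
pose n := (Num.truncn (1 + 2 * complex.Im z ^+ 2)).+1.
have /negP[] : Gamma (z + n%:R) != 0.
  apply: Gamma_neq0_large; rewrite CReD CImD ReN ImN addr0 ltr_pwDl//.
  by rewrite ltW// truncnS_gt.
by rewrite (Gn n).1.
Qed.

End GammaFunction.

(** * Convolution of reciprocal kernels *)

Section KernelIdentity.
Set Implicit Arguments.
Unset Strict Implicit.
Variable R : realType.
Local Notation C := R[i].
Local Notation normc := (@Normc.normc R).

Lemma normcE (z : C) : `|z| = (normc z)%:C.
Proof. by rewrite normc_def; case: z. Qed.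

Lemma normcD_le (z w : C) : normc (z + w) <= normc z + normc w.
Proof. by rewrite -lecR rmorphD/= -!normcE ler_normD. Qed.

Lemma normcX (z : C) n : normc (z ^+ n) = normc z ^+ n.
Proof.
elim: n => [|n ih]; first by rewrite !expr0 Normc.normc1.
by rewrite !exprS Normc.normcM ih.
Qed.

Lemma normc_sum_le n (F : 'I_n -> C) : normc (\sum_i F i) <= \sum_i normc (F i).
Proof.
elim: n F => [|n ih] F; first by rewrite !big_ord0 Normc.normc0.
by rewrite !big_ord_recr/= (le_trans (normcD_le _ _))// lerD2r.
Qed.

Lemma analytic_on_disc_unif (rho r : R) c (A : C -> C) :
  analytic_on_disc rho c A -> 0 < r -> r < rho ->
  forall e : R, 0 < e -> exists N0, forall N, (N0 <= N)%N -> forall z,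
    normc z <= r -> normc (A z - \sum_(k < N) c k * z ^+ k) < e.
Proof.
move=> hA r0 rrho e e0.
have /= := hA r r0 rrho.
have e0' : (0 : C) < e%:C by rewrite ltcR.
move=> /(_ [set h : C^o -> C^o | forall z, `|z : C^o| <= r%:C -> `|(A z : C^o) - h z| < e%:C]).
case.
  apply/uniform_nbhs; exists [set xy : C^o * C^o | `|xy.1 - xy.2| < e%:C]; split => //.
  exact: (entourage_ball _ (PosNum e0')).
move=> N0 _ H; exists N0 => N hN z zr.
have := H N hN z; rewrite !normcE !ltcR !lecR; exact.
Qed.

(** The terms of a series that converges at some r1 between r0 and rho are bounded, which gives
    decay like (r0 / r1)^k. Taking q as the square root of r0 / r1 splits this decay into two equal
    geometric factors: in the double series one makes the sum converge and the other makes its tail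
    small. *)
Lemma coef_bound (rho r0 : R) c (A : C -> C) : analytic_on_disc rho c A ->
  0 < r0 -> r0 < rho ->
  exists M q : R, [/\ 0 <= M, 0 <= q, q < 1 &
    forall k, normc (c k) * r0 ^+ k <= M * (q ^+ k * q ^+ k)].
Proof.
move=> hA r00 r0rho.
pose r1 := (r0 + rho) / 2.
have r01 : r0 < r1 by rewrite /r1; lra.
have r1rho : r1 < rho by rewrite /r1; lra.
have r10 : 0 < r1 by rewrite (lt_trans r00).
have [N0 H] := analytic_on_disc_unif hA r10 r1rho ltr01.
(* The sum covers the first N0 terms. Every later term is the difference of two consecutive
   remainders, each of modulus below 1, hence the 2. *)
pose M := \sum_(k < N0) (normc (c k) * r1 ^+ k) + 2.
have M0 : 0 <= M.
  by rewrite addr_ge0// sumr_ge0// => i _; rewrite mulr_ge0 ?normc_ge0 ?exprn_ge0 ?ltW.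
have HM k : normc (c k) * r1 ^+ k <= M.
  have [kN|Nk] := ltnP k N0.
    rewrite /M (bigD1 (Ordinal kN))//= -addrA lerDl addr_ge0// sumr_ge0// => i _.
    by rewrite mulr_ge0 ?normc_ge0 ?exprn_ge0 ?ltW.
  have nr1 : normc r1%:C = r1 by rewrite /= expr0n addr0 sqrtr_sqr ger0_norm// ltW.
  have h1 := H k Nk r1%:C; have h2 := H k.+1 (leqW Nk) r1%:C.
  move: h1 h2; rewrite nr1 lexx => /(_ isT) h1 /(_ isT) h2.
  have -> : normc (c k) * r1 ^+ k = normc (c k * r1%:C ^+ k).
    by rewrite Normc.normcM normcX nr1.
  have -> : c k * r1%:C ^+ k = (A r1%:C - \sum_(i < k) c i * r1%:C ^+ i) +
     - (A r1%:C - \sum_(i < k.+1) c i * r1%:C ^+ i).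
    by rewrite big_ord_recr/=; ring.
  rewrite (le_trans (normcD_le _ _))// normcN /M.
  rewrite -[leLHS]add0r lerD//; last by lra.
  by rewrite sumr_ge0// => i _; rewrite mulr_ge0 ?normc_ge0 ?exprn_ge0 ?ltW.
exists M, (Num.sqrt (r0 / r1)); split => //.
- by rewrite -sqrtr1 ltr_sqrt// ltr_pdivrMr// mul1r.
move=> k; rewrite -exprMn -expr2 sqr_sqrtr; last exact: divr_ge0 (ltW r00) (ltW r10).
rewrite expr_div_n mulrA ler_pdivlMr ?exprn_gt0// mulrAC ler_wpM2r ?HM//.
by rewrite exprn_ge0 ?ltW.
Qed.

Lemma sum_geom_le (q : R) n : 0 <= q -> q < 1 ->
  \sum_(k < n) q ^+ k <= (1 - q)^-1.
Proof.
move=> q0 q1; have d0 : 0 < 1 - q by rewrite subr_gt0.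
rewrite -[leRHS]mul1r ler_pdivlMr//.
have -> : (\sum_(k < n) q ^+ k) * (1 - q) = 1 - q ^+ n.
  by rewrite -opprB mulrN mulrC -subrX1 opprB.
by rewrite gerBl exprn_ge0.
Qed.

Lemma sum_triangle (V : zmodType) (f : nat -> nat -> V) N :
  \sum_(k < N) \sum_(j < N - k) f k j = \sum_(m < N) \sum_(k < m.+1) f k (m - k)%N.
Proof.
elim: N => [|N ih]; first by rewrite !big_ord0.
rewrite [RHS]big_ord_recr/= -ih.
transitivity (\sum_(k < N.+1) (\sum_(j < N - k) f k j + f k (N - k)%N)).
  apply: eq_bigr => k _; rewrite subSn ?big_ord_recr//.
  by rewrite -ltnS.
rewrite big_split/= big_ord_recr/= subnn big_ord0 addr0//.
Qed.

(** The integrand is the density of the exponential law of rate 1. *)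
Lemma Gamma1 : Gamma (1 : C) = 1.
Proof.
have p1 : 0 < complex.Re (1 : C) by exact: ltr01.
have E s : cgker 1 s = (gker 1 s)%:C :> C.
  by rewrite /cgker -[X in cker X]/((1 : R)%:C) cker_real -rmorphM.
have I1 : \int[mu]_s gker (1 : R) s = 1.
  rewrite /Rintegral -[RHS]/(fine 1%E) -(integral_exponential_pdf (ltr01 : 0 < 1 :> R)).
  congr fine; transitivity (\int[mu]_(t in `]0%R, +oo[) (expR (- (t : R)))%:E)%E.
    rewrite [RHS]integral_mkcond; apply: eq_integral => t _.
    rewrite patchE mem_setE/= in_itv/= andbT /gker /pker subrr powRr0.
    by case: ifP; rewrite ?mul1r ?mul0r.
  rewrite integral_itv_obnd_cbnd; last first.
    apply: measurable_funTS; apply/measurable_EFinP.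
    by apply: measurableT_comp => //; exact: measurableT_comp.
  rewrite integral_mkcond; apply: eq_integral => t _.
  rewrite /exponential_pdf !patchE mem_setE/=.
  by case: ifP => _; rewrite ?mul1r ?mulN1r.
rewrite GammaE//; apply/eqP; rewrite eq_complex; apply/andP; split; apply/eqP.
  by rewrite ReCint -[RHS]I1; apply: eq_Rintegral => s _; rewrite E.
rewrite ImCint/= -(@Rintegral_set0 _ _ _ mu (fun=> 0)).
by rewrite /Rintegral integral0_eq ?integral_set0// => s _; rewrite E.
Qed.

(** On ]0, 1[ raising an exponent only decreases the kernel, and outside of it the product vanishes.
    The bound is uniform in z and w, so a single constant serves all coefficients of the double
    series. *)
Lemma normc_cbeta_le (z w : C) (p q : R) : 0 < p -> 0 < q ->
  p <= complex.Re z -> q <= complex.Re w ->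
  normc (cbeta z w) <= rbeta p q *+ 2.
Proof.
move=> p0 q0 pz qw; apply: normc_Cint_le.
- by apply: Cmeasurable_conv1; exact: Cmeasurable_cker.
- exact: integrable_pconv.
- move=> s; rewrite Normc.normcM !normc_cker.
  have [s0|s0] := leP s 0; first by rewrite !(pker_neg _ s0) !mulr0.
  have [s1|s1] := leP 1 s.
    by rewrite !(@pker_neg _ _ (1 - s)) ?mul0r//; lra.
  by rewrite ler_pM ?pker_ge0// pker_le//; lra.
Qed.

(** * The kernel of a fractional integral and its partial sums *)

Section FractionalKernel.
Variables (T alpha rho : R) (beta : C) (c : nat -> C) (A : C -> C).
Hypotheses (T0 : 0 < T) (alpha0 : 0 < alpha) (beta0 : 0 <= complex.Re beta)
  (rho_gt : T `^ complex.Re beta < rho) (hA : analytic_on_disc rho c A).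

Definition kexp (k : nat) : C := beta *+ k + alpha%:C.

(** The cutoff at T keeps |t^beta| <= T^Re(beta) < rho, the range where the power series controls
    [A]. *)
Definition fker (t : R) : C :=
  if (0 < t) && (t <= T) then (t `^ (alpha - 1))%:C * A (cpowR t beta) else 0.

Definition fker_sum (N : nat) (t : R) : C :=
  if (0 < t) && (t <= T) then \sum_(k < N) c k * cker (kexp k) t else 0.

Lemma Re_kexp k : alpha <= complex.Re (kexp k).
Proof.
by rewrite /kexp CReD/= raddfMn/= lerDr mulrn_wge0.
Qed.

Lemma Re_kexp_gt0 k : 0 < complex.Re (kexp k).
Proof. exact: lt_le_trans alpha0 (Re_kexp k). Qed.

Lemma cker_kexp k t : 0 < t ->
  cker (kexp k) t = (t `^ (alpha - 1))%:C * cpowR t beta ^+ k.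
Proof.
move=> t0; rewrite /cker t0 /kexp -addrA [_ + (_ - 1)]addrC cpowRD// cpowRMn//.
by rewrite -cpowR_real// rmorphB.
Qed.

Lemma fker_sumE N t : 0 < t -> t <= T ->
  fker_sum N t = (t `^ (alpha - 1))%:C * \sum_(k < N) c k * cpowR t beta ^+ k.
Proof.
move=> t0 tT; rewrite /fker_sum t0 tT/= mulr_sumr; apply: eq_bigr => k _.
by rewrite cker_kexp// mulrCA.
Qed.

Let r0 := T `^ complex.Re beta.

Let r00 : 0 < r0. Proof. exact: powR_gt0. Qed.

Lemma normc_cpowR_le t : 0 < t -> t <= T -> normc (cpowR t beta) <= r0.
Proof.
by move=> t0 tT; rewrite normc_cpowR ge0_ler_powR// nnegrE ltW.
Qed.

Lemma fker_sum_cvg t (e : R) : 0 < e ->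
  exists N0, forall N, (N0 <= N)%N -> normc (fker t - fker_sum N t) <= pker alpha t * e.
Proof.
move=> e0; have [N0 H] := analytic_on_disc_unif hA r00 rho_gt e0.
exists N0 => N hN; rewrite /fker; case: ifPn => [/andP[t0 tT]|h]; last first.
  by rewrite /fker_sum (negbTE h) subrr Normc.normc0 mulr_ge0 ?pker_ge0// ltW.
rewrite fker_sumE// -mulrBr Normc.normcM -cpowR_real// normc_cpowR/= /pker t0.
by rewrite ler_wpM2l ?powR_ge0// ltW// H// normc_cpowR_le.
Qed.

(** One constant serves the kernel and all its partial sums, as dominated convergence requires. The
    coefficients decay geometrically at T^Re(beta), so the partial sums of the series are bounded
    uniformly on ]0, T]. *)
Lemma fker_bound : exists M, [/\ 0 <= M,
  forall t, normc (fker t) <= M * pker alpha t &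
  forall N t, normc (fker_sum N t) <= M * pker alpha t].
Proof.
have [M [q [M0 q0 q1 H]]] := coef_bound hA r00 rho_gt.
have d0 : 0 < 1 - q by rewrite subr_gt0.
have K0 : 0 <= M * (1 - q)^-1 by rewrite mulr_ge0// invr_ge0 ltW.
have HN N t : normc (fker_sum N t) <= M * (1 - q)^-1 * pker alpha t.
  have [/andP[t0 tT]|h] := boolP ((0 < t) && (t <= T)); last first.
    by rewrite /fker_sum (negbTE h) Normc.normc0 mulr_ge0 ?pker_ge0.
  rewrite fker_sumE// Normc.normcM -cpowR_real// normc_cpowR/= /pker t0 mulrC.
  rewrite ler_wpM2r ?powR_ge0// (le_trans (normc_sum_le _))//.
  apply: le_trans (ler_wpM2l M0 (sum_geom_le N q0 q1)).
  rewrite mulr_sumr ler_sum// => k _; rewrite Normc.normcM normcX.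
  apply: (@le_trans _ _ (normc (c k) * r0 ^+ k)).
    by rewrite ler_wpM2l ?normc_ge0// lerXn2r ?nnegrE ?normc_ge0 ?normc_cpowR_le// ltW.
  rewrite (le_trans (H k))// ler_wpM2l// ler_piMr ?exprn_ge0//.
  by rewrite exprn_ile1// ltW.
(* The extra 1 pays for replacing the kernel by a partial sum that is accurate up to
   [pker alpha t]. *)
exists (M * (1 - q)^-1 + 1); split; first by rewrite addr_ge0.
- move=> t; have [N0 /(_ N0 (leqnn _)) h] := fker_sum_cvg t ltr01.
  rewrite -[fker t](subrK (fker_sum N0 t)) (le_trans (normcD_le _ _))//.
  by rewrite mulrDl addrC lerD// mulrC.
- by move=> N t; rewrite (le_trans (HN N t))// ler_wpM2r ?pker_ge0// lerDl.
Qed.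

Lemma Cmeasurable_if_itv (f : R -> C) : Cmeasurable f ->
  Cmeasurable (fun t => if (0 < t) && (t <= T) then f t else 0).
Proof.
move=> [m1 m2].
have mb : measurable_fun setT (fun t : R => (0 < t) && (t <= T)).
  by apply: measurable_and; [exact: measurable_fun_ltr|exact: measurable_fun_ler].
split.
- have -> : (fun t : R => complex.Re (if (0 < t) && (t <= T) then f t else 0)) =
   (fun t => if (0 < t) && (t <= T) then complex.Re (f t) else 0).
    by apply/funext => t; case: ifP.
  exact: measurable_fun_ifT.
- have -> : (fun t : R => complex.Im (if (0 < t) && (t <= T) then f t else 0)) =
   (fun t => if (0 < t) && (t <= T) then complex.Im (f t) else 0).
    by apply/funext => t; case: ifP.
  exact: measurable_fun_ifT.
Qed.

Lemma Cmeasurable_fker_sum N : Cmeasurable (fker_sum N).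
Proof.
apply: Cmeasurable_if_itv; apply: Cmeasurable_sum => i.
by apply: CmeasurableM; [exact: Cmeasurable_cst|exact: Cmeasurable_cker].
Qed.

Lemma fker_sum_cvgRe t :
  complex.Re (fker_sum N t) @[N --> \oo] --> complex.Re (fker t) /\
  complex.Im (fker_sum N t) @[N --> \oo] --> complex.Im (fker t).
Proof.
have H (e : R) : 0 < e -> \forall N \near \oo, normc (fker t - fker_sum N t) < e.
  move=> e0; have d0 : 0 < pker alpha t + 1 by rewrite ltr_wpDl ?pker_ge0.
  have [N0 h] := fker_sum_cvg t (divr_gt0 e0 d0).
  exists N0 => // N /= hN; rewrite (le_lt_trans (h N hN))//.
  by rewrite mulrA ltr_pdivrMr// mulrC ltr_pM2l// ltrDl.
split; apply/cvgrPdist_lt => e e0; have := H e e0; apply: filterS => N; apply: le_lt_trans.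
- by rewrite -raddfB; exact: normr_Re_le.
- by rewrite -raddfB; exact: normr_Im_le.
Qed.

(** Measurability is inherited from the partial sums, which are finite combinations of powers and
    converge pointwise. *)
Lemma Cmeasurable_fker : Cmeasurable fker.
Proof.
split.
- apply: (@measurable_fun_cvg _ _ _ setT (fun N t => complex.Re (fker_sum N t))) => //.
  + by move=> N; exact: (Cmeasurable_fker_sum N).1.
  + by move=> t _; exact: (fker_sum_cvgRe t).1.
- apply: (@measurable_fun_cvg _ _ _ setT (fun N t => complex.Im (fker_sum N t))) => //.
  + by move=> N; exact: (Cmeasurable_fker_sum N).2.
  + by move=> t _; exact: (fker_sum_cvgRe t).2.
Qed.

End FractionalKernel.

(** * The two kernels convolve to 1 *)

Section KernelConvolution.
Variables (T alpha rho rhobar : R) (beta : C) (c cbar : nat -> C) (A Abar : C -> C).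
Hypotheses (T0 : 0 < T) (alpha0 : 0 < alpha) (alpha1 : alpha < 1)
  (beta0 : 0 <= complex.Re beta)
  (rho_gt : T `^ complex.Re beta < rho) (hA : analytic_on_disc rho c A)
  (rhobar_gt : T `^ complex.Re beta < rhobar)
  (hAbar : analytic_on_disc rhobar cbar Abar)
  (A_Abar : series_reciprocal (gamma_transform alpha beta c)
                              (gamma_transform (1 - alpha) beta cbar)).

Let alpha1' : 0 < 1 - alpha. Proof. by rewrite subr_gt0. Qed.

(** The convolution of term k of the first kernel with term j of the second is d k j * t^(beta (k +
    j)): the orders alpha and 1 - alpha add up to 1, so no singular power of t is left. *)
Let d (k j : nat) : C := c k * cbar j * cbeta (kexp alpha beta k) (kexp (1 - alpha) beta j).

Let kexpD k j : kexp alpha beta k + kexp (1 - alpha) beta j = beta *+ (k + j) + 1.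
Proof.
rewrite /kexp addrACA -mulrnDr -rmorphD; congr (_ + _).
by rewrite addrC subrK.
Qed.

(** Multiplication by Gamma(beta N + 1), which is nonzero, turns each Beta value into a product of
    two Gamma values. The sum becomes coefficient N of the product of the two transforms. *)
Let antidiag N : \sum_(k < N.+1) d k (N - k) = (N == 0%N)%:R.
Proof.
have ReN : 0 < complex.Re (beta *+ N + 1).
  by rewrite CReD/= raddfMn/= ltr_wpDl// mulrn_wge0.
apply: (mulIf (Gamma_neq0 ReN)).
transitivity (\sum_(k < N.+1) gamma_transform alpha beta c k *
    gamma_transform (1 - alpha) beta cbar (N - k)).
  rewrite mulr_suml; apply: eq_bigr => k _.
  rewrite /gamma_transform -/(kexp _ _ _) -/(kexp _ _ _) mulrACA Gamma_mul ?Re_kexp_gt0//.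
  by rewrite kexpD subnKC ?mulrA// -ltnS.
rewrite A_Abar; case: eqP => [->|_]; last by rewrite mul0r.
by rewrite mulr0n add0r Gamma1 mulr1.
Qed.

Let conv_sum N t : 0 < t -> t <= T ->
  Cint (fun s => fker_sum T alpha beta c N (t - s) * fker_sum T (1 - alpha) beta cbar N s) =
  \sum_(k < N) \sum_(j < N) d k j * cpowR t beta ^+ (k + j).
Proof.
move=> t0 tT.
have ii k j : Cintegrable (fun s => (c k * cbar j) *
    (cker (kexp alpha beta k) (t - s) * cker (kexp (1 - alpha) beta j) s)).
  by apply/CintegrableZl/Cintegrable_cconv; exact: Re_kexp_gt0.
transitivity (Cint (fun s => \sum_(k < N) \sum_(j < N) (c k * cbar j) *
    (cker (kexp alpha beta k) (t - s) * cker (kexp (1 - alpha) beta j) s))).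
  apply: eq_Cint => s; have [/andP[s0 st]|h] := boolP ((0 < s) && (s < t)).
    have sT : s <= T by rewrite ltW// (lt_le_trans st).
    have tsT : t - s <= T by rewrite lerBlDr (le_trans tT)// lerDl ltW.
    rewrite /fker_sum subr_gt0 st s0 sT tsT/= mulr_suml; apply: eq_bigr => k _.
    by rewrite mulr_sumr; apply: eq_bigr => j _; rewrite mulrACA.
  have [s0|s0] := leP s 0.
    rewrite /fker_sum [X in _ * (if X && _ then _ else _)]ltNge s0/= mulr0 big1// => k _.
    by rewrite big1// => j _; rewrite (cker_neg _ s0) !mulr0.
  have st : t <= s by move: h; rewrite s0/= -leNgt.
  rewrite /fker_sum subr_gt0 ltNge st/= mul0r big1// => k _.
  by rewrite big1// => j _; rewrite (@cker_neg _ _ (t - s)) ?subr_le0// mul0r mulr0.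
have isum (k : 'I_N) := Cint_sum (fun j : 'I_N => ii k j).
rewrite (Cint_sum (fun k => (isum k).1)).2; apply: eq_bigr => k _.
rewrite (isum k).2; apply: eq_bigr => j _.
rewrite CintZl; last by apply: Cintegrable_cconv; exact: Re_kexp_gt0.
rewrite Cint_cconv ?Re_kexp_gt0// kexpD /cker t0 addrK cpowRMn//.
by rewrite mulrA.
Qed.

(** By [antidiag] the triangle k + j < N contributes exactly 1 as soon as N > 0. Each remaining term
    of the square is at most a constant times p^k p^j p^(k+j): the factors p^k p^j are summable, and
    p^(k+j) <= p^N since k + j >= N. *)
Let sum_cvg t : 0 < t -> t <= T -> forall e : R, 0 < e -> exists N0, forall N, (N0 <= N)%N ->
  normc (\sum_(k < N) \sum_(j < N) d k j * cpowR t beta ^+ (k + j) - 1) < e.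
Proof.
move=> t0 tT e e0.
have r00 : 0 < T `^ complex.Re beta by exact: powR_gt0.
have [M [q [M0 q0 q1 HM]]] := coef_bound hA r00 rho_gt.
have [M' [q' [M'0 q'0 q'1 HM']]] := coef_bound hAbar r00 rhobar_gt.
pose p := Num.max q q'.
have p0 : 0 <= p by rewrite le_max q0.
have p1 : p < 1 by rewrite gt_max q1.
pose B := rbeta alpha (1 - alpha) *+ 2.
have B0 : 0 <= B.
  apply: le_trans (normc_cbeta_le alpha0 alpha1' (lexx _ : alpha <= complex.Re alpha%:C) (lexx _ : 1 - alpha <= complex.Re (1 - alpha)%:C)).
  exact: normc_ge0.
have wr : normc (cpowR t beta) <= T `^ complex.Re beta.
  by rewrite normc_cpowR ge0_ler_powR// nnegrE ltW.
have dle k j : normc (d k j * cpowR t beta ^+ (k + j)) <= M * M' * B * (p ^+ k * p ^+ j) * (p ^+ (k + j)).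
  rewrite /d !Normc.normcM normcX exprD.
  have h1 : normc (c k) * normc (cpowR t beta) ^+ k <= M * (p ^+ k * p ^+ k).
    apply: (@le_trans _ _ (normc (c k) * (T `^ complex.Re beta) ^+ k)).
      by rewrite ler_wpM2l ?normc_ge0// lerXn2r ?nnegrE ?normc_ge0 ?(ltW r00).
    rewrite (le_trans (HM k))// ler_wpM2l// ler_pM ?exprn_ge0// lerXn2r ?nnegrE// le_max lexx//.
  have h2 : normc (cbar j) * normc (cpowR t beta) ^+ j <= M' * (p ^+ j * p ^+ j).
    apply: (@le_trans _ _ (normc (cbar j) * (T `^ complex.Re beta) ^+ j)).
      by rewrite ler_wpM2l ?normc_ge0// lerXn2r ?nnegrE ?normc_ge0 ?(ltW r00).
    rewrite (le_trans (HM' j))// ler_wpM2l// ler_pM ?exprn_ge0// lerXn2r ?nnegrE// le_max lexx orbT//.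
  have h3 : normc (cbeta (kexp alpha beta k) (kexp (1 - alpha) beta j)) <= B.
    by apply: normc_cbeta_le => //; exact: Re_kexp.
  have := ler_pM (mulr_ge0 (mulr_ge0 (normc_ge0 (c k)) (exprn_ge0 k (normc_ge0 (cpowR t beta)))) (mulr_ge0 (normc_ge0 (cbar j)) (exprn_ge0 j (normc_ge0 (cpowR t beta))))) (normc_ge0 (cbeta (kexp alpha beta k) (kexp (1 - alpha) beta j)))
   (ler_pM (mulr_ge0 (normc_ge0 (c k)) (exprn_ge0 k (normc_ge0 (cpowR t beta)))) (mulr_ge0 (normc_ge0 (cbar j)) (exprn_ge0 j (normc_ge0 (cpowR t beta)))) h1 h2) h3.
  rewrite [p ^+ (k + j)]exprD.
  by congr (_ <= _); ring.
pose L := M * M' * B * ((1 - p)^-1 * (1 - p)^-1).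
have L0 : 0 <= L by rewrite !mulr_ge0// invr_ge0 subr_ge0 ltW.
have tail N : (0 < N)%N ->
    normc (\sum_(k < N) \sum_(j < N) d k j * cpowR t beta ^+ (k + j) - 1) <= L * p ^+ N.
  move=> N0.
  have tri : \sum_(k < N) \sum_(j < N - k) d k j * cpowR t beta ^+ (k + j) = 1.
    rewrite (sum_triangle (fun k j => d k j * cpowR t beta ^+ (k + j))).
    rewrite (eq_bigr (fun m : 'I_N => (val m == 0%N)%:R * cpowR t beta ^+ m)); last first.
      move=> m _; rewrite -antidiag mulr_suml; apply: eq_bigr => k _.
      by rewrite subnKC// -ltnS.
    case: N N0 => // N _; rewrite big_ord_recl/= expr0 mulr1 big1 ?addr0// => i _.
    by rewrite mul0r.
  rewrite -[X in _ - X]tri -sumrB.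
  rewrite (le_trans (normc_sum_le _))//.
  apply: (@le_trans _ _ (\sum_(k < N) \sum_(j < N) M * M' * B * (p ^+ k * p ^+ j) * p ^+ N)).
    apply: ler_sum => k _.
    have -> : \sum_(j < N) d k j * cpowR t beta ^+ (k + j) -
        \sum_(j < N - k) d k j * cpowR t beta ^+ (k + j) =
        \sum_(j < N) if (j < N - k)%N then 0 else d k j * cpowR t beta ^+ (k + j).
      rewrite [X in _ - X](big_ord_widen N (fun j => d k j * cpowR t beta ^+ (k + j))) ?leq_subr//.
      rewrite [X in X - _](bigID (fun j : 'I_N => (j < N - k)%N))/= addrAC subrr add0r.
      rewrite [RHS](bigID (fun j : 'I_N => (j < N - k)%N))/= [X in _ = X + _]big1 ?add0r; last first.
        by move=> j ->.
      by apply: eq_bigr => j /negbTE ->.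
    rewrite (le_trans (normc_sum_le _))// ler_sum// => j _.
    case: ltnP => h; first by rewrite Normc.normc0 !mulr_ge0 ?exprn_ge0.
    rewrite (le_trans (dle _ _))// ler_wpM2l ?mulr_ge0 ?exprn_ge0//.
    by rewrite ler_wiXn2l// ?ltW// -leq_subLR.
  rewrite /L.
  rewrite (eq_bigr (fun k : 'I_N => M * M' * B * p ^+ N * (\sum_(j < N) p ^+ j) * p ^+ k)); last first.
    move=> k _; rewrite mulr_sumr mulr_suml; apply: eq_bigr => j _; ring.
  rewrite -mulr_sumr.
  have g := sum_geom_le N p0 p1.
  have -> : M * M' * B * ((1 - p)^-1 / (1 - p)) * p ^+ N = M * M' * B * p ^+ N * (1 - p)^-1 * (1 - p)^-1.
    by ring.
  have s0 : 0 <= \sum_(j < N) p ^+ j by rewrite sumr_ge0// => i _; exact: exprn_ge0.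
  by rewrite ler_pM ?ler_wpM2l ?mulr_ge0 ?exprn_ge0.
have pabs : `|p| < 1 by rewrite ger0_norm.
have e1 : 0 < e / (L + 1) by rewrite divr_gt0// ltr_wpDl.
have /cvgrPdist_lt/(_ _ e1)[N1 _ HN1] := cvg_expr pabs.
exists (maxn N1 1) => N; rewrite geq_max => /andP[hN1 hN].
rewrite (le_lt_trans (tail N hN))//.
have := HN1 N hN1; rewrite /= sub0r normrN ger0_norm ?exprn_ge0//.
rewrite ltr_pdivlMr ?ltr_wpDl// => h.
by rewrite (le_lt_trans _ h)// mulrC ler_wpM2l ?exprn_ge0// lerDl.
Qed.

(** The convolutions of the partial sums tend to 1 by [conv_sum] and [sum_cvg]. By [fker_bound] they
    are dominated by a multiple of the real Beta integrand, so the limit may be taken under the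
    integral. *)
Lemma fker_conv t : 0 < t -> t <= T ->
  \int[mu]_s complex.Re (fker T alpha beta A (t - s) * fker T (1 - alpha) beta Abar s) = 1.
Proof.
move=> t0 tT.
have [M [M0 HM HMN]] := fker_bound alpha T0 beta0 rho_gt hA.
have [M' [M'0 HM' HMN']] := fker_bound (1 - alpha) T0 beta0 rhobar_gt hAbar.
pose fN N s := complex.Re (fker_sum T alpha beta c N (t - s) * fker_sum T (1 - alpha) beta cbar N s).
pose f s := complex.Re (fker T alpha beta A (t - s) * fker T (1 - alpha) beta Abar s).
pose g s := M * M' * (pker alpha (t - s) * pker (1 - alpha) s).
have ig : mu.-integrable setT (EFin \o g).
  by have := integrableZl measurableT (M * M') (integrable_pconv t alpha0 alpha1').
have mfN N : measurable_fun setT (EFin \o fN N).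
  apply/measurable_EFinP.
  exact: (Cmeasurable_conv1 t (Cmeasurable_fker_sum T alpha beta c N) (Cmeasurable_fker_sum T (1 - alpha) beta cbar N)).1.
have mf : measurable_fun setT (EFin \o f).
  apply/measurable_EFinP.
  exact: (Cmeasurable_conv1 t (Cmeasurable_fker alpha T0 beta0 rho_gt hA) (Cmeasurable_fker (1 - alpha) T0 beta0 rhobar_gt hAbar)).1.
have cf s : fN N s @[N --> \oo] --> f s.
  have [h1 h2] := fker_sum_cvgRe alpha T0 beta0 rho_gt hA (t - s).
  have [h3 h4] := fker_sum_cvgRe (1 - alpha) T0 beta0 rhobar_gt hAbar s.
  rewrite /fN /f CReM; under eq_fun do rewrite CReM.
  by apply: cvgB; apply: cvgM.
have fg N s : (`|(EFin \o fN N) s| <= (EFin \o g) s)%E.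
  rewrite /= lee_fin (le_trans (normr_Re_le _))// Normc.normcM /g.
  have := ler_pM (normc_ge0 _) (normc_ge0 _) (HMN N (t - s)) (HMN' N s).
  by rewrite mulrACA.
have [] := @dominated_convergence _ _ _ mu setT measurableT (fun N => EFin \o fN N) (EFin \o f) (EFin \o g) mfN mf _ ig _.
- by apply: aeW => s _; apply/cvg_EFin; [exact: nearW|exact: cf].
- by apply: aeW => s N _; exact: fg.
move=> if_ _ cv.
have cv1 : (\int[mu]_x (EFin \o fN N) x)%E @[N --> \oo] --> 1%E.
  have ifN N : mu.-integrable setT (EFin \o fN N).
    apply: (@le_integrable _ _ _ mu setT measurableT (EFin \o fN N) (EFin \o g) (mfN N)) => // s _.
    by rewrite (le_trans (fg N s))//= lee_fin ler_norm.
  have -> : (fun N => (\int[mu]_x (EFin \o fN N) x)%E) = (fun N => (\int[mu]_x fN N x)%:E).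
    apply/funext => N; rewrite /Rintegral fineK//.
    by apply: integrable_fin_num => //; exact: ifN.
  apply/cvg_EFin; first exact: nearW.
  apply/cvgrPdist_lt => e e0.
  have [N0 H] := sum_cvg t0 tT e0.
  exists N0 => // N /= hN.
  have := H N hN; rewrite -conv_sum// => h.
  rewrite (le_lt_trans _ h)// distrC.
  by apply: le_trans (normr_Re_le _); rewrite raddfB/=.
have := cvg_unique _ cv cv1.
by rewrite /Rintegral => /(_ (@ereal_hausdorff _)) ->.
Qed.

End KernelConvolution.

End KernelIdentity.

(** * Piecewise continuous functions *)

Section PiecewiseContinuous.
Set Implicit Arguments.
Unset Strict Implicit.
Variable R : realType.

Lemma itv_partition_piece (a b t : R) (s : seq R) : itv_partition a b s ->
  a < t -> t < b -> t \notin s ->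
  exists i, [/\ (i < size s)%N, nth a (a :: s) i < t & t < nth a s i].
Proof.
elim: s a => [|c s ih] a abs at_ tb.
  by move: (itv_partition_nil abs) => ab; move: (lt_trans at_ tb); rewrite ab ltxx.
rewrite inE negb_or => /andP[tc ts].
have [ct|] := ltP c t; last first.
  by rewrite le_eqVlt (negbTE tc)/= => ct; exists 0%N.
have [i [si h1 h2]] := ih c (itv_partition_cons abs) ct tb ts.
exists i.+1; split => //=.
  by rewrite (set_nth_default c)//= ltnW.
by rewrite (set_nth_default c).
Qed.

Lemma cvg_right_bounded (V : normedModType R) (g : R -> V) (p : R) :
  cvg (g t @[t --> p^'+]) ->
  exists d M : R, 0 < d /\ forall t, p < t -> t < p + d -> `|g t| <= M.
Proof.
move=> cg; have := cvgr_norm_lt _ cg (`|lim (g t @[t --> p^'+])| + 1).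
rewrite ltrDl ltr01 => /(_ _ isT)/nbhs_ballP[d /= d0 H].
exists d, (`|lim (g t @[t --> p^'+])| + 1); split => // t pt tpd.
apply/ltW/H => //; rewrite /ball/= ltr0_norm ?subr_lt0//.
by rewrite opprB ltrBlDl.
Qed.

Lemma cvg_left_bounded (V : normedModType R) (g : R -> V) (p : R) :
  cvg (g t @[t --> p^'-]) ->
  exists d M : R, 0 < d /\ forall t, p - d < t -> t < p -> `|g t| <= M.
Proof.
move=> cg; have := cvgr_norm_lt _ cg (`|lim (g t @[t --> p^'-])| + 1).
rewrite ltrDl ltr01 => /(_ _ isT)/nbhs_ballP[d /= d0 H].
exists d, (`|lim (g t @[t --> p^'-])| + 1); split => // t pt tpd.
apply/ltW/H => //; rewrite /ball/= gtr0_norm ?subr_gt0//.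
by rewrite ltrBlDr -ltrBlDl.
Qed.

Lemma piece_bounded (V : normedModType R) (g : R -> V) (p q : R) :
  {in `]p, q[, continuous g} -> cvg (g t @[t --> p^'+]) ->
  cvg (g t @[t --> q^'-]) ->
  exists M : R, forall t, p < t -> t < q -> `|g t| <= M.
Proof.
move=> cg /cvg_right_bounded[d1 [M1 [d10 H1]]] /cvg_left_bounded[d2 [M2 [d20 H2]]].
pose u := p + d1 / 2; pose v := q - d2 / 2.
have [M3 H3] : exists M3 : R, forall t, u <= t -> t <= v -> `|g t| <= M3.
  have [uv|vu] := leP u v; last first.
    exists 0 => t ut tv; move: (lt_le_trans vu (le_trans ut tv)).
    by rewrite ltxx.
  have [|c _ Hc] := @EVT_max R (fun t => `|g t|) u v uv.
    apply: continuous_in_subspaceT => t; rewrite inE/= in_itv/= => /andP[ut tv].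
    apply: cvg_norm; apply: cg; rewrite in_itv/=.
    by apply/andP; split; move: ut tv; rewrite /u /v; lra.
  by exists `|g c| => t ut tv; apply: Hc; rewrite in_itv/= ut tv.
exists (Num.max M1 (Num.max M2 M3)) => t pt tq; rewrite !le_max.
have [h1|h1] := ltP t (p + d1); first by rewrite H1.
have [h2|h2] := ltP (q - d2) t; first by rewrite H2// orbT.
by rewrite H3 ?orbT// /u /v; lra.
Qed.

(** All that is kept of a partition is a finite list of exceptional points. Functions with different
    breakpoints then share the concatenated list, without a common refinement. *)
Definition continuous_off (V : normedModType R) (a b : R) (S : seq R) (g : R -> V) :=
  forall t, a < t -> t < b -> t \notin S -> {for t, continuous g}.

Lemma continuous_pieces_off (V : normedModType R) (a b : R) (s : seq R) (g : R -> V) :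
  itv_partition a b s -> continuous_pieces a s g ->
  continuous_off a b s g /\
  exists M : R, forall t, a <= t -> t <= b -> `|g t| <= M.
Proof.
move=> abs gs; split.
  move=> t at_ tb ts; have [i [si h1 h2]] := itv_partition_piece abs at_ tb ts.
  by have [H _ _] := gs i si; apply: H; rewrite in_itv/= h1 h2.
have /choice[M HM] : forall i, exists M : R, (i < size s)%N ->
    forall t, nth a (a :: s) i < t -> t < nth a s i -> `|g t| <= M.
  move=> i.
  have [si|_] := ltnP i (size s); last by exists 0.
  by have [h1 h2 h3] := gs i si; have [M H] := piece_bounded h1 h2 h3; exists M.
(* The values at a and at the breakpoints are unrelated to the one-sided limits, so they enter the
   bound as a separate sum. *)
exists (\sum_(i < size s) `|M i| + \sum_(x <- a :: s) `|g x|) => t at_ tb.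
have h0 : 0 <= \sum_(i < size s) `|M i| by exact: sumr_ge0.
have h0' : 0 <= \sum_(x <- a :: s) `|g x| by exact: sumr_ge0.
have [ts|] := boolP (t \in a :: s).
  rewrite (le_trans _ (_ : \sum_(x <- a :: s) `|g x| <= _))//; last by rewrite lerDr.
  by rewrite (big_rem _ ts)/= lerDl sumr_ge0.
rewrite inE negb_or => /andP[ta ts].
have at' : a < t by rewrite lt_neqAle eq_sym ta.
have tb' : t < b.
  rewrite lt_neqAle tb andbT; apply: contra ts => /eqP ->.
  have [_ /eqP lb] := abs; rewrite -lb.
  case: s lb {abs gs M HM h0 h0'} => [/= lb|c s _]; last by rewrite /= mem_last.
  by move: (lt_le_trans at' tb); rewrite lb ltxx.
have [i [si h1 h2]] := itv_partition_piece abs at' tb' ts.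
rewrite (le_trans (HM i si t h1 h2))// (le_trans (ler_norm _))//.
rewrite (le_trans _ (_ : \sum_(i < size s) `|M i| <= _))//; last by rewrite lerDl.
by rewrite (bigD1 (Ordinal si))//= lerDl sumr_ge0.
Qed.

Lemma PC_continuous_off (V : normedModType R) (a b : R) (g : R -> V) : PC a b g ->
  exists S, continuous_off a b S g /\
  exists M : R, forall t, a <= t -> t <= b -> `|g t| <= M.
Proof.
by move=> [s abs gs]; exists s; exact: continuous_pieces_off.
Qed.

Lemma closed_seq (S : seq R) : closed [set` S].
Proof.
apply: accessible_finite_set_closed.1; last exact: finite_seq.
exact/hausdorff_accessible/Rhausdorff.
Qed.

Lemma measurable_off_finite (S : seq R) (f g : R -> R) :
  (forall t, t \notin S -> f t = g t) -> measurable_fun setT g -> measurable_fun setT f.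
Proof.
elim: S f => [|p S ih] f fg mg.
  by have -> : f = g by apply/funext => t; exact: fg.
pose f' t := if t == p then g p else f t.
have mf' : measurable_fun setT f'.
  apply: ih => // t tS; rewrite /f'; case: eqP => [->//|/eqP tp].
  by rewrite fg// inE negb_or tp.
have -> : f = (fun t => if t == p then f p else f' t).
  by apply/funext => t; rewrite /f'; case: eqP => [->|].
apply: measurable_fun_ifT => //; exact: measurable_fun_eqr.
Qed.

Lemma Rintegral_off_finite (S : seq R) (f g : R -> R) :
  (forall t, t \notin S -> f t = g t) -> measurable_fun setT g ->
  \int[mu]_t f t = \int[mu]_t g t.
Proof.
move=> fg mg; have mf := measurable_off_finite fg mg.
rewrite /Rintegral; congr fine; apply: ae_eq_integral => //.
- exact/measurable_EFinP.
- exact/measurable_EFinP.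
exists [set` S]; split.
- by have := closed_measurable (@closed_seq S).
- by apply: countable_lebesgue_measure0; exact: finite_set_countable.
- move=> t /=; apply: contra_notP => tS _; rewrite fg//; exact/negP.
Qed.

Lemma open_setC_seq (S : seq R) : open (~` [set` S]).
Proof.
exact/closed_openC/closed_seq.
Qed.

Lemma measurable_continuous_off (a b : R) (S : seq R) (f : R -> R) :
  continuous_off a b S f ->
  measurable_fun setT (fun t => if (a < t) && (t < b) then f t else 0).
Proof.
move=> cf; pose U : set R := `]a, b[%classic `&` ~` [set` S].
have oU : open U by apply: openI; [exact: interval_open|exact: open_setC_seq].
apply: (@measurable_off_finite S _ (f \_ U)).
  move=> t tS; rewrite patchE; case: ifPn => h.
    by rewrite mem_set//; split; [rewrite /= in_itv|exact/negP].
  by rewrite memNset// => -[]; rewrite /= in_itv/= (negbTE h).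
apply/(measurable_restrictT _ _).1; first exact: open_measurable.
apply: open_continuous_measurable_fun => // t.
by rewrite inE => -[/=]; rewrite in_itv/= => /andP[at_ tb] /negP; exact: cf.
Qed.

(** Induction on the exceptional points: one lying inside ]p, q[ cuts the interval in two, and
    continuity up to the cut glues the halves. *)
Lemma derive0_off_constant (S : seq R) (phi : R -> R) (p q : R) : p <= q ->
  {within `[p, q], continuous phi} ->
  (forall t, p < t -> t < q -> t \notin S -> is_derive t 1 phi 0) ->
  phi p = phi q.
Proof.
elim: S p q => [|c S ih] p q pq cphi dphi.
  have [|c _] := MVT_segment pq _ cphi (df := fun=> 0).
    by move=> t; rewrite in_itv/= => /andP[h1 h2]; exact: dphi.
  by rewrite mul0r => /eqP; rewrite subr_eq0 => /eqP.
have [pc|cp] := ltP p c; last first.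
  apply: ih => // t pt tq tS; apply: dphi => //.
  by rewrite inE negb_or tS andbT gt_eqF// (le_lt_trans cp).
have [cq|qc] := ltP c q; last first.
  apply: ih => // t pt tq tS; apply: dphi => //.
  by rewrite inE negb_or tS andbT lt_eqF// (lt_le_trans tq).
transitivity (phi c).
  apply: ih; first exact: ltW.
    apply: continuous_subspaceW cphi; apply: subset_itvl; rewrite bnd_simp; exact: ltW.
  move=> t pt tc tS; apply: dphi => //; first exact: lt_trans cq.
  by rewrite inE negb_or tS andbT lt_eqF.
apply: ih; first exact: ltW.
  apply: continuous_subspaceW cphi; apply: subset_itvr; rewrite bnd_simp; exact: ltW.
move=> t ct tq tS; apply: dphi => //; first exact: lt_trans ct.
by rewrite inE negb_or tS andbT gt_eqF.
Qed.

Lemma integrable_bounded_itv (a b M : R) (f : R -> R) :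
  measurable_fun setT (fun t => if (a < t) && (t < b) then f t else 0) ->
  (forall t, a < t -> t < b -> `|f t| <= M) ->
  mu.-integrable setT (EFin \o (fun t => if (a < t) && (t < b) then f t else 0)).
Proof.
move=> mf fM.
have iM : mu.-integrable setT (EFin \o (fun t : R => if (a < t) && (t < b) then `|M| else 0)).
  have iD : mu.-integrable `]a, b[ (EFin \o (fun _ : R => `|M|)).
    apply: measurable_bounded_integrable => //.
    - by rewrite /= lebesgue_measure_itv/=; case: ifP; rewrite ?ltry.
    - exact: bounded_cst.
  have mI : measurable (`]a, b[%classic : set (measurableTypeR R)) by [].
  have := (integrable_mkcond _ mI).1 iD.
  apply: eq_integrable => // t _ /=.
  by rewrite patchE mem_setE/= in_itv/=; case: ifP.
apply: le_integrable iM => //; first exact/measurable_EFinP.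
move=> t _ /=; case: ifPn => [/andP[h1 h2]|_]; last by rewrite normr0.
by rewrite lee_fin normr_id (le_trans (fM t h1 h2))// ler_norm.
Qed.

(** The difference of y and the integral of its derivative is continuous on [a, b] and has
    derivative 0 off S, hence is constant. *)
Lemma piecewise_FTC (a b M : R) (S : seq R) (y : R -> R) : a < b ->
  {within `[a, b], continuous y} ->
  (forall t, a < t -> t < b -> t \notin S -> derivable y t 1) ->
  continuous_off a b S (derive1 y) ->
  (forall t, a < t -> t < b -> `|derive1 y t| <= M) ->
  forall t, a <= t -> t <= b ->
  \int[mu]_s (if s < t then if (a < s) && (s < b) then derive1 y s else 0 else 0) = y t - y a.
Proof.
move=> ab cy dy cdy yM.
pose f s := if (a < s) && (s < b) then derive1 y s else 0.
have mf : measurable_fun setT f by exact: measurable_continuous_off cdy.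
have if_ : mu.-integrable setT (EFin \o f) by exact: integrable_bounded_itv mf yM.
have ifab : mu.-integrable `[a, b] (EFin \o f) by exact: integrableS if_.
pose Y t := \int[mu]_(s in `[a, t]) f s.
have YE t : a <= t -> \int[mu]_s (if s < t then f s else 0) = Y t.
  move=> at_; rewrite /Y [RHS]Rintegral_mkcond; apply: (@Rintegral_off_finite [:: t]).
    move=> s; rewrite inE => st; rewrite patchE mem_setE/= in_itv/=.
    rewrite [s <= t]le_eqVlt (negbTE st)/=; case: (s < t); rewrite ?andbF// andbT.
    by case: leP => // sa; rewrite /f ltNge (ltW sa).
  by apply/(measurable_restrictT _ _).1 => //; exact: measurable_funTS.
move=> t at_ tb; rewrite YE//.
have cY : {within `[a, b], continuous Y} := parameterized_integral_continuous (ltW ab) ifab.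
have : (fun u => y u - Y u) a = (fun u => y u - Y u) t.
  apply: (@derive0_off_constant S (fun u => y u - Y u) a t) => //.
    have sub : `[a, t]%classic `<=` `[a, b]%classic.
      by apply: subset_itvl; rewrite bnd_simp.
    move=> u; apply: (@cvgB _ _ (subspace `[a, t]%classic)).
      exact: (continuous_subspaceW sub cy).
    exact: (continuous_subspaceW sub cY).
  move=> u au ut uS; have ub : u < b by exact: lt_le_trans tb.
  have cf : {for u, continuous f}.
    have near_f : \forall s \near u, derive1 y s = f s.
      near=> s; rewrite /f ifT//; apply/andP; split; near: s.
        exact: lt_nbhsr.
      exact: lt_nbhsl.
    have cyu : derive1 y s @[s --> u] --> derive1 y u := cdy u au ub uS.
    have fu : derive1 y u = f u by rewrite /f au ub.
    by rewrite fu in cyu; apply: cvg_trans cyu; exact: near_eq_cvg.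
  have [dY eY] := continuous_FTC1_closed ub ifab au cf.
  have D1 : is_derive u 1 Y (f u) by split; [exact: dY|rewrite -derive1E; exact: eY].
  have D2 : is_derive u 1 y (f u).
    by split; [exact: dy|rewrite -derive1E /f au ub].
  by have := is_deriveB D2 D1; rewrite subrr.
rewrite /= /Y set_itv1 Rintegral_set1 subr0 => ->.
by rewrite opprB addrC subrK.
Unshelve. all: by end_near. Qed.

End PiecewiseContinuous.

(** * Inversion of the Caputo derivative *)

Section Volterra.
Set Implicit Arguments.
Unset Strict Implicit.
Variable R : realType.
Local Notation C := R[i].
Local Notation normc := (@Normc.normc R).

Lemma Cmeasurable_real (f : R -> R) : measurable_fun setT f ->
  Cmeasurable (fun t => (f t)%:C).
Proof. by move=> mf; split => //=; exact: measurable_cst. Qed.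

Lemma Cint0 (f : R -> C) : (forall t, f t = 0) -> Cint f = 0.
Proof.
move=> f0; rewrite (@eq_Cint _ f (fun=> 0 * 0)); last by move=> t; rewrite f0 mul0r.
by rewrite CintZl ?mul0r//; split; exact: integrable0.
Qed.

Lemma normcR (x : R) : normc x%:C = `|x|.
Proof. by rewrite /= expr0n addr0 sqrtr_sqr. Qed.

Lemma measurable_ind_itv (a b : R) :
  measurable_fun setT (fun s : R => if (a < s) && (s < b) then 1 else 0 : R).
Proof.
by apply: (@measurable_continuous_off _ a b [::] (fun=> 1)) => s _ _ _; exact: cvg_cst.
Qed.

Lemma measurable_pker_rev (q r : R) : measurable_fun setT (fun s : R => pker q (r - s)).
Proof.
have := measurableT_comp (@measurable_pker R q) (measurable_affine (-1) r).
by under eq_fun do rewrite mulN1r addrC.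
Qed.

Lemma integrable_pker_itv (a b q r : R) : 0 < q ->
  mu.-integrable setT (EFin \o (fun s => pker q (r - s) * (if (a < s) && (s < b) then 1 else 0))).
Proof.
move=> q0; pose D := expR (r - a).
have ig : mu.-integrable setT (EFin \o (fun s => D * gker q (r - s))).
  have := integrable_affine r (_ : (-1 : R) != 0) (integrable_gker q0).
  rewrite oppr_eq0 oner_eq0 => /(_ isT) /(integrableZl measurableT D).
  by apply: eq_integrable => // s _ /=; rewrite mulN1r [- s + r]addrC EFinM.
apply: le_integrable ig => //.
  apply/measurable_EFinP; apply: measurable_funM; last exact: measurable_ind_itv.
  exact: measurable_pker_rev.
move=> s _ /=; rewrite lee_fin !ger0_norm; last 2 first.
+ by rewrite mulr_ge0 ?gker_ge0// expR_ge0.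
+ by rewrite mulr_ge0 ?pker_ge0//; case: ifP.
case: ifPn => [/andP[as_ _]|_]; last by rewrite mulr0 mulr_ge0 ?gker_ge0// expR_ge0.
by rewrite mulr1 pker_le_gker// lerD2l lerN2 ltW.
Qed.

(** Dominates K(t - r) Kb(r - s) y'(s), with K and Kb the kernels of orders alpha and 1 - alpha and
    y' bounded on ]a, b[. As p + q = 1, the integral over r is a constant times the indicator of s <
    t, so it remains integrable over ]a, b[. *)
Lemma dominating_volterra (a b t p q c0 : R) : a < b -> 0 < p -> 0 < q -> p + q = 1 -> 0 <= c0 ->
  fubini_dominating (fun s r => c0 * (pker p (t - r) *
    (pker q (r - s) * (if (a < s) && (s < b) then 1 else 0)))).
Proof.
move=> ab p0 q0 pq c00.
have mind := measurable_ind_itv a b.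
have mpr := @measurable_pker R.
have i1 s : mu.-integrable setT (EFin \o (fun r => pker p (t - r) * pker q (r - s))).
  have := integrable_affine (- s) (oner_neq0 R) (integrable_pconv (t - s) p0 q0).
  apply: eq_integrable => // r _ /=; rewrite mul1r; congr (EFin (pker _ _ * _)).
  by rewrite opprD addrA opprK addrAC subrK.
have iE s : \int[mu]_r (pker p (t - r) * pker q (r - s)) = rbeta p q * pker 1 (t - s).
  rewrite -pq -Rintegral_pconv.
  have m := measurable_conv1 (t - s) (mpr p) (mpr q).
  have := Rintegral_affine (- s) (oner_neq0 R) m; rewrite normr1 invr1 mul1r => <-.
  apply: eq_Rintegral => r _; rewrite mul1r; congr (pker _ _ * _).
  by rewrite opprD addrA opprK addrAC subrK.
split.
- apply: measurable_funM => //; apply: measurable_funM.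
    apply: (measurableT_comp (mpr p)).
    by apply: measurable_funB => //; exact: measurable_snd.
  apply: measurable_funM.
    apply: (measurableT_comp (mpr q)).
    by apply: measurable_funB; [exact: measurable_snd|exact: measurable_fst].
  by apply: (measurableT_comp mind); exact: measurable_fst.
- move=> s.
  have := integrableZl measurableT (c0 * (if (a < s) && (s < b) then 1 else 0)) (i1 s).
  by apply: eq_integrable => // r _ /=; rewrite -EFinM; congr EFin; ring.
- move=> r.
  have := integrableZl measurableT (c0 * pker p (t - r)) (integrable_pker_itv a b r q0).
  by apply: eq_integrable => // s _ /=; rewrite -EFinM -mulrA.
- have im : mu.-integrable setT (EFin \o (fun s => if (a < s) && (s < b) then c0 * (rbeta p q * pker 1 (t - s)) else 0)).
    apply: (@integrable_bounded_itv _ a b (`|c0| * `|rbeta p q|)).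
      have -> : (fun s : R => if (a < s) && (s < b) then c0 * (rbeta p q * pker 1 (t - s)) else 0) =
         (fun s => (if (a < s) && (s < b) then 1 else 0) * (c0 * (rbeta p q * pker 1 (t - s)))).
        by apply/funext => s; case: ifP; rewrite ?mul1r ?mul0r.
      apply: measurable_funM => //; apply: measurable_funM => //; apply: measurable_funM => //.
      exact: measurable_pker_rev.
    move=> s _ _; rewrite !normrM mulrA ler_piMr ?mulr_ge0//.
    by rewrite ger0_norm ?pker_ge0// /pker subrr powRr0; case: ifP.
  apply: eq_integrable im => // s _ /=; congr EFin.
  rewrite RintegralZl//; last first.
    have := integrableZl measurableT (if (a < s) && (s < b) then 1 else 0) (i1 s).
    by apply: eq_integrable => // r _ /=; rewrite -EFinM mulrC -mulrA.
  have -> : (fun r => pker p (t - r) * (pker q (r - s) * (if (a < s) && (s < b) then 1 else 0))) =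
    (fun r => (if (a < s) && (s < b) then 1 else 0) * (pker p (t - r) * pker q (r - s))).
    by apply/funext => r; ring.
  rewrite RintegralZl// iE; case: ifP; rewrite ?mul1r ?mul0r ?mulr0//.
Qed.

Variables (a b alpha rho rhobar : R) (beta : C) (c cbar : nat -> C) (A Abar : C -> C).
Hypotheses (ab : a < b) (alpha0 : 0 < alpha) (alpha1 : alpha < 1)
  (beta0 : 0 <= complex.Re beta)
  (rho_gt : (b - a) `^ complex.Re beta < rho) (hA : analytic_on_disc rho c A)
  (rhobar_gt : (b - a) `^ complex.Re beta < rhobar)
  (hAbar : analytic_on_disc rhobar cbar Abar)
  (A_Abar : series_reciprocal (gamma_transform alpha beta c)
                              (gamma_transform (1 - alpha) beta cbar)).

Let T := b - a.
Let T0 : 0 < T. Proof. by rewrite subr_gt0. Qed.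
Let alpha1' : 0 < 1 - alpha. Proof. by rewrite subr_gt0. Qed.
Let K := fker T alpha beta A.
Let Kb := fker T (1 - alpha) beta Abar.

Let K_neg t : t <= 0 -> K t = 0.
Proof. by move=> t0; rewrite /K /fker ltNge t0. Qed.

Let Kb_neg t : t <= 0 -> Kb t = 0.
Proof. by move=> t0; rewrite /Kb /fker ltNge t0. Qed.

Let mK : Cmeasurable K. Proof. exact: Cmeasurable_fker hA. Qed.
Let mKb : Cmeasurable Kb. Proof. exact: Cmeasurable_fker hAbar. Qed.

(** The inversion is an identity between complex numbers with real data; its real part is the
    equation used from there on. *)
Definition volterra_kernel (t : R) : R := complex.Re (K t).

Section Inversion.
Variables (N : R) (S : seq R) (y g : R -> R).
Hypotheses (cy : {within `[a, b], continuous y})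
  (dy : forall t, a < t -> t < b -> t \notin S -> derivable y t 1)
  (cdy : continuous_off a b S (derive1 y))
  (yN : forall t, a < t -> t < b -> `|derive1 y t| <= N)
  (capy : forall t, t \in `[a, b] -> caputo Abar alpha beta a y t = (g t)%:C).

Let y0 s := if (a < s) && (s < b) then derive1 y s else 0.

Let my0 : measurable_fun setT y0. Proof. exact: measurable_continuous_off cdy. Qed.

Let caputoE r : a < r -> r <= b -> Cint (fun s => Kb (r - s) * (y0 s)%:C) = (g r)%:C.
Proof.
move=> ar rb; rewrite -capy ?in_itv/= ?(ltW ar)//.
have [m1 m2] := Cmeasurable_conv1 r mKb (Cmeasurable_real my0).
rewrite /caputo /frac_integral.
have H (h : C -> R) : h 0 = 0 -> measurable_fun setT (fun s : R => h (Kb (r - s) * (y0 s)%:C)) ->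
  \int[mu]_s h (Kb (r - s) * (y0 s)%:C) =
  \int[mu]_(s in `[a, r]) h (((r - s) `^ (1 - alpha - 1))%:C * Abar (cpowR (r - s) beta) * (derive1 y s)%:C).
  move=> h0 mh; rewrite [RHS]Rintegral_mkcond; apply/esym.
  (* The truncated and the original integrand can differ only at the endpoints a and r. *)
  apply: (@Rintegral_off_finite _ [:: a; r]) => // s.
  rewrite !inE negb_or => /andP[sa sr].
  rewrite patchE mem_setE/= in_itv/=.
  have [as_|sa'] := ltP a s; last first.
    have sa2 : s < a by rewrite lt_neqAle sa.
    rewrite leNgt sa2/= /y0 ltNge (ltW sa2)/= mulr0 h0//.
  rewrite (ltW as_)/= [s <= r]le_eqVlt (negbTE sr)/=.
  have [sr'|rs] := ltP s r; last by rewrite Kb_neg ?subr_le0// mul0r h0.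
  rewrite /y0 as_ (lt_le_trans sr' rb)/= /Kb /fker subr_gt0 sr'/=.
  have -> : r - s <= T by rewrite /T lerD// lerN2 ltW.
  by [].
by congr (_ +i* _); [exact: (H (@complex.Re R))|exact: (H (@complex.Im R))].
Qed.

(** Both sides are the double integral of K(t - r) Kb(r - s) y'(s). Over r first, K and Kb convolve
    to 1 and the integral of y' up to t is left; over s first, the inner integral is the Caputo
    derivative g(r). *)
Lemma volterra_inversion t : a <= t -> t <= b ->
  y t - y a = \int[mu]_s (volterra_kernel (t - s) * (if (a < s) && (s < b) then g s else 0)).
Proof.
move=> at_ tb.
have [M [M0 HM _]] := fker_bound alpha T0 beta0 rho_gt hA.
have [M' [M'0 HM' _]] := fker_bound (1 - alpha) T0 beta0 rhobar_gt hAbar.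
have [m1 m2] := mK; have [n1 n2] := mKb.
pose G s r := K (t - r) * (Kb (r - s) * (y0 s)%:C).
have dom := dominating_volterra t ab alpha0 alpha1' (subrKC alpha 1) (mulr_ge0 (mulr_ge0 M0 M'0) (normr_ge0 N)).
have m1' (f : R -> R) : measurable_fun setT f -> measurable_fun setT (fun z : R * R => f (t - z.2)).
  move=> mf; apply: (measurableT_comp mf).
  by apply: measurable_funB => //; exact: measurable_snd.
have m2' (f : R -> R) : measurable_fun setT f -> measurable_fun setT (fun z : R * R => f (z.2 - z.1)).
  move=> mf; apply: (measurableT_comp mf).
  by apply: measurable_funB; [exact: measurable_snd|exact: measurable_fst].
have m3' : measurable_fun setT (fun z : R * R => y0 z.1).
  by apply: (measurableT_comp my0); exact: measurable_fst.
have m4 (f1 f2 : R -> R) : measurable_fun setT f1 -> measurable_fun setT f2 ->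
    measurable_fun setT (fun z : R * R => f1 (t - z.2) * (f2 (z.2 - z.1) * y0 z.1)).
  move=> mf1 mf2; apply: measurable_funM; first exact: m1'.
  by apply: measurable_funM; first exact: m2'.
(* Shifting r by s gives the convolution of the two kernels at t - s, which is 1 for s < t and 0
   otherwise. *)
have ReCintG (s : R) : complex.Re (Cint (G s)) = if s < t then y0 s else 0.
  have -> : Cint (G s) = (y0 s)%:C * Cint (fun r => K (t - s - r) * Kb r).
    have iK : Cintegrable (fun r => K (t - s - r) * Kb r).
      apply: (@Cintegrable_le _ _ (fun r => M * M' * (pker alpha (t - s - r) * pker (1 - alpha) r))).
      - exact: Cmeasurable_conv1.
      - exact: (integrableZl measurableT (M * M') (integrable_pconv (t - s) alpha0 alpha1')).
      - move=> r; rewrite Normc.normcM mulrACA.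
        exact: ler_pM (normc_ge0 _) (normc_ge0 _) (HM _) (HM' _).
    rewrite -(CintZl (y0 s)%:C iK).
    have mm : Cmeasurable (fun r => (y0 s)%:C * (K (t - s - r) * Kb r)).
      by apply: CmeasurableM; [exact: Cmeasurable_cst|exact: Cmeasurable_conv1].
    have := Cint_affine (- s) (oner_neq0 R) mm; rewrite normr1 invr1 mul1r => <-.
    apply: eq_Cint => r; rewrite /G mul1r.
    have -> : t - s - (r - s) = t - r by ring.
    by ring.
  rewrite CReM/= mul0r subr0.
  have [as_|as_] := boolP ((a < s) && (s < b)); last first.
    by rewrite /y0 (negbTE as_) mul0r; case: ifP.
  case: ifPn => st.
    have ts : t - s <= T := lerB tb (ltW (andP as_).1).
    have ts0 : 0 < t - s by rewrite subr_gt0; exact: st.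
    have -> := fker_conv T0 alpha0 alpha1 beta0 rho_gt hA rhobar_gt hAbar A_Abar ts0 ts.
    by rewrite mulr1.
  have z0 r : K (t - s - r) * Kb r = 0.
    have [r0|r0] := leP r 0; first by rewrite (Kb_neg r0) mulr0.
    have tsr : t - s - r <= 0 by move: st; rewrite -leNgt => st; lra.
    by rewrite (K_neg tsr) mul0r.
  have -> : \int[mu]_r complex.Re (K (t - s - r) * Kb r) = 0.
    exact: (congr1 (@complex.Re R) (Cint0 z0)).
  by rewrite mulr0.
have CintGr (r : R) : Cint (G^~ r) = K (t - r) * (if (a < r) && (r < b) then g r else 0)%:C.
  have [tr|rt] := leP t r.
    have tr0 : t - r <= 0 by rewrite subr_le0; exact: tr.
    by rewrite (K_neg tr0) mul0r; apply: Cint0 => s; rewrite /G (K_neg tr0); exact: mul0r.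
  have rb : r < b by exact: lt_le_trans tb.
  rewrite rb andbT; case: ifPn => ar; last first.
    rewrite mulr0 Cint0// => s; rewrite /G /y0; case: ifPn => [/andP[as_ _]|_]; last by rewrite !mulr0.
    by rewrite Kb_neg ?mul0r ?mulr0//; move: ar; rewrite -leNgt; lra.
  have iKb : Cintegrable (fun s => Kb (r - s) * (y0 s)%:C).
    apply: (@Cintegrable_le _ _ (fun s => M' * `|N| * (pker (1 - alpha) (r - s) * (if (a < s) && (s < b) then 1 else 0)))).
    - by apply: Cmeasurable_conv1 => //; exact: Cmeasurable_real.
    - exact: (integrableZl measurableT (M' * `|N|) (integrable_pker_itv a b r alpha1')).
    - move=> s; rewrite Normc.normcM normcR mulrACA.
      apply: ler_pM => //; [exact: normc_ge0|].
      rewrite /y0; case: ifPn => [/andP[as_ sb]|_]; last by rewrite normr0 mulr0.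
      by rewrite mulr1 (le_trans (yN as_ sb))// ler_norm.
  by rewrite -(caputoE ar (ltW rb)) -(CintZl (K (t - r)) iKb).
have F : Cint (fun s => Cint (G s)) = Cint (fun r => Cint (G^~ r)).
  apply: (Cint_Fubini dom).
  - rewrite /G; under eq_fun do rewrite CReM CReM CImM/= !mulr0 subr0 add0r.
    by apply: measurable_funB; [exact: (m4 _ _ m1 n1)|exact: (m4 _ _ m2 n2)].
  - rewrite /G; under eq_fun do rewrite CImM CReM CImM/= !mulr0 subr0 add0r.
    by apply: measurable_funD; [exact: (m4 _ _ m1 n2)|exact: (m4 _ _ m2 n1)].
  - move=> s r; rewrite /G !Normc.normcM normcR.
    have h1 : normc (K (t - r)) <= _ := HM (t - r); have h2 : normc (Kb (r - s)) <= _ := HM' (r - s).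
    have h3 : `|y0 s| <= `|N| * (if (a < s) && (s < b) then 1 else 0).
      rewrite /y0; case: ifPn => [/andP[as_ sb]|_]; last by rewrite normr0 mulr0.
      by rewrite mulr1 (le_trans (yN as_ sb))// ler_norm.
    have := ler_pM (normc_ge0 _) (mulr_ge0 (normc_ge0 _) (normr_ge0 _)) h1 (ler_pM (normc_ge0 _) (normr_ge0 _) h2 h3).
    by rewrite [X in _ <= _ * X -> _]mulrACA [X in _ <= X -> _]mulrACA [X in _ <= X * _ -> _]mulrA.
have -> : y t - y a = complex.Re (Cint (fun s => Cint (G s))).
  rewrite ReCint -(piecewise_FTC ab cy dy cdy yN at_ tb).
  by apply: eq_Rintegral => s _; rewrite ReCintG.
rewrite F ReCint; apply: eq_Rintegral => r _.
by rewrite CintGr CReM/= mulr0 subr0.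
Qed.

End Inversion.
End Volterra.

(** * Weakly singular Gronwall inequality *)

Section Gronwall.
Set Implicit Arguments.
Unset Strict Implicit.
Variable R : realType.
Local Notation ind a b s x := (if (a < s) && (s < b) then x else 0).

(* The first term has small mass for large lam, the second one is bounded: this
   turns convergence in mean into uniform convergence of the convolution. *)
Lemma pker_split (p lam t : R) : p < 1 -> 0 < lam ->
  pker p t <= expR 1 * (pker p t * expR (- (lam * t))) + lam `^ (1 - p).
Proof.
move=> p1 lam0.
have [t0|t0] := leP t 0.
  by rewrite pker_neg// mul0r mulr0 add0r powR_ge0.
(* If lam t <= 1 the factor e exp(-lam t) is at least 1; otherwise 1/t < lam, so t^(p-1) <=
   lam^(1-p). *)
have [lt1|lt1] := leP (lam * t) 1.
  rewrite mulrCA -expRD ler_wpDr ?powR_ge0// ler_peMr ?pker_ge0//.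
  by rewrite -[leLHS]expR0 ler_expR subr_ge0.
rewrite ler_wpDl// ?mulr_ge0 ?expR_ge0 ?pker_ge0//.
rewrite /pker t0.
have -> : p - 1 = -1 * (1 - p) by ring.
rewrite powRrM (powR_inv1 (ltW t0)) ge0_ler_powR ?nnegrE ?invr_ge0 ?subr_ge0 ?(ltW t0) ?(ltW lam0) ?(ltW p1)//.
by apply: ltW; rewrite -div1r ltr_pdivrMr.
Qed.

(** The Laplace transform of t^(p-1), by scaling. Its decay lam^(-p) is what makes the singular
    kernel contractive in the weighted norm. *)
Lemma integral_eker (p lam t : R) : 0 < p -> 0 < lam ->
  mu.-integrable setT (EFin \o (fun s => pker p (t - s) * expR (- (lam * (t - s))))) /\
  \int[mu]_s (pker p (t - s) * expR (- (lam * (t - s)))) =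
    lam `^ (- p) * \int[mu]_s gker p s.
Proof.
move=> p0 lam0.
have ln0 : lam != 0 by rewrite gt_eqF.
have key (s : R) : lam `^ (1 - p) * gker p (- lam * s + lam * t) =
    pker p (t - s) * expR (- (lam * (t - s))).
  have -> : - lam * s + lam * t = lam * (t - s) by ring.
  rewrite /gker pkerM// !mulrA -powRD ?ln0 ?implybT//.
  have -> : 1 - p + (p - 1) = 0 by ring.
  by rewrite powRr0 mul1r.
have lamN0 : - lam != 0 by rewrite oppr_eq0.
have ig := integrable_affine (lam * t) lamN0 (integrable_gker p0).
have ig2 := integrableZl measurableT (lam `^ (1 - p)) ig.
split.
  by apply: eq_integrable ig2 => // s _ /=; rewrite -EFinM key.
under eq_Rintegral do rewrite -key.
rewrite RintegralZl// (Rintegral_affine _ lamN0); last exact: measurable_gker.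
rewrite normrN gtr0_norm// mulrA; congr (_ * _).
by rewrite -powR_inv1 ?ltW// -powRD ?ln0 ?implybT//; congr (_ `^ _); ring.
Qed.

Lemma integrable_kernel_bounded (a b p M N t : R) (K v : R -> R) :
  0 < p -> measurable_fun setT K -> (forall t, `|K t| <= M * pker p t) ->
  measurable_fun setT (fun s => ind a b s (v s)) ->
  (forall s, a < s -> s < b -> `|v s| <= N) ->
  mu.-integrable setT (EFin \o (fun s => K (t - s) * ind a b s (v s))).
Proof.
move=> p0 mK KM mv vN.
apply: le_integrable (integrableZl measurableT (M * N) (integrable_pker_itv a b t p0)) => //.
  apply/measurable_EFinP; apply: measurable_funM => //.
  by have := measurableT_comp mK (measurable_affine (-1) t); under eq_fun do rewrite mulN1r addrC.
move=> s _; rewrite lee_fin mulrACA 2!normrM; apply: ler_pM => //.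
  exact: le_trans (KM _) (ler_norm _).
case: ifPn => [/andP[as_ sb]|_]; last by rewrite normr0.
by rewrite mulr1; exact: le_trans (vN _ as_ sb) (ler_norm _).
Qed.

(** A bound uniform in t: a large lam makes the term with the supremum B small, and then a small
    mean of v controls the other one. *)
Lemma integral_pker_le (a b p t lam B : R) (v : R -> R) :
  0 < p -> p < 1 -> 0 < lam -> 0 <= B ->
  measurable_fun setT (fun s => ind a b s (v s)) ->
  (forall s, a < s -> s < b -> 0 <= v s <= B) ->
  \int[mu]_s (pker p (t - s) * ind a b s (v s)) <=
    expR 1 * B * (lam `^ (- p) * \int[mu]_s gker p s) +
    lam `^ (1 - p) * \int[mu]_s ind a b s (v s).
Proof.
move=> p0 p1 lam0 B0 mv vB.
have [ie iE] := integral_eker t p0 lam0.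
have vb (s : R) : 0 <= ind a b s (v s) <= B.
  by case: ifPn => [/andP[as_ sb]|_]; [exact: vB|rewrite lexx].
have iv : mu.-integrable setT (EFin \o (fun s => ind a b s (v s))).
  apply: (integrable_bounded_itv mv (M := B)) => s as_ sb.
  by have /andP[v0 ?] := vB s as_ sb; rewrite ger0_norm.
have i1 := integrableZl measurableT (expR 1 * B) ie.
have i2 := integrableZl measurableT (lam `^ (1 - p)) iv.
rewrite -iE -RintegralZl// -RintegralZl// -RintegralD//.
have key (s : R) : pker p (t - s) * ind a b s (v s) <=
   expR 1 * B * (pker p (t - s) * expR (- (lam * (t - s)))) + lam `^ (1 - p) * ind a b s (v s).
  have /andP[v0 vB'] := vb s.
  apply: le_trans (ler_wpM2r v0 (pker_split (t - s) p1 lam0)) _.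
  rewrite mulrDl lerD2r mulrAC ler_wpM2r// ?mulr_ge0 ?pker_ge0 ?expR_ge0//.
  by rewrite ler_wpM2l ?expR_ge0.
have i3 := integrableD measurableT i1 i2.
apply: le_Rintegral => //.
apply: (@integrable_kernel_bounded _ _ p 1 B _ (pker p)) => //.
- exact: measurable_pker.
- by move=> r; rewrite mul1r ger0_norm ?pker_ge0.
- by move=> s as_ sb; have /andP[v0 ?] := vB s as_ sb; rewrite ger0_norm.
Qed.

(** Applied to the supremum Y of w(s) exp(-lam (s - a)), the hypothesis gives Y <= Y/2 + E. The a
    priori bound B makes Y finite, so that Y/2 can be absorbed. *)
Lemma sup_halving (a b lam E : R) (w : R -> R) (B : R) :
  0 <= E -> 0 <= lam ->
  (forall t, a <= t -> t <= b -> 0 <= w t <= B) ->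
  (forall Y, 0 <= Y -> (forall s, a <= s -> s <= b -> w s <= Y * expR (lam * (s - a))) ->
    forall t, a <= t -> t <= b -> w t <= Y / 2 * expR (lam * (t - a)) + E) ->
  forall t, a <= t -> t <= b -> w t <= 2 * E * expR (lam * (t - a)).
Proof.
move=> E0 lam0 wB H t at_ tb.
pose Q := [set w s * expR (- (lam * (s - a))) | s in `[a, b]].
have e1 s : a <= s -> expR (- (lam * (s - a))) <= 1.
  by move=> as_; rewrite -expR0 ler_expR oppr_le0 mulr_ge0 ?subr_ge0.
have ubQ : ubound Q B.
  move=> x0 [s /=]; rewrite in_itv/= => /andP[as_ sb] <-.
  have /andP[w0 wB'] := wB s as_ sb.
  by rewrite (le_trans _ wB')// ler_piMr// e1.
have Q0 : Q !=set0.
  by exists (w t * expR (- (lam * (t - a)))), t => //=; rewrite in_itv/= at_.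
have wE s x : a <= s -> s <= b -> (w s * expR (- (lam * (s - a))) <= x) = (w s <= x * expR (lam * (s - a))).
  by move=> _ _; rewrite expRN ler_pdivrMr ?expR_gt0.
have supP s : a <= s -> s <= b -> w s <= sup Q * expR (lam * (s - a)).
  move=> as_ sb; rewrite -wE//; apply: sup_upper_bound.
    by split => //; exists B.
  by exists s => //=; rewrite in_itv/= as_.
have sup0 : 0 <= sup Q.
  have := supP t at_ tb; have /andP[w0 _] := wB t at_ tb => /(le_trans w0).
  by rewrite pmulr_lge0 ?expR_gt0.
have : sup Q <= sup Q / 2 + E.
  apply: ge_sup => // x0 [s /=]; rewrite in_itv/= => /andP[as_ sb] <-.
  rewrite wE// mulrDl (le_trans (H _ sup0 supP s as_ sb))// lerD2l ler_peMr//.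
  by rewrite -expR0 ler_expR mulr_ge0 ?subr_ge0.
move=> h; rewrite (le_trans (supP t at_ tb))// ler_wpM2r ?expR_ge0//; lra.
Qed.

Lemma row_norm_le (n : nat) (x : 'rV[R]_n) (c : R) :
  0 <= c -> (forall i, `|x ord0 i| <= c) -> `|x| <= c.
Proof.
move=> c0 xc; rewrite [`|x|]mx_normrE; apply: bigmax_le => //= -[i j] _ /=.
by rewrite ord1.
Qed.

Lemma coord_norm_le (n : nat) (x : 'rV[R]_n) i : `|x ord0 i| <= `|x|.
Proof. by rewrite [`|x|]mx_normrE (le_bigmax _ (fun ij => `|x ij.1 ij.2|) (ord0, i)). Qed.

(** C is quantified before W, q and v, so it is uniform in the parameter eps. The inhomogeneity v
    enters the conclusion only through E, a bound on its singular convolution; B merely guarantees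
    finiteness and does not affect the estimate. *)
Lemma volterra_gronwall (a b p M L : R) (K : R -> R) :
  a < b -> 0 < p -> p < 1 -> 0 <= M -> 0 <= L ->
  measurable_fun setT K -> (forall t, `|K t| <= M * pker p t) ->
  exists2 C, 0 <= C & forall (n : nat) (W q : R -> 'rV[R]_n) (v : R -> R) (B E : R),
    (forall i, measurable_fun setT (fun s => ind a b s (q s ord0 i))) ->
    measurable_fun setT (fun s => ind a b s (v s)) ->
    (forall s, a < s -> s < b -> 0 <= v s <= B) ->
    (forall t, a <= t -> t <= b -> `|W t| <= B) ->
    (forall s, a < s -> s < b -> `|q s| <= L * `|W s| + v s) ->
    (forall t i, a <= t -> t <= b ->
       W t ord0 i = \int[mu]_s (K (t - s) * ind a b s (q s ord0 i))) ->
    (forall t, a <= t -> t <= b ->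
       \int[mu]_s (pker p (t - s) * ind a b s (v s)) <= E) ->
    forall t, a <= t -> t <= b -> `|W t| <= C * E.
Proof.
move=> ab p0 p1 M0 L0 mK KM.
pose G := \int[mu]_s gker p s.
have G0 : 0 <= G by apply: Rintegral_ge0 => s _; exact: gker_ge0.
(* lam is chosen with lam^p = X, so that M L G lam^(-p) <= 1/2; the 1 keeps X positive. *)
pose X := 2 * (M * L * G) + 1.
have X0 : 0 < X by rewrite ltr_wpDl ?mulr_ge0.
pose lam := X `^ p^-1.
have lam0 : 0 < lam by rewrite powR_gt0.
have lamE : lam `^ (- p) = X^-1.
  by rewrite powRN -powRrM mulVf ?gt_eqF// powRr1// ltW.
have half : M * L * (lam `^ (- p) * G) <= 2^-1.
  rewrite lamE mulrCA mulrC ler_pdivrMr// /X; lra.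
exists (2 * M * expR (lam * (b - a))); first by rewrite !mulr_ge0 ?expR_ge0.
move=> n W q v B E mq mv vB WB qL WE vE t at_ tb.
have B0 : 0 <= B by exact: le_trans (normr_ge0 _) (WB t at_ tb).
have v0 (s : R) : 0 <= ind a b s (v s).
  by case: ifPn => // /andP[as_ sb]; have /andP[] := vB s as_ sb.
have E0 : 0 <= E.
  by apply: le_trans (vE t at_ tb); apply: Rintegral_ge0 => s _; rewrite mulr_ge0 ?pker_ge0.
have main Y : 0 <= Y ->
    (forall s, a <= s -> s <= b -> `|W s| <= Y * expR (lam * (s - a))) ->
    forall t, a <= t -> t <= b -> `|W t| <= Y / 2 * expR (lam * (t - a)) + M * E.
  move=> Y0 WY r ar rb.
  apply: row_norm_le => [|i]; first by rewrite addr_ge0 ?mulr_ge0 ?expR_ge0.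
  rewrite WE//.
  have [ie iE] := integral_eker r p0 lam0.
  have ipv : mu.-integrable setT (EFin \o (fun s => pker p (r - s) * ind a b s (v s))).
    apply: (@integrable_kernel_bounded _ _ p 1 B _ (pker p)) => //.
    - exact: measurable_pker.
    - by move=> s; rewrite mul1r ger0_norm ?pker_ge0.
    - by move=> s as_ sb; have /andP[v0' ?] := vB s as_ sb; rewrite ger0_norm.
  have iKq : mu.-integrable setT (EFin \o (fun s => K (r - s) * ind a b s (q s ord0 i))).
    apply: (@integrable_kernel_bounded _ _ p M (L * B + B)) => // s as_ sb.
    rewrite (le_trans (coord_norm_le _ _))// (le_trans (qL s as_ sb))//.
    have /andP[_ ?] := vB s as_ sb.
    by rewrite lerD// ler_wpM2l// WB// ltW.
  pose c1 := M * L * Y * expR (lam * (r - a)).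
  have c10 : 0 <= c1 by rewrite !mulr_ge0 ?expR_ge0.
  have j1 := integrableZl measurableT c1 ie.
  have j2 := integrableZl measurableT M ipv.
  have key (s : R) : `|K (r - s) * ind a b s (q s ord0 i)| <=
      c1 * (pker p (r - s) * expR (- (lam * (r - s)))) + M * (pker p (r - s) * ind a b s (v s)).
    rewrite normrM; case: ifPn => [/andP[as_ sb]|_]; last first.
      by rewrite normr0 !mulr0 addr0 !mulr_ge0 ?pker_ge0 ?expR_ge0.
    apply: (@le_trans _ _ (M * pker p (r - s) * (L * (Y * expR (lam * (s - a))) + v s))).
      apply: ler_pM => //; apply: le_trans (coord_norm_le _ _) _.
      by rewrite (le_trans (qL s as_ sb))// lerD2r ler_wpM2l// WY// ltW.
    (* Rewriting the weight at s as the weight at r times exp(-lam (r - s)) moves the decay into the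
       kernel, where [integral_eker] evaluates it. *)
    have -> : lam * (s - a) = lam * (r - a) + - (lam * (r - s)) by ring.
    rewrite expRD /c1 mulrDr !mulrA lerD2r.
    by rewrite le_eqVlt; apply/orP; left; apply/eqP; ring.
  have H1 : `|\int[mu]_s (K (r - s) * ind a b s (q s ord0 i))| <=
      c1 * \int[mu]_s (pker p (r - s) * expR (- (lam * (r - s)))) +
      M * \int[mu]_s (pker p (r - s) * ind a b s (v s)).
    have j3 := integrableD measurableT j1 j2.
    rewrite -RintegralZl// -RintegralZl// -RintegralD//.
    apply: le_trans (le_normr_Rintegral measurableT iKq) _.
    apply: le_Rintegral => //; exact: integrable_norm iKq.
  apply: le_trans H1 _; rewrite iE; apply: lerD; last by rewrite ler_wpM2l// vE.
  rewrite /c1 -mulrA [X in _ * X]mulrC mulrA ler_wpM2r ?expR_ge0//.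
  have := ler_wpM2l Y0 half; rewrite mulrCA !mulrA; lra.
have W0 s : a <= s -> s <= b -> 0 <= `|W s| <= B by move=> *; rewrite normr_ge0 WB.
have ME0 : 0 <= M * E by rewrite mulr_ge0.
apply: le_trans (sup_halving ME0 (ltW lam0) W0 main at_ tb) _.
have -> : 2 * M * expR (lam * (b - a)) * E = 2 * (M * E) * expR (lam * (b - a)) by ring.
by rewrite ler_wpM2l ?mulr_ge0// ler_expR ler_wpM2l ?(ltW lam0)// lerB.
Qed.

End Gronwall.

(** * Trajectories and their sensitivity *)

Section C1.
Set Implicit Arguments.
Unset Strict Implicit.
Variable R : realType.

Lemma C1_on_expansion (V W : normedModType R) (D : set V) (g : V -> W) : C1_on D g ->
  exists dg : V -> {linear V -> W}, forall p e, D p -> 0 < e ->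
    exists2 d, 0 < d & forall q, D q -> `|q - p| < d ->
      `|g q - g p - dg p (q - p)| <= e * `|q - p|.
Proof.
move=> [dg [dgo _]]; exists dg => p e Dp e0.
have /eqoP/(_ _ e0) := dgo p Dp.
rewrite near_withinE => /nbhs_normP[d /= d0 H].
exists d => // q Dq qp; apply: H => //=.
by rewrite distrC.
Qed.

Section Along.
Variables (n m : nat) (a b L : R) (f : R -> 'rV[R]_n -> 'rV[R]_m -> 'rV[R]_n).
Hypotheses (L0 : 0 <= L)
  (f_C1 : C1_on (`[a, b] `*` setT `*` setT)
    (fun p : R * 'rV[R]_n * 'rV[R]_m => f p.1.1 p.1.2 p.2))
  (lipx : forall t x y u, a <= t -> t <= b -> `|f t x u - f t y u| <= L * `|x - y|)
  (lipu : forall t x u v, a <= t -> t <= b -> `|f t x u - f t x v| <= L * `|u - v|).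

Lemma lipschitz_xu t x y u v : a <= t -> t <= b ->
  `|f t x u - f t y v| <= L * (`|x - y| + `|u - v|).
Proof.
move=> at_ tb; rewrite -(subrKA (f t y u)) mulrDr (le_trans (ler_normD _ _))// lerD ?lipx ?lipu//.
Qed.

Lemma C1_time_continuous s x u e : a <= s -> s <= b -> 0 < e ->
  exists2 d, 0 < d & forall r, a <= r -> r <= b -> `|r - s| < d ->
    `|f r x u - f s x u| < e.
Proof.
move=> as_ sb e0; have [dg H] := C1_on_expansion f_C1.
have [] := H (s, x, u) 1 _ ltr01.
  by split => //; split => //=; rewrite in_itv/= as_.
move=> d d0 Hd.
(* The expansion with error constant 1 bounds the slope of f in time by the norm of its time
   derivative plus 1; c leaves room to spare. *)
pose c := `|dg (s, x, u) (1, 0, 0)| + 1 + 1.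
have c0 : 0 < c by rewrite ltr_wpDl// addr_ge0.
exists (Num.min d (e / c)); first by rewrite lt_min d0 divr_gt0.
move=> r ar rb; rewrite lt_min => /andP[rd re].
have E : (r, x, u) - (s, x, u) = (r - s) *: (1, 0, 0) :> R * 'rV[R]_n * 'rV[R]_m.
  by congr (_, _, _) => /=; rewrite ?subrr ?scaler0// [RHS]mulr1.
have nE : `|(r, x, u) - (s, x, u) : R * 'rV[R]_n * 'rV[R]_m| = `|r - s|.
  rewrite !prod_normE/= !subrr !normr0.
  by rewrite (max_idPl _) ?(max_idPl _)// max_l.
have := Hd (r, x, u); rewrite nE E linearZ/= => /(_ _ rd) H1.
have {H1}H1 : `|f r x u - f s x u - (r - s) *: dg (s, x, u) (1, 0, 0)| <= 1 * `|r - s|.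
  by apply: H1; split => //; split => //=; rewrite in_itv/= ar.
have := le_lt_trans (ler_normD (f r x u - f s x u - (r - s) *: dg (s, x, u) (1, 0, 0)) ((r - s) *: dg (s, x, u) (1, 0, 0))).
rewrite subrK; apply; rewrite normrZ.
apply: (@le_lt_trans _ _ (`|r - s| * (`|dg (s, x, u) (1, 0, 0)| + 1))).
  by rewrite mulrDr mulr1 addrC lerD2l -[leRHS]mul1r.
apply: (@le_lt_trans _ _ (`|r - s| * c)); first by rewrite ler_wpM2l// /c lerDl.
by rewrite -ltr_pdivlMr.
Qed.

Lemma continuous_off_along S (x : R -> 'rV[R]_n) (u : R -> 'rV[R]_m) :
  continuous_off a b S x -> continuous_off a b S u ->
  continuous_off a b S (fun s => f s (x s) (u s)).
Proof.
move=> cx cu s as_ sb sS; apply/cvgrPdist_lt => e e0.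
(* The two Lipschitz increments together get e/2; L + 1 replaces L, which may be 0. *)
have c0 : 0 < e / 2 / (2 * (L + 1)) by rewrite !divr_gt0// mulr_gt0// ltr_wpDl.
have [d d0 Hd] := C1_time_continuous (x s) (u s) (ltW as_) (ltW sb) (divr_gt0 e0 (ltr0n R 2)).
near=> r.
have ar : a < r by near: r; exact: lt_nbhsr.
have rb : r < b by near: r; exact: lt_nbhsl.
have rd : `|r - s| < d.
  by near: r; apply/nbhs_normP; exists d => //= r; rewrite /ball_/= distrC.
have h1 := Hd r (ltW ar) (ltW rb) rd.
have h2 := lipschitz_xu (x s) (x r) (u s) (u r) (ltW ar) (ltW rb).
have xr : `|x s - x r| < e / 2 / (2 * (L + 1)).
  by near: r; move/cvgrPdist_lt : (cx s as_ sb sS); exact.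
have ur : `|u s - u r| < e / 2 / (2 * (L + 1)).
  by near: r; move/cvgrPdist_lt : (cu s as_ sb sS); exact.
rewrite -(subrKA (f r (x s) (u s))).
apply: le_lt_trans (ler_normD _ _) _.
rewrite [ltRHS](splitr e); apply: ltr_leD; first by rewrite distrC.
apply: le_trans h2 _.
apply: (@le_trans _ _ (L * (e / 2 / (2 * (L + 1)) + e / 2 / (2 * (L + 1))))).
  by rewrite ler_wpM2l// lerD// ltW.
have -> : e / 2 / (2 * (L + 1)) + e / 2 / (2 * (L + 1)) = e / 2 / (L + 1).
  by field; rewrite gt_eqF// ltr_wpDl.
by rewrite mulrA ler_pdivrMr ?ltr_wpDl// mulrC ler_wpM2l ?divr_ge0 ?(ltW e0)// lerDl.
Unshelve. all: end_near. Qed.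

(** |f s 0 0| is continuous in s, hence bounded on [a, b], and the Lipschitz conditions control the
    distance from f s x u to f s 0 0. *)
Lemma bounded_along (X U : R) : a <= b -> exists M, forall s x u, a <= s -> s <= b ->
  `|x| <= X -> `|u| <= U -> `|f s x u| <= M.
Proof.
move=> ab.
have cf : {within `[a, b], continuous (fun s => `|f s 0 0|)}.
  apply/subspace_continuousP => s; rewrite /= in_itv/= => /andP[as_ sb].
  apply: cvg_norm; apply/cvgrPdist_lt => e e0.
  have [d d0 Hd] := C1_time_continuous 0 0 as_ sb e0.
  near=> r.
  have : `[a, b]%classic r by near: r; exact: withinT.
  rewrite /= in_itv/= => /andP[ar rb].
  rewrite distrC; apply: Hd => //; rewrite distrC.
  by near: r; apply: cvg_within; exact: nbhs_ball_norm (PosNum d0).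
have [c _ Hc] := EVT_max ab cf.
exists (`|f c 0 0| + L * (X + U)) => s x u as_ sb xX uU.
rewrite -[f s x u](subrK (f s 0 0)) addrC.
apply: le_trans (ler_normD _ _) _; apply: lerD.
  by apply: Hc; rewrite in_itv/= as_.
rewrite (le_trans (lipschitz_xu _ _ _ _ as_ sb))// !subr0.
by rewrite ler_wpM2l// lerD.
Unshelve. all: end_near. Qed.

End Along.
End C1.

(** * Trajectories solve the Volterra equation *)

Section Trajectory.
Set Implicit Arguments.
Unset Strict Implicit.
Variable R : realType.
Local Notation C := R[i].
Local Notation ind a b s x := (if (a < s) && (s < b) then x else 0).

(* At the endpoints Gamma 0 occurs, and its junk value 0 contradicts
   c_0 Gamma(alpha) * cbar_0 Gamma(1 - alpha) = 1. *)
Lemma series_reciprocal_order (alpha : R) (beta : C) (c cbar : nat -> C) :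
  alpha \in `[0, 1] ->
  series_reciprocal (gamma_transform alpha beta c) (gamma_transform (1 - alpha) beta cbar) ->
  0 < alpha < 1.
Proof.
have Gamma0 : Gamma (0 : C) = 0 by rewrite /Gamma /= ltxx invr0 mulr0.
rewrite in_itv/= => /andP[a0 a1] /(_ 0%N).
rewrite big_ord1 /gamma_transform !mulr0n !add0r => h.
rewrite !lt_neqAle a0 a1 !andbT; apply/andP; split; apply/eqP => E; move: h.
  by rewrite -E Gamma0 mulr0 mul0r => /esym/eqP; rewrite oner_eq0.
by rewrite E subrr Gamma0 !mulr0 => /esym/eqP; rewrite oner_eq0.
Qed.

Variables (n m : nat) (a b alpha rho rhobar : R) (beta : C) (c cbar : nat -> C) (A Abar : C -> C).
Hypotheses (ab : a < b) (alpha0 : 0 < alpha) (alpha1 : alpha < 1)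
  (beta0 : 0 <= complex.Re beta)
  (rho_gt : (b - a) `^ complex.Re beta < rho) (hA : analytic_on_disc rho c A)
  (rhobar_gt : (b - a) `^ complex.Re beta < rhobar)
  (hAbar : analytic_on_disc rhobar cbar Abar)
  (A_Abar : series_reciprocal (gamma_transform alpha beta c)
                              (gamma_transform (1 - alpha) beta cbar)).
Variables (f : R -> 'rV[R]_n -> 'rV[R]_m -> 'rV[R]_n) (xa : 'rV[R]_n).
Let K := volterra_kernel a b alpha beta A.

Lemma derive1_coord (x : R -> 'rV[R]_n) t i : derivable x t 1 ->
  derive1 (fun s => x s ord0 i) t = derive1 x t ord0 i.
Proof. by move=> dx; rewrite !derive1E derive_mx// mxE. Qed.

Lemma cvg_coord (T : Type) (F : set_system T) (x : T -> 'rV[R]_n) (l : 'rV[R]_n) i : Filter F ->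
  x @ F --> l -> (fun s => x s ord0 i) @ F --> l ord0 i.
Proof.
move=> FF xl.
exact: (@cvg_comp _ _ _ x (fun M : 'rV[R]_n => M ord0 i) F (nbhs l) _ xl (@coord_continuous R 1 n ord0 i l)).
Qed.

Lemma trajectory_volterra (u : R -> 'rV[R]_m) (x : R -> 'rV[R]_n) :
  state_trajectory Abar alpha beta a b f xa u x ->
  [/\ continuous_off a b [::] x,
      exists M, forall t, a <= t -> t <= b -> `|x t| <= M &
      forall t i, a <= t -> t <= b -> x t ord0 i - xa ord0 i =
        \int[mu]_s (K (t - s) * ind a b s (f s (x s) (u s) ord0 i))].
Proof.
move=> [[cx [S [abS dx cdx]]] capx xaE]; split.
- by move=> t at_ tb _; apply: (within_continuous_continuous ab cx); rewrite in_itv/= at_.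
- have [|r _ Hr] := EVT_max (ltW ab) (f := fun s => `|x s|).
    by move=> s; apply: cvg_norm; exact: cx.
  by exists `|x r| => t at_ tb; apply: Hr; rewrite in_itv/= at_.
move=> t i at_ tb; rewrite -xaE.
have derx r : a < r -> r < b -> r \notin S -> derivable x r 1.
  move=> ar rb rS; have [j [jS h1 h2]] := itv_partition_piece abS ar rb rS.
  by apply: (dx j jS); rewrite in_itv/= h1.
have [cdx' [M HM]] := continuous_pieces_off abS cdx.
pose y s := x s ord0 i.
(* At a breakpoint [derive1] of a coordinate need not be the coordinate of [derive1 x], so its
   values there are added to the bound N separately. *)
apply: (volterra_inversion ab alpha0 alpha1 beta0 rho_gt hA rhobar_gt hAbar A_Abar
  (N := M + \sum_(p <- S) `|derive1 y p|) (S := S) (y := y) (g := fun s => f s (x s) (u s) ord0 i)) => //.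
- apply: (@within_continuous_comp _ _ _ _ x (fun M : 'rV[R]_n => M ord0 i)) => //.
  by move=> M' _; exact: coord_continuous.
- by move=> r ar rb rS; have /derivable_mxP := derx r ar rb rS; exact.
- move=> r ar rb rS; rewrite /prop_for /continuous_at derive1_coord; last exact: derx.
  have H : (fun s => derive1 x s ord0 i) @ r --> derive1 x r ord0 i.
    by apply: cvg_coord; exact: cdx'.
  apply: (cvg_trans _ H).
  have nS : \forall z \near r, (~` [set` S]) z.
    by apply: open_nbhs_nbhs; split; [exact: open_setC_seq|exact/negP].
  apply: near_eq_cvg; near=> q; apply/esym/derive1_coord/derx.
  + by near: q; exact: lt_nbhsr.
  + by near: q; exact: lt_nbhsl.
  + by apply/negP; near: q; exact: nS.
- have s0 : 0 <= \sum_(p <- S) `|derive1 y p| by exact: sumr_ge0.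
  move=> r ar rb; have [rS|rS] := boolP (r \in S).
    rewrite (big_rem _ rS)/= addrCA lerDl addr_ge0//; last exact: sumr_ge0.
    by apply: le_trans (HM r (ltW ar) (ltW rb)).
  rewrite /y derive1_coord; last exact: derx.
  rewrite ler_wpDr// (le_trans (coord_norm_le _ _))//.
  by apply: HM; exact: ltW.
- by move=> r rab; exact: capx.
Unshelve. all: end_near. Qed.

End Trajectory.

(** * Convergence of the difference quotients *)

Section Sensitivity.
Set Implicit Arguments.
Unset Strict Implicit.
Variable R : realType.
Local Notation ind a b s x := (if (a < s) && (s < b) then x else 0).

Lemma bounded_convergence_itv (a b B : R) (v : nat -> R -> R) :
  (forall j, measurable_fun setT (fun s => ind a b s (v j s))) ->
  (forall j s, a < s -> s < b -> `|v j s| <= B) ->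
  (forall s, a < s -> s < b -> v j s @[j --> \oo] --> (0 : R)) ->
  \int[mu]_s ind a b s (v j s) @[j --> \oo] --> (0 : R).
Proof.
move=> mv vB v0.
have iB : mu.-integrable setT (EFin \o (fun s => ind a b s `|B|)).
  apply: (@integrable_bounded_itv _ a b `|B| (fun=> `|B|)) => [|s _ _]; last by rewrite normr_id.
  by apply: (@measurable_continuous_off _ a b [::] (fun=> `|B|)) => s _ _ _; exact: cvg_cst.
have bnd j s : `|ind a b s (v j s)| <= ind a b s `|B|.
  case: ifPn => [/andP[as_ sb]|_]; last by rewrite normr0.
  exact: le_trans (vB j s as_ sb) (ler_norm _).
have mvj j : measurable_fun setT (EFin \o (fun s => ind a b s (v j s))) by apply/measurable_EFinP.
have m0 : measurable_fun setT (EFin \o (fun _ : R => 0 : R)) by apply/measurable_EFinP.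
have [] := @dominated_convergence _ _ _ mu setT measurableT
  (fun j => EFin \o (fun s => ind a b s (v j s))) (EFin \o (fun=> 0)) (EFin \o (fun s => ind a b s `|B|)) mvj m0 _ iB _.
- apply: aeW => s _; apply/cvg_EFin; first exact: nearW.
  rewrite /comp/=; case: (boolP ((a < s) && (s < b))) => [/andP[as_ sb]|_]; first exact: v0.
  exact: cvg_cst.
- by apply: aeW => s j _; rewrite /= lee_fin.
move=> _ _; rewrite [X in _ --> X]integral0_eq// => cv.
have ivj j : mu.-integrable setT (EFin \o (fun s => ind a b s (v j s))).
  by apply: integrable_bounded_itv => // s as_ sb; exact: vB.
have E : (fun j => (\int[mu]_x (EFin \o (fun s => ind a b s (v j s))) x)%E) =
    (fun j => (\int[mu]_x ind a b x (v j x))%:E).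
  by apply/funext => j; rewrite /Rintegral fineK//; apply: integrable_fin_num => //; exact: ivj.
by move: cv; rewrite [X in X @ _ --> _]E => /fine_cvgP[].
Qed.

Variables (n m : nat) (a b p M L H : R) (K : R -> R) (S : seq R).
Variables (f : R -> 'rV[R]_n -> 'rV[R]_m -> 'rV[R]_n) (us h : R -> 'rV[R]_m).
Variables (xa : 'rV[R]_n) (xs : R -> 'rV[R]_n) (X : R -> R -> 'rV[R]_n).
Hypotheses (ab : a < b) (p0 : 0 < p) (p1 : p < 1) (M0 : 0 <= M)
  (mK : measurable_fun setT K) (KM : forall t, `|K t| <= M * pker p t).
Hypotheses (L0 : 0 <= L)
  (f_C1 : C1_on (`[a, b] `*` setT `*` setT)
    (fun q : R * 'rV[R]_n * 'rV[R]_m => f q.1.1 q.1.2 q.2))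
  (lipx : forall t x y u, a <= t -> t <= b -> `|f t x u - f t y u| <= L * `|x - y|)
  (lipu : forall t x u v, a <= t -> t <= b -> `|f t x u - f t x v| <= L * `|u - v|).
Hypotheses (cus : continuous_off a b S us) (ch : continuous_off a b S h)
  (bus : exists U, forall t, a <= t -> t <= b -> `|us t| <= U)
  (hH : forall t, a <= t -> t <= b -> `|h t| <= H).
(** From here on the fractional derivative is gone: a trajectory is a bounded solution of the
    Volterra equation, continuous inside the interval. *)
Let volterra_sol (u : R -> 'rV[R]_m) (x : R -> 'rV[R]_n) :=
  [/\ continuous_off a b [::] x,
      exists B, forall t, a <= t -> t <= b -> `|x t| <= B &
      forall t i, a <= t -> t <= b -> x t ord0 i - xa ord0 i =
        \int[mu]_s (K (t - s) * ind a b s (f s (x s) (u s) ord0 i))].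
Hypotheses (xs_sol : volterra_sol us xs)
  (X_sol : forall eps, volterra_sol (fun t => us t + eps *: h t) (X eps)).

Let F eps s := f s (X eps s) (us s + eps *: h s).
Let Fs s := f s (xs s) (us s).

Let H0 : 0 <= H. Proof. by apply: le_trans (normr_ge0 (h a)) (hH _ _) => //; exact: ltW. Qed.

Let c_sol u x : volterra_sol u x -> continuous_off a b S x.
Proof. by move=> [c _ _] t at_ tb _; exact: c. Qed.

Let cu eps : continuous_off a b S (fun t => us t + eps *: h t).
Proof.
by move=> t at_ tb tS; apply: cvgD; [exact: cus|apply: cvgZr; exact: ch].
Qed.

Let cF eps : continuous_off a b S (F eps).
Proof. by apply: continuous_off_along f_C1 lipx lipu _ _ _ _ _ => //; exact: c_sol (X_sol _). Qed.

Let cFs : continuous_off a b S Fs.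
Proof. by apply: continuous_off_along f_C1 lipx lipu _ _ _ _ _ => //; exact: c_sol xs_sol. Qed.

Let measurable_coord (g : R -> 'rV[R]_n) i : continuous_off a b S g ->
  measurable_fun setT (fun s => ind a b s (g s ord0 i)).
Proof.
move=> cg; apply: (@measurable_continuous_off _ a b S) => t at_ tb tS.
by apply: cvg_coord; exact: cg.
Qed.

Let bFs : exists B, forall s, a <= s -> s <= b -> `|Fs s| <= B.
Proof.
have [_ [Bx hx] _] := xs_sol; have [U hU] := bus.
have [B HB] := bounded_along L0 f_C1 lipx lipu Bx U (ltW ab).
by exists B => s as_ sb; apply: HB => //; [exact: hx|exact: hU].
Qed.

Let bF eps : exists B, forall s, a <= s -> s <= b -> `|F eps s| <= B.
Proof.
have [_ [Bx hx] _] := X_sol eps; have [U hU] := bus.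
have [B HB] := bounded_along L0 f_C1 lipx lipu Bx (U + `|eps| * H) (ltW ab).
exists B => s as_ sb; apply: HB => //; first exact: hx.
by rewrite (le_trans (ler_normD _ _))// normrZ lerD ?hU// ler_wpM2l// hH.
Qed.

Let int_kernel (g : R -> 'rV[R]_n) t i : continuous_off a b S g ->
  (exists B, forall s, a <= s -> s <= b -> `|g s| <= B) ->
  mu.-integrable setT (EFin \o (fun s => K (t - s) * ind a b s (g s ord0 i))).
Proof.
move=> cg [B gB]; apply: (@integrable_kernel_bounded _ a b p M B t K (fun s => g s ord0 i)) => //.
  exact: measurable_coord cg.
move=> s as_ sb; apply: le_trans (coord_norm_le _ _) _.
by apply: gB; exact: ltW.
Qed.

Let diff_volterra eps k t i : a <= t -> t <= b ->
  (k *: (X eps t - xs t)) ord0 i =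
  \int[mu]_s (K (t - s) * ind a b s ((k *: (F eps s - Fs s)) ord0 i)).
Proof.
move=> at_ tb.
have [_ _ /(_ t i at_ tb) e1] := X_sol eps; have [_ _ /(_ t i at_ tb) e2] := xs_sol.
have i1 := int_kernel t i (@cF eps) (bF eps); have i2 := int_kernel t i cFs bFs.
have key (s : R) : K (t - s) * ind a b s ((k *: (F eps s - Fs s)) ord0 i) =
   k * (K (t - s) * ind a b s (F eps s ord0 i) - K (t - s) * ind a b s (Fs s ord0 i)).
  by rewrite !mxE; case: ifP => _; ring.
under eq_Rintegral do rewrite key.
have i3 := integrableB measurableT i1 i2.
rewrite RintegralZl// RintegralB// -e1 -e2 !mxE; ring.
Qed.

Let pker_const : exists P, forall t B, 0 <= B ->
  \int[mu]_s (pker p (t - s) * ind a b s B) <= P * B.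
Proof.
have m1 (B : R) : measurable_fun setT (fun s : R => ind a b s B).
  by apply: (@measurable_continuous_off _ a b [::] (fun=> B)) => s _ _ _; exact: cvg_cst.
have i1 : mu.-integrable setT (EFin \o (fun s => ind a b s (1 : R))).
  by apply: (@integrable_bounded_itv _ a b 1 (fun=> 1)) => // s _ _; rewrite normr1.
exists (expR 1 * (1 `^ (- p) * \int[mu]_s gker p s) + 1 `^ (1 - p) * \int[mu]_s ind a b s (1 : R)).
move=> t B B0.
have := integral_pker_le t p0 p1 ltr01 B0 (m1 B); move/(_ (fun s _ _ => _)).
have -> : \int[mu]_s ind a b s B = B * \int[mu]_s ind a b s (1 : R).
  by rewrite -RintegralZl//; apply: eq_Rintegral => s _; case: ifP => _; rewrite ?mulr1 ?mulr0.
move=> le1; apply: le_trans (le1 _) _; first by move=> *; rewrite B0 lexx.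
by rewrite le_eqVlt; apply/orP; left; apply/eqP; ring.
Qed.

(** The free factor k covers two cases. For k = 1/eps this bounds the quotients; for eps = 0 every k
    is allowed, which forces [X 0] to coincide with [xs], so uniqueness comes as a by-product. The
    inhomogeneity is at most L |k eps| |h| <= L H. *)
Let apriori : exists C, forall eps k, `|k * eps| <= 1 -> forall t, a <= t -> t <= b ->
  `|k *: (X eps t - xs t)| <= C.
Proof.
have [C C0 HC] := volterra_gronwall ab p0 p1 M0 L0 mK KM.
have [P HP] := pker_const.
exists (C * (P * (L * H))) => eps k keps.
have [_ [B1 hB1] _] := X_sol eps; have [_ [B2 hB2] _] := xs_sol.
have LH0 : 0 <= L * H by rewrite mulr_ge0.
have N1 : 0 <= `|k| * (`|B1| + `|B2|) by rewrite mulr_ge0 ?addr_ge0.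
apply: (HC n (fun t => k *: (X eps t - xs t)) (fun s => k *: (F eps s - Fs s)) (fun=> L * H)
  (`|k| * (`|B1| + `|B2|) + L * H) (P * (L * H))).
- move=> i; apply: measurable_coord => t at_ tb tS.
  by apply: cvgZr; apply: cvgB; [exact: cF|exact: cFs].
- by apply: (@measurable_continuous_off _ a b [::] (fun=> L * H)) => s _ _ _; exact: cvg_cst.
- by move=> s _ _; rewrite LH0 lerDr.
- move=> t at_ tb; rewrite normrZ ler_wpDr// ler_wpM2l// (le_trans (ler_normB _ _))// lerD//.
    by rewrite (le_trans (hB1 t at_ tb))// ler_norm.
  by rewrite (le_trans (hB2 t at_ tb))// ler_norm.
- move=> s as_ sb; rewrite !normrZ.
  have := lipschitz_xu lipx lipu (X eps s) (xs s) (us s + eps *: h s) (us s) (ltW as_) (ltW sb).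
  move=> /(ler_wpM2l (normr_ge0 k)) h1; apply: le_trans h1 _.
  rewrite mulrCA -mulrDr ler_wpM2l// mulrDr lerD2l [us s + _]addrC addrK normrZ.
  by rewrite mulrA -normrM -[leRHS]mul1r ler_pM// hH// ltW.
- by move=> t i at_ tb; rewrite diff_volterra.
- by move=> t _ _; exact: HP.
Qed.

Let D eps v s := eps^-1 *: (f s (xs s + eps *: v) (us s + eps *: h s) - Fs s).

(** The increment has norm at most |eps| (C + H + 1) for every admissible v, so the error of the
    expansion divided by |eps| is small uniformly in v. This is needed because the direction will
    vary along a sequence. The 1 keeps the divisor positive. *)
Let directional C s : 0 <= C -> a <= s -> s <= b ->
  exists l : 'rV[R]_n -> 'rV[R]_n, forall e, 0 < e -> exists2 d, 0 < d &
    forall eps v, eps != 0 -> `|eps| < d -> `|v| <= C -> `|D eps v s - l v| <= e.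
Proof.
move=> C0 as_ sb; have [dg Hdg] := C1_on_expansion f_C1.
pose q := (s, xs s, us s).
have N0 : 0 < C + H + 1 by rewrite ltr_wpDl// addr_ge0.
exists (fun v => dg q (0, v, h s)) => e e0.
have [] := Hdg q (e / (C + H + 1)) _ (divr_gt0 e0 N0).
  by split => //; split => //=; rewrite in_itv/= as_.
move=> d d0 Hd; exists (d / (C + H + 1)); first by rewrite divr_gt0.
move=> eps v eps0 epsd vC.
pose r : R * 'rV[R]_n * 'rV[R]_m := (s, xs s + eps *: v, us s + eps *: h s).
have rE : r - q = eps *: ((0, v, h s) : R * 'rV[R]_n * 'rV[R]_m).
  congr (_, _, _) => /=; first by rewrite subrr [RHS]mulr0.
    by rewrite addrAC subrr add0r.
  by rewrite addrAC subrr add0r.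
have wN : `|((0, v, h s) : R * 'rV[R]_n * 'rV[R]_m)| <= C + H + 1.
  rewrite !prod_normE/= normr0 !ge_max (ltW N0)/=.
  by rewrite (le_trans vC) ?(le_trans (hH as_ sb))//; have := H0; lra.
have rN : `|r - q| <= `|eps| * (C + H + 1) by rewrite rE normrZ ler_wpM2l.
have rd : `|r - q| < d by apply: le_lt_trans rN _; rewrite -ltr_pdivlMr.
have rD : (`[a, b] `*` [set: 'rV[R]_n] `*` [set: 'rV[R]_m])%classic r.
  by split => //; split => //=; rewrite in_itv/= as_.
have := Hd r rD rd; rewrite {1}rE linearZ => {}Hd.
have {}Hd : `|f s (xs s + eps *: v) (us s + eps *: h s) - Fs s - eps *: dg q (0, v, h s)| <=
    e / (C + H + 1) * `|r - q| := Hd.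
have -> : D eps v s - dg q (0, v, h s) =
    eps^-1 *: (f s (xs s + eps *: v) (us s + eps *: h s) - Fs s - eps *: dg q (0, v, h s)).
  by rewrite [RHS]scalerBr scalerA mulVf// scale1r.
rewrite normrZ normfV ler_pdivrMl ?normr_gt0//; apply: le_trans Hd _.
apply: (@le_trans _ _ (e / (C + H + 1) * (`|eps| * (C + H + 1)))).
  by rewrite ler_wpM2l// divr_ge0// ltW.
by rewrite le_eqVlt; apply/orP; left; apply/eqP; field; rewrite gt_eqF.
Qed.

Let D_lip eps w1 w2 s : eps != 0 -> a <= s -> s <= b ->
  `|D eps w1 s - D eps w2 s| <= L * `|w1 - w2|.
Proof.
move=> eps0 as_ sb; rewrite /D -scalerBr opprB addrA subrK normrZ normfV ler_pdivrMl ?normr_gt0//.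
apply: le_trans (lipx _ _ _ as_ sb) _.
by rewrite opprD addrACA subrr add0r -scalerBr normrZ mulrCA.
Qed.

Let D_bound eps w s : eps != 0 -> a <= s -> s <= b -> `|D eps w s| <= L * (`|w| + H).
Proof.
move=> eps0 as_ sb; rewrite /D normrZ normfV ler_pdivrMl ?normr_gt0//.
apply: le_trans (lipschitz_xu lipx lipu _ _ _ _ as_ sb) _.
rewrite ![_ + eps *: _]addrC !addrK !normrZ -mulrDr mulrCA ler_wpM2l// ler_wpM2l// lerD2l.
exact: hH.
Qed.

Let V eps t := eps^-1 *: (X eps t - xs t).
Let G eps s := eps^-1 *: (F eps s - Fs s).

Let V_sol eps s : eps != 0 -> xs s + eps *: V eps s = X eps s.
Proof. by move=> eps0; rewrite /V scalerA divff// scale1r addrC subrK. Qed.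

Let D_V eps s : eps != 0 -> D eps (V eps s) s = G eps s.
Proof. by move=> eps0; rewrite /D V_sol. Qed.

Let cV eps : continuous_off a b S (V eps).
Proof.
move=> t at_ tb tS; apply: cvgZr; apply: cvgB; first exact: c_sol (X_sol eps) _ _ _ _.
exact: c_sol xs_sol _ _ _ _.
Qed.

Let cG eps : continuous_off a b S (G eps).
Proof. by move=> t at_ tb tS; apply: cvgZr; apply: cvgB; [exact: cF|exact: cFs]. Qed.

Let bG eps : exists B, forall s, a <= s -> s <= b -> `|G eps s| <= B.
Proof.
have [B1 h1] := bF eps; have [B2 h2] := bFs.
exists (`|eps^-1| * (B1 + B2)) => s as_ sb.
by rewrite normrZ ler_wpM2l// (le_trans (ler_normB _ _))// lerD ?h1 ?h2.
Qed.

Let cD eps del : continuous_off a b S (fun s => D eps (V del s) s).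
Proof.
have cx : continuous_off a b S (fun s => xs s + eps *: V del s).
  move=> t at_ tb tS; apply: cvgD; first exact: c_sol xs_sol _ _ _ _.
  by apply: cvgZr; exact: cV.
move=> t at_ tb tS; apply: cvgZr; apply: cvgB; last exact: cFs.
exact: (continuous_off_along L0 f_C1 lipx lipu cx (@cu eps)).
Qed.

(** G eps - G del splits at the quotient for eps in the direction [V del]. The first part is at most
    L |V eps - V del| by [D_lip] and goes into Gronwall; the second compares the quotients for eps
    and del in the same bounded direction and tends to 0. *)
Let cauchy_quotient e : 0 < e -> exists2 d, 0 < d & forall eps del, eps != 0 -> del != 0 ->
  `|eps| < d -> `|del| < d -> forall t, a <= t -> t <= b -> `|V eps t - V del t| <= e.
Proof.
move=> e0; apply: contrapT => nd.
(* Dominated convergence concerns sequences, so a failure of the claim is recorded along parameters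
   below 1 / (j + 1). *)
have /choice[ed Hed] : forall j : nat, exists z : R * R,
    [/\ z.1 != 0, z.2 != 0, `|z.1| < j.+1%:R^-1, `|z.2| < j.+1%:R^-1 &
     exists t, [/\ a <= t, t <= b & e < `|V z.1 t - V z.2 t|]].
  move=> j; apply: contrapT => nz; apply: nd; exists j.+1%:R^-1; first by rewrite invr_gt0.
  move=> eps del eps0 del0 epsj delj t at_ tb; rewrite leNgt; apply/negP => lt.
  by apply: nz; exists (eps, del); split => //; exists t.
have [C1 hC1] := apriori.
have VC eps t : eps != 0 -> a <= t -> t <= b -> `|V eps t| <= C1.
  by move=> eps0; apply: hC1; rewrite mulVf// normr1.
have C10 : 0 <= C1.
  have [e10 _ _ _ _] := Hed 0%N.
  by apply: le_trans (normr_ge0 _) (VC (ed 0%N).1 a e10 (lexx _) (ltW ab)).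
pose v j s := `|D (ed j).1 (V (ed j).2 s) s - D (ed j).2 (V (ed j).2 s) s|.
(* Gronwall takes a common bound: the first two terms bound v, the last two the difference of two
   quotients. *)
pose B := L * (C1 + H) + L * (C1 + H) + C1 + C1.
have LB : 0 <= L * (C1 + H) by rewrite mulr_ge0// addr_ge0.
have B0 : 0 <= B by rewrite /B; lra.
have vB j s : a < s -> s < b -> 0 <= v j s <= B.
  move=> /ltW as_ /ltW sb; rewrite normr_ge0/=.
  have [e10 e20 _ _ _] := Hed j.
  apply: (@le_trans _ _ (L * (C1 + H) + L * (C1 + H))); last by rewrite /B; lra.
  apply: le_trans (ler_normB _ _) _; apply: lerD.
    apply: le_trans (D_bound _ e10 as_ sb) _.
    by rewrite ler_wpM2l// lerD2r VC.
  apply: le_trans (D_bound _ e20 as_ sb) _.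
  by rewrite ler_wpM2l// lerD2r VC.
have mv j : measurable_fun setT (fun s => ind a b s (v j s)).
  apply: (@measurable_continuous_off _ a b S) => t at_ tb tS.
  by apply: cvg_norm; apply: cvgB; exact: cD.
have v0 s : a < s -> s < b -> v j s @[j --> \oo] --> (0 : R).
  move=> /ltW as_ /ltW sb; apply/cvgrPdist_le => e1 e10.
  have [l Hl] := directional C10 as_ sb.
  have e12 : 0 < e1 / 2 by rewrite divr_gt0.
  have [d d0 Hd] := Hl _ e12.
  near=> j.
  have jd : j.+1%:R^-1 < d by near: j; exact: near_infty_natSinv_lt (PosNum d0).
  have [j1 j2 j3 j4 _] := Hed j.
  rewrite sub0r normrN /v normr_id -(subrKA (l (V (ed j).2 s))) (le_trans (ler_normD _ _))//.
  rewrite [leRHS](splitr e1); apply: lerD.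
    by apply: Hd => //; [exact: lt_trans jd|exact: VC].
  by rewrite distrC; apply: Hd => //; [exact: lt_trans jd|exact: VC].
have cv : \int[mu]_s ind a b s (v j s) @[j --> \oo] --> (0 : R).
  apply: (bounded_convergence_itv (B := B)) => // j s as_ sb.
  by have /andP[vj0 vjB] := vB j s as_ sb; rewrite ger0_norm.
have [C C0 HC] := volterra_gronwall ab p0 p1 M0 L0 mK KM.
pose I := \int[mu]_s gker p s.
have I0 : 0 <= I by apply: Rintegral_ge0 => s _; exact: gker_ge0.
(* With lam^p = Y, the supremum term of [integral_pker_le], multiplied by C, is Q / Y <= e/2. *)
pose Q := C * (expR 1 * B) * I.
have Q0 : 0 <= Q by rewrite !mulr_ge0 ?expR_ge0.
pose Y := 2 * (Q + 1) / e.
have Y0 : 0 < Y by rewrite divr_gt0// mulr_gt0// ltr_wpDl.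
pose lam := Y `^ p^-1.
have lam0 : 0 < lam by rewrite powR_gt0.
have lamE : lam `^ (- p) = Y^-1.
  by rewrite powRN -powRrM mulVf ?gt_eqF// powRr1// ltW.
have first_half : C * (expR 1 * B * (lam `^ (- p) * I)) <= e / 2.
  have -> : C * (expR 1 * B * (lam `^ (- p) * I)) = Q / Y by rewrite lamE /Q; ring.
  rewrite ler_pdivrMr// /Y.
  have -> : e / 2 * (2 * (Q + 1) / e) = Q + 1 by field; rewrite gt_eqF.
  by rewrite lerDl.
(* Bounds the coefficient of the mean of v. As lam is already fixed, an index N can be taken with
   that mean below e / 2 / Z. *)
pose Z := C * lam `^ (1 - p) + 1.
have Z0 : 0 < Z by rewrite ltr_wpDl// mulr_ge0// powR_ge0.
have e2Z : 0 < e / 2 / Z by rewrite !divr_gt0.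
have /cvgrPdist_lt/(_ _ e2Z)[N _ HN] := cv.
have := HN N (leqnn N); rewrite /= sub0r normrN => intN.
have [j1 j2 _ _ [t [at_ tb]]] := Hed N.
apply/negP; rewrite -leNgt.
have E r : \int[mu]_s (pker p (r - s) * ind a b s (v N s)) <=
    expR 1 * B * (lam `^ (- p) * I) + lam `^ (1 - p) * \int[mu]_s ind a b s (v N s).
  by apply: integral_pker_le => // s; exact: vB.
have := HC n (fun t => V (ed N).1 t - V (ed N).2 t) (fun s => G (ed N).1 s - G (ed N).2 s) (v N) B _
  _ (mv N) (vB N) _ _ _ (fun r _ _ => E r) t at_ tb.
move=> H1; apply: le_trans (H1 _ _ _ _) _.
- move=> i; apply: measurable_coord => r ar rb rS.
  by apply: cvgB; exact: cG.
- move=> r ar rb; apply: le_trans (ler_normB _ _) _.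
  have := VC _ _ j1 ar rb; have := VC _ _ j2 ar rb; rewrite /B; lra.
- move=> s as_ sb.
  rewrite -(D_V _ j1) -(D_V _ j2) -(subrKA (D (ed N).1 (V (ed N).2 s) s)).
  by apply: le_trans (ler_normD _ _) _; rewrite lerD2r; apply: D_lip => //; exact: ltW.
- move=> r i ar rb.
  have i1 := int_kernel r i (@cG (ed N).1) (bG _); have i2 := int_kernel r i (@cG (ed N).2) (bG _).
  have key (s : R) : K (r - s) * ind a b s ((G (ed N).1 s - G (ed N).2 s) ord0 i) =
     K (r - s) * ind a b s (G (ed N).1 s ord0 i) - K (r - s) * ind a b s (G (ed N).2 s ord0 i).
    by rewrite !mxE; case: ifP => _; ring.
  under eq_Rintegral do rewrite key.
  by rewrite RintegralB// -!diff_volterra// !mxE.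
rewrite mulrDr [leRHS](splitr e); apply: lerD => //.
rewrite mulrA; apply: (@le_trans _ _ (Z * (e / 2 / Z))).
  apply: ler_pM; [by rewrite mulr_ge0// powR_ge0| |by rewrite /Z lerDl|].
    apply: Rintegral_ge0 => s _; case: ifPn => // /andP[as_ sb].
    by have /andP[] := vB N s as_ sb.
  exact: le_trans (ler_norm _) (ltW intN).
by rewrite mulrC divfK// gt_eqF.
Unshelve. all: end_near. Qed.

(** eta is the limit of the quotients along eps = 1 / (j + 1); the Cauchy property in two parameters
    carries the estimate over to every small eps. *)
Lemma sensitivity : exists eta : R -> 'rV[R]_n, forall t e, a <= t -> t <= b -> 0 < e ->
  exists2 d, 0 < d & forall eps, `|eps| < d -> `|X eps t - (xs t + eps *: eta t)| <= e * `|eps|.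
Proof.
pose r j : R := j.+1%:R^-1.
have r0 j : r j != 0 by rewrite invr_eq0 pnatr_eq0.
have rd d : 0 < d -> \forall j \near \oo, `|r j| < d.
  move=> d0; near=> j; rewrite ger0_norm ?invr_ge0//.
  by near: j; exact: near_infty_natSinv_lt (PosNum d0).
exists (fun t => lim (V (r j) t @[j --> \oo])) => t e at_ tb e0.
have cvgV : cvg (V (r j) t @[j --> \oo]).
  apply: cauchy_cvg; apply: cauchy_exP => e1 e10.
  have [d d0 Hd] := cauchy_quotient (divr_gt0 e10 (ltr0n R 2)).
  have [N _ HN] := rd d d0.
  exists (V (r N) t); exists N => // j /= Nj; rewrite -ball_normE/=.
  apply: le_lt_trans (Hd _ _ (r0 N) (r0 j) (HN N (leqnn N)) (HN j Nj) t at_ tb) _.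
  by rewrite ltr_pdivrMr// ltr_pMr// ltr1n.
set l := lim _.
have e2 := divr_gt0 e0 (ltr0n R 2).
have [d d0 Hd] := cauchy_quotient e2.
exists d => // eps epsd; have [->|eps0] := eqVneq eps 0.
  (* At eps = 0 the estimate demands [X 0 t] = [xs t]. Otherwise [apriori], with a factor that
     brings the difference to norm |C1| + 1, is contradicted. *)
  rewrite scale0r addr0 normr0 mulr0 normr_le0 -normr_eq0.
  have [C1 HC1] := apriori.
  apply/eqP; apply: contrapT => /eqP W0.
  have W1 : 0 < `|X 0 t - xs t| by rewrite lt_neqAle eq_sym W0 normr_ge0.
  have := HC1 0 ((`|C1| + 1) / `|X 0 t - xs t|); rewrite mulr0 normr0 => /(_ ler01 t at_ tb).
  rewrite normrZ [`|_ / _|]ger0_norm ?divr_ge0 ?addr_ge0// divfK ?gt_eqF//.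
  by rewrite leNgt => /negP; apply; rewrite ltr_pwDr// ler_norm.
have [j jd jl] : exists2 j, `|r j| < d & `|l - V (r j) t| < e / 2.
  near \oo => j; exists j; first by near: j; exact: rd.
  by near: j; move/cvgrPdist_lt : cvgV; exact.
have -> : X eps t - (xs t + eps *: l) = eps *: (V eps t - l).
  by rewrite -(V_sol t eps0) scalerBr opprD addrACA subrr add0r.
rewrite normrZ mulrC ler_wpM2r//.
rewrite -(subrKA (V (r j) t)) (le_trans (ler_normD _ _))// (splitr e) lerD//.
  exact: Hd.
by rewrite distrC ltW.
Unshelve. all: end_near. Qed.

End Sensitivity.

Theorem lemma14 (R : realType) (n m : nat) (le_mn : (m <= n)%N)
  (a b : R) (ltab : a < b)
  (alpha : R) (alpha01 : alpha \in `[0, 1])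
  (beta : R[i]) (beta_ge0 : 0 <= complex.Re beta)
  (rho rhobar : R) (rho_gt : (b - a) `^ complex.Re beta < rho)
  (rhobar_gt : (b - a) `^ complex.Re beta < rhobar)
  (c cbar : nat -> R[i]) (A Abar : R[i] -> R[i])
  (A_analytic : analytic_on_disc rho c A)
  (Abar_analytic : analytic_on_disc rhobar cbar Abar)
  (A_Abar : series_reciprocal (gamma_transform alpha beta c)
                              (gamma_transform (1 - alpha) beta cbar))
  (f : R -> 'rV[R]_n -> 'rV[R]_m -> 'rV[R]_n)
  (f_C1 : C1_on (`[a, b] `*` setT `*` setT)
    (fun p : R * 'rV[R]_n * 'rV[R]_m => f p.1.1 p.1.2 p.2))
  (f_lip_x : exists K : R, forall t u, t \in `[a, b] ->
    K.-lipschitz (fun x => f t x u))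
  (f_lip_u : exists K : R, forall t x, t \in `[a, b] ->
    K.-lipschitz (fun u => f t x u))
  (xa : 'rV[R]_n)
  (us : R -> 'rV[R]_m) (us_PC : PC a b us)
  (xs : R -> 'rV[R]_n)
  (xs_traj : state_trajectory Abar alpha beta a b f xa us xs)
  (h : R -> 'rV[R]_m) (h_PC : PC a b h)
  (xeps : R -> R -> 'rV[R]_n)
  (xeps_traj : forall eps : R, state_trajectory Abar alpha beta a b f xa
    (fun t => us t + eps *: h t) (xeps eps)) :
  exists eta : R -> 'rV[R]_n, forall t, t \in `[a, b] ->
    (fun eps : R => xeps eps t) =
      (fun eps : R => xs t + eps *: eta t) +o_ (0 : R) (fun eps : R => eps).

Proof.
have /andP[alpha0 alpha1] := series_reciprocal_order alpha01 A_Abar.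
have T0 : 0 < b - a by rewrite subr_gt0.
have [M [M0 HM _]] := fker_bound alpha T0 beta_ge0 rho_gt A_analytic.
have [mK _] := Cmeasurable_fker alpha T0 beta_ge0 rho_gt A_analytic.
have [Kx lipx] := f_lip_x; have [Ku lipu] := f_lip_u.
(* One constant for both arguments; the absolute values are there because the given constants carry
   no sign. *)
pose L := `|Kx| + `|Ku|.
have lipx' t x y u : a <= t -> t <= b -> `|f t x u - f t y u| <= L * `|x - y|.
  move=> at_ tb; have := lipx t u; rewrite in_itv/= at_ tb => /(_ isT (x, y) (conj I I)) h1.
  by apply: le_trans h1 _; rewrite ler_wpM2r// (le_trans (ler_norm _))// lerDl.
have lipu' t x u v : a <= t -> t <= b -> `|f t x u - f t x v| <= L * `|u - v|.
  move=> at_ tb; have := lipu t x; rewrite in_itv/= at_ tb => /(_ isT (u, v) (conj I I)) h1.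
  by apply: le_trans h1 _; rewrite ler_wpM2r// (le_trans (ler_norm _))// lerDr.
have [Su [cu bu]] := PC_continuous_off us_PC.
have [Sh [ch [H hH]]] := PC_continuous_off h_PC.
have cu' : continuous_off a b (Su ++ Sh) us.
  by move=> t at_ tb; rewrite mem_cat negb_or => /andP[tu _]; exact: cu.
have ch' : continuous_off a b (Su ++ Sh) h.
  by move=> t at_ tb; rewrite mem_cat negb_or => /andP[_ th]; exact: ch.
have sol u x := @trajectory_volterra R n m a b alpha rho rhobar beta c cbar A Abar ltab alpha0 alpha1
  beta_ge0 rho_gt A_analytic rhobar_gt Abar_analytic A_Abar f xa u x.
have KM t : `|volterra_kernel a b alpha beta A t| <= M * pker alpha t.
  by apply: le_trans (normr_Re_le _) (HM t).
have [eta Heta] := sensitivity ltab alpha0 alpha1 M0 mK KM (addr_ge0 (normr_ge0 Kx) (normr_ge0 Ku))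
  f_C1 lipx' lipu' cu' ch' bu hH (sol _ _ xs_traj) (fun eps => sol _ _ (xeps_traj eps)).
exists eta => t; rewrite in_itv/= => /andP[at_ tb]; apply/eqaddoP => e e0.
have [d d0 Hd] := Heta t e at_ tb e0.
by apply/nbhs_normP; exists d => //= eps; rewrite /ball_/= sub0r normrN; exact: Hd.
Qed.
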